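(* Assume that $\Gamma$ is unbounded and that $(\Omega,m,\mu)$ satisfies (H1)--(H6). Then there exist $k>1$ and $C>0$ such that for every $Q\in\mathbb D$ and every $u\in W$ such that $\mathrm{Tr}\,u=0$ $\mu$-a.e. on $2Q$, $$\left(\frac1{m(T_{2Q})}\int_{T_{2Q}}|u|^{2k}\,dm\right)^{\frac1{2k}}\le C\,\ell(Q)\left(\frac1{m(T_{2Q})}\int_{T_{2Q}}|\nabla u|^2\,dm\right)^{\frac12}.$$
   Context: Setting. $\Omega\subset\mathbb R^n$ is a domain (connected open set), $\Gamma=\partial\Omega$, $\delta(X)=\mathrm{dist}(X,\Gamma)$, $B(x,r)$ is the open ball and $\lambda B$ the concentric ball with radius multiplied by $\lambda$. $\Gamma$ is unbounded. $\mu$ is a Borel measure on $\Gamma$, positive and finite on balls centered on $\Gamma$, and $m$ is a measure on $\Omega$. Hypotheses: (H1) There is $C_1$ such that for all $x\in\Gamma$, $r>0$ there is $X\in B(x,r)$ with $B(X,C_1^{-1}r)\subset\Omega$. (H2) There is an integer $C_2=N+1$ such that, for every $r>0$, if $X,Y\in\Omega$, $\delta(X)>r$, $\delta(Y)>r$ and $|X-Y|\le 7C_1r$, there are points $Z_0=X,Z_1,\dots,Z_N=Y$ in $\Omega$ with $|Z_i-Z_{i+1}|<\frac12\delta(Z_i)$ for $0\le i<N$. (H3) $\mathrm{supp}\,\mu=\Gamma$ and $\mu(B(x,2r))\le C_3\mu(B(x,r))$ for $x\in\Gamma$, $r>0$. (H4) $dm=w\,dX$ with $w\in L^1_{loc}(\Omega)$,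 $w>0$ a.e., and $m(B(X,2r)\cap\Omega)\le C_4m(B(X,r)\cap\Omega)$ for $X\in\overline\Omega$, $r>0$. (H5) $\rho(x,r)=\frac{m(B(x,r)\cap\Omega)}{r\mu(B(x,r))}$ satisfies $\rho(x,r)/\rho(x,s)\le C_5(r/s)^{1-\epsilon}$ for $x\in\Gamma$, $0<s<r$, with $\epsilon=1/C_5$. (H6) (a) If $D$ is open and relatively compact in $\Omega$, $u_i\in C^\infty(\overline D)$, $\int_D|u_i|\,dm\to0$ and $\int_D|\nabla u_i-v|^2dm\to0$ for some vector-valued $v\in L^2(D,m)$, then $v=0$. (b) For every ball $B$ of radius $r$ with $2B\subset\Omega$ and every $u\in C^\infty(\overline B)$, $\frac1{m(B)}\int_B|u-u_B|dm\le C_6r\big(\frac1{m(B)}\int_B|\nabla u|^2dm\big)^{1/2}$, $u_B=\frac1{m(B)}\int_Bu\,dm$. Energy space. $W$ is the set of $u\in L^1_{loc}(\Omega,m)$ for which there are a vector-valued $v\in L^2(\Omega,m)$ and $\varphi_i\in C^\infty(\overline\Omega)$ with $\int_\Omega|\nabla\varphi_i|^2dm<\infty$, $\int_B|\varphi_i-u|dm\to0$ for every ball $B$ with $2B\subset\Omega$, and $\int_\Omega|\nabla\varphi_i-v|^2dm\to0$. By (H6) $v$ is unique; $\nabla u:=v$. Dyadic cubes on $\Gamma$. Fix a Christ dyadic decomposition $\mathbb D=\bigcup_{k\in\mathbb Z}\mathbb D_k$ of $(\Gamma,\mu)$, with $a_0>0$ depending only on $C_3$: each $\mathbb D_k$ is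 a partition of $\Gamma$ into measurable sets; if $\ell\ge k$, $Q'\in\mathbb D_\ell$, $Q\in\mathbb D_k$, then $Q'\subset Q$ or $Q'\cap Q=\emptyset$; each $Q\in\mathbb D_k$ has a unique ancestor in $\mathbb D_\ell$ for each $\ell<k$; $\mathrm{diam}\,Q\le2^{-k}$ and $Q\supset B(z_Q,a_02^{-k})\cap\Gamma$ for some $z_Q\in\Gamma$, when $Q\in\mathbb D_k$. A cube comes with its generation $k$, and $\ell(Q)=2^{-k}$; $\lambda Q=\{x\in\Gamma:\mathrm{dist}(x,Q)\le(\lambda-1)\ell(Q)\}$. Whitney regions. $\mathcal W$ is the collection of (true) dyadic cubes $I\subset\Omega$ of $\mathbb R^n$ such that $4\,\mathrm{diam}\,I\le\mathrm{dist}(4I,\Gamma)$ but the dyadic parent of $I$ does not satisfy the same inequality; $X_I$ is the center and $\ell(I)$ the side length of $I$. For $Q\in\mathbb D$, $\mathcal W_Q=\{I\in\mathcal W:\ C_a^{-1}\ell(Q)\le\ell(I),\ \mathrm{dist}(I,Q)\le2\ell(Q)\}$ with $C_a=1000C_1\sqrt n$, and $U_Q=\bigcup_{I\in\mathcal W_Q}I$; for $x\in\Gamma$, $\gamma(x)=\bigcup_{Q\in\mathbb D,\,Q\ni x}U_Q$. $\mathcal W^0_Q$ is the set of $I\in\mathcal W$ meeting $B(X,\delta(X)/2)$ for some $X\in U_Q\cup U_{Q'}$, $Q'$ the parent of $Q$. For any $I,I'\in\mathcal W^0_Q$ the centers $X_I,X_{I'}$ are linked by a Harnack chain: points $Z_0=X_I,\dots,Z_M=X_{I'}$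 with $|Z_i-Z_{i+1}|\le\frac12\delta(Z_i)$, $\delta(Z_i)\ge c\,\ell(Q)$, $|Z_i-X_I|\le C\ell(Q)$, with $M,c,C$ depending only on $n,C_1,C_2$, and associated balls $B(Z_i,\delta(Z_i)/2)$. $\mathcal W_Q^*$ is the set of cubes of $\mathcal W$ meeting at least one ball of these chains, $U_Q^*=\bigcup_{I\in\mathcal W_Q^*}I$. For $x\in\Gamma$, $\gamma_Q^*(x)=\bigcup\{U^*_{Q'}:\ Q'\in\mathbb D,\ x\in Q',\ \ell(Q')\le\ell(Q)\}$, and $T_{2Q}=\bigcup_{x\in2Q}\gamma_Q^*(x)$. Trace. For $u\in W$, $\mathrm{Tr}\,u(x)=\lim_{X\in\gamma(x),\,\delta(X)\to0}\frac1{m(B(X,\delta(X)/2))}\int_{B(X,\delta(X)/2)}u\,dm$, which exists for $\mu$-a.e. $x\in\Gamma$. *)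

(* Defs.v *)
From HB Require Import structures.
From mathcomp Require Import all_boot all_order all_algebra.
From mathcomp Require Import all_classical all_reals all_analysis.

Set Implicit Arguments.
Unset Strict Implicit.
Unset Printing Implicit Defensive.
Import Order.TTheory GRing.Theory Num.Theory.
Import numFieldNormedType.Exports.

Local Open Scope classical_set_scope.
Local Open Scope ring_scope.

(* R^n is 'rV[R]_n with its Borel sigma-algebra. *)
HB.instance Definition _ (R : realType) (m n : nat) :=
  Measurable.copy 'M[R]_(m, n) (g_sigma_algebraType (@open 'M[R]_(m, n))).

Section Euclidean.
Context {R : realType} {n : nat}.
Local Notation Rn := 'rV[R]_n.

(* The library norm and `ball` on 'rV[R]_n are those of the sup norm. They
   give the right topology, but the metric notions here are Euclidean. *)
Definition enorm (x : Rn) : R := Num.sqrt (\sum_(i < n) x ord0 i ^+ 2).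

Definition eball (x : Rn) (r : R) : set Rn := [set y | enorm (y - x) < r].

(* The infimum of the empty set is 0; these are only used on nonempty sets. *)
Definition dist (x : Rn) (A : set Rn) : R := inf [set enorm (x - y) | y in A].

Definition setdist (A B : set Rn) : R :=
  inf [set enorm (p.1 - p.2) | p in A `*` B].

(* Extended-real, so that a bound on the diameter implies boundedness. *)
Definition ediam (A : set Rn) : \bar R :=
  ereal_sup [set (enorm (p.1 - p.2))%:E | p in A `*` A].

Definition boundary (A : set Rn) : set Rn := closure A `\` A°.

Definition domain (Om : set Rn) : Prop :=
  [/\ open Om, connected Om & Om !=set0].

Definition delta (Om : set Rn) (X : Rn) : R := dist X (boundary Om).

End Euclidean.

(* Lebesgue measure on R^n, as the n-fold product of the Lebesgue measure of
   R: the measure of A is the iterated integral of its sections. *)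
Fixpoint leb (R : realType) (n : nat) : set 'rV[R]_n -> \bar R :=
  match n with
  | 0%N => fun A => (\1_A 0)%:E
  | n'.+1 => fun A =>
      (\int[@lebesgue_measure R]_t leb [set y : 'rV[R]_n' | A (row_mx t%:M y)])%E
  end.

Section Functions.
Context {R : realType} {n : nat}.
Local Notation Rn := 'rV[R]_n.

Definition evec (i : 'I_n) : Rn := delta_mx ord0 i.

Definition pderiv (s : seq 'I_n) (f : Rn -> R) : Rn -> R :=
  foldr (fun i g => fun x => 'D_(evec i) g x) f s.

Definition grad (f : Rn -> R) (x : Rn) : Rn := \row_i 'D_(evec i) f x.

(* C^oo of the closure of the open set U: f is smooth in U and each of its
   partial derivatives of any order extends continuously to the closure of U.
   Only the values of f in U matter. *)
Definition smooth_closure (U : set Rn) (f : Rn -> R) : Prop :=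
  forall s : seq 'I_n,
    (forall (i : 'I_n) x, U x -> derivable (pderiv s f) x (evec i)) /\
    (exists g : Rn -> R, {within closure U, continuous g} /\
       forall x, U x -> g x = pderiv s f x).

Definition L1loc (mu : set Rn -> \bar R) (U : set Rn) (f : Rn -> R) : Prop :=
  measurable_fun U f /\
  forall K, compact K -> K `<=` U -> (\int[mu]_(x in K) `|f x|%:E < +oo)%E.

Definition sqint (mu : set Rn -> \bar R) (U : set Rn) (v : Rn -> Rn) : \bar R :=
  (\int[mu]_(x in U) (enorm (v x) ^+ 2)%:E)%E.

Definition L2vec (mu : set Rn -> \bar R) (U : set Rn) (v : Rn -> Rn) : Prop :=
  measurable_fun U v /\ (sqint mu U v < +oo)%E.

Definition eavg (mu : set Rn -> \bar R) (A : set Rn) (f : Rn -> \bar R) :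
  \bar R := ((\int[mu]_(x in A) f x) / mu A)%E.

Definition avg (mu : set Rn -> \bar R) (A : set Rn) (f : Rn -> R) : R :=
  fine (eavg mu A (fun x => (f x)%:E)).

End Functions.

(* m is a measure on Om and mu one on boundary Om. Both are measures on R^n:
   only the values of m on subsets of Om are ever used, and H3 forces mu to
   be concentrated on boundary Om. *)
Section Hypotheses.
Context {R : realType} {n : nat}.
Local Notation Rn := 'rV[R]_n.
Implicit Types (Om : set Rn) (m mu : {measure set Rn -> \bar R}).

Definition finite_on_boundary_balls Om mu : Prop :=
  forall x r, boundary Om x -> 0 < r -> (0 < mu (eball x r) < +oo)%E.

Definition H1 Om (C1 : R) : Prop :=
  forall x r, boundary Om x -> 0 < r ->
    exists2 X, eball x r X & eball X (C1^-1 * r) `<=` Om.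

Definition H2 Om (C1 : R) (N : nat) : Prop :=
  forall (r : R) (X Y : Rn), 0 < r -> Om X -> Om Y ->
    r < delta Om X -> r < delta Om Y -> enorm (X - Y) <= 7 * C1 * r ->
    exists Z : nat -> Rn,
      [/\ Z 0%N = X, Z N = Y, forall i, (i <= N)%N -> Om (Z i) &
          forall i, (i < N)%N ->
            enorm (Z i - Z i.+1) < 2^-1 * delta Om (Z i)].

Definition supp mu : set Rn :=
  [set x : Rn | forall r, 0 < r -> (0 < mu (eball x r))%E].

Definition H3 Om mu (C3 : R) : Prop :=
  supp mu = boundary Om /\
  forall x r, boundary Om x -> 0 < r ->
    (mu (eball x (2 * r)) <= C3%:E * mu (eball x r))%E.

Definition H4 Om m (C4 : R) : Prop :=
  (exists w : Rn -> R,
     [/\ L1loc (@leb R n) Om w,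
         {ae @leb R n, forall x, Om x -> 0 < w x} &
         forall A, measurable A -> A `<=` Om ->
           m A = (\int[@leb R n]_(x in A) (w x)%:E)%E]) /\
  forall X r, closure Om X -> 0 < r ->
    (m (eball X (2 * r) `&` Om) <= C4%:E * m (eball X r `&` Om))%E.

Definition rho Om m mu (x : Rn) (r : R) : \bar R :=
  (m (eball x r `&` Om) / (r%:E * mu (eball x r)))%E.

Definition H5 Om m mu (C5 : R) : Prop :=
  forall x r s, boundary Om x -> 0 < s -> s < r ->
    (rho Om m mu x r / rho Om m mu x s <=
       (C5 * (r / s) `^ (1 - C5^-1))%:E)%E.

Definition H6a Om m : Prop :=
  forall (D : set Rn) (u : nat -> Rn -> R) (v : Rn -> Rn),
    open D -> compact (closure D) -> closure D `<=` Om ->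
    (forall i, smooth_closure D (u i)) -> L2vec m D v ->
    (\int[m]_(x in D) `|u i x|%:E)%E @[i --> \oo] --> 0%E ->
    sqint m D (fun x => grad (u i) x - v x) @[i --> \oo] --> 0%E ->
    {ae m, forall x, D x -> v x = 0}.

Definition H6b Om m (C6 : R) : Prop :=
  forall (X : Rn) (r : R) (u : Rn -> R),
    0 < r -> eball X (2 * r) `<=` Om -> smooth_closure (eball X r) u ->
    let B := eball X r in
    (eavg m B (fun x => `|u x - avg m B u|%:E) <=
       (C6 * r)%:E *
       poweR (eavg m B (fun x => (enorm (grad u x) ^+ 2)%:E)) 2^-1)%E.

(* u is in the energy space W, with gradient v. *)
Definition energy_gradient Om m (u : Rn -> R) (v : Rn -> Rn) : Prop :=
  [/\ L1loc m Om u, L2vec m Om v &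
      exists phi : nat -> Rn -> R,
        [/\ forall i, smooth_closure Om (phi i),
            forall i, (sqint m Om (grad (phi i)) < +oo)%E,
            forall X r, 0 < r -> eball X (2 * r) `<=` Om ->
              (\int[m]_(x in eball X r) `|phi i x - u x|%:E)%E
                @[i --> \oo] --> 0%E &
            sqint m Om (fun x => grad (phi i) x - v x)
              @[i --> \oo] --> 0%E]].

End Hypotheses.

Section Cubes.
Context {R : realType} {n : nat}.
Local Notation Rn := 'rV[R]_n.
Implicit Types (Om : set Rn) (k : int) (Q : set Rn).

(* The cubes of generation k on the boundary form the set D k of sets. The
   same set may be a cube of several generations, so a cube is always given
   as a pair of k and Q with D k Q. *)
Definition len k : R := 2 ^ (- k).

Definition christ_cubes Om (D : int -> set (set Rn)) (a0 : R) : Prop :=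
  [/\ forall k, partition (D k) id (boundary Om),
      forall k Q, D k Q -> measurable Q,
      forall k l Q Q', k <= l -> D l Q' -> D k Q ->
        Q' `<=` Q \/ Q' `&` Q = set0,
      forall k l Q, l < k -> D k Q -> exists! Q', D l Q' /\ Q `<=` Q' &
      forall k Q, D k Q ->
        (ediam Q <= (len k)%:E)%E /\
        exists2 z, boundary Om z & eball z (a0 * len k) `&` boundary Om `<=` Q].

Definition dilate Om (lam : R) k Q : set Rn :=
  [set x : Rn | boundary Om x /\ dist x Q <= (lam - 1) * len k].

(* (j, z) stands for the closed dyadic cube of R^n of side 2^-j whose lowest
   vertex is 2^-j z. *)
Definition dyadic : Type := (int * 'rV[int]_n)%type.

Definition side (I : dyadic) : R := 2 ^ (- I.1).

Definition center (I : dyadic) : Rn :=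
  \row_i (side I * ((I.2 ord0 i)%:~R + 2^-1)).

Definition dcube (lam : R) (I : dyadic) : set Rn :=
  [set x : Rn | forall i, `|x ord0 i - center I ord0 i| <= lam * side I / 2].

Definition dparent (I : dyadic) : dyadic :=
  (I.1 - 1, \row_i (I.2 ord0 i %/ 2)%Z).

Definition far_from_boundary Om (I : dyadic) : Prop :=
  (4%:E * ediam (dcube 1 I) <= (setdist (dcube 4 I) (boundary Om))%:E)%E.

Definition whitney Om : set dyadic :=
  [set I | [/\ dcube 1 I `<=` Om, far_from_boundary Om I &
               ~ far_from_boundary Om (dparent I)]].

Definition whitneyQ Om (C1 : R) k Q : set dyadic :=
  [set I | [/\ whitney Om I,
               (1000 * C1 * Num.sqrt n%:R)^-1 * len k <= side I &
               setdist (dcube 1 I) Q <= 2 * len k]].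

Definition regionU Om (C1 : R) k Q : set Rn :=
  \bigcup_(I in whitneyQ Om C1 k Q) dcube 1 I.

Definition cone Om (C1 : R) (D : int -> set (set Rn)) (x : Rn) : set Rn :=
  [set X : Rn | exists k Q, [/\ D k Q, Q x & regionU Om C1 k Q X]].

Definition whitney0 Om (C1 : R) (D : int -> set (set Rn)) k Q : set dyadic :=
  [set I | whitney Om I /\
     exists X,
       (regionU Om C1 k Q X \/
        exists Q', [/\ D (k - 1) Q', Q `<=` Q' & regionU Om C1 (k - 1) Q' X]) /\
       dcube 1 I `&` eball X (delta Om X / 2) !=set0].

(* Z k Q I I' is the chosen chain from center I to center I'. All chains have
   the same number of points, which is no restriction: points may repeat. *)
Definition harnack_chains Om (C1 : R) (D : int -> set (set Rn))
    (M : nat) (c C : R)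
    (Z : int -> set Rn -> dyadic -> dyadic -> nat -> Rn) : Prop :=
  forall k Q I I', D k Q ->
    whitney0 Om C1 D k Q I -> whitney0 Om C1 D k Q I' ->
    let z := Z k Q I I' in
    [/\ z 0%N = center I, z M = center I',
        forall i, (i < M)%N -> enorm (z i - z i.+1) <= 2^-1 * delta Om (z i),
        forall i, (i <= M)%N -> c * len k <= delta Om (z i) &
        forall i, (i <= M)%N -> enorm (z i - center I) <= C * len k].

Definition whitney_star Om (C1 : R) (D : int -> set (set Rn)) (M : nat)
    (Z : int -> set Rn -> dyadic -> dyadic -> nat -> Rn) k Q : set dyadic :=
  [set I | whitney Om I /\
     exists J J' i, [/\ whitney0 Om C1 D k Q J, whitney0 Om C1 D k Q J',
       (i <= M)%N &
       dcube 1 I `&` eball (Z k Q J J' i) (delta Om (Z k Q J J' i) / 2)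
         !=set0]].

Definition region_star Om (C1 : R) (D : int -> set (set Rn)) (M : nat)
    (Z : int -> set Rn -> dyadic -> dyadic -> nat -> Rn) k Q : set Rn :=
  \bigcup_(I in whitney_star Om C1 D M Z k Q) dcube 1 I.

(* The truncated cone depends on the cube Q only through its generation k. *)
Definition cone_star Om (C1 : R) (D : int -> set (set Rn)) (M : nat)
    (Z : int -> set Rn -> dyadic -> dyadic -> nat -> Rn) k (x : Rn) : set Rn :=
  [set X : Rn | exists k' Q', [/\ D k' Q', Q' x, len k' <= len k &
                             region_star Om C1 D M Z k' Q' X]].

Definition tent2 Om (C1 : R) (D : int -> set (set Rn)) (M : nat)
    (Z : int -> set Rn -> dyadic -> dyadic -> nat -> Rn) k Q : set Rn :=
  \bigcup_(x in dilate Om 2 k Q) cone_star Om C1 D M Z k x.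

Definition cone_filter Om (C1 : R) (D : int -> set (set Rn)) (x : Rn) :
    set_system Rn :=
  filter_from [set e : R | 0 < e]
    (fun e => cone Om C1 D x `&` [set X : Rn | delta Om X < e]).

(* Tr u (x) exists and is equal to l. *)
Definition has_trace Om (m : {measure set Rn -> \bar R}) (C1 : R)
    (D : int -> set (set Rn)) (u : Rn -> R) (x : Rn) (l : R) : Prop :=
  avg m (eball X (delta Om X / 2)) u @[X --> cone_filter Om C1 D x] --> l.

End Cubes.

Arguments dyadic : clear implicits.

(* Main.v *)
(** For a function f and a dyadic cube I inside Om, let f_I be the average of f
    over the ball inscribed in I. By (H6)(b), f_I changes by at most
    C 2^-i (E_i / m_i)^(1/2) between neighbouring cubes of side comparable to 2^-i,
    where E_i is the energy and m_i the mass in a ball of radius comparable to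
    2^-i; one center of this ball serves for all the steps made at scale i.
    Telescoping from a fixed large cube I0 of the tent T = T_{2Q}
    - down to a point X of T bounds |f(X) - f_I0| by the sum of these costs over
      the scales of T. As m is doubling, m(T) <= D^(p+2) m_i at the p-th scale, so
      that for k close enough to 1 the k-th power of the square of that sum is at
      most C V(X), with V(X) a sum of the E_i / m_i with geometric weights. The
      balls of one scale have bounded overlap, so V is integrable over T and its
      integral is at most a multiple of the energy;
    - down to a point x of Q along its cone, where f has trace 0, bounds |f_I0|
      by the sum of the costs. (H5) says that 4^-p / m_i is at most C eta^p times
      (mu(Q) / m(T)) / mu_i with eta < 1, so the costs can be integrated over Q
      with respect to mu instead.
    This gives the inequality for smooth functions up to the term f_I0, which is
    continuous in the energy space, and Fatou's lemma passes to the limit.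
    If m(Om) = 0 everything vanishes; otherwise all balls have positive mass. *)
From mathcomp Require Import all_boot all_order all_algebra.
From mathcomp Require Import all_classical all_reals all_analysis.
From mathcomp Require Import measurable_realfun ring lra zify.
Require Import Defs.
Set Implicit Arguments.
Unset Strict Implicit.
Unset Printing Implicit Defensive.
Import Order.TTheory GRing.Theory Num.Theory.
Import numFieldNormedType.Exports.
Local Open Scope classical_set_scope.
Local Open Scope ring_scope.

(** * Euclidean balls and distances *)

Section Euclid.
Context {R : realType} {n : nat}.
Local Notation Rn := 'rV[R]_n.
Implicit Types (x y z : Rn) (r s : R) (A B : set Rn).

(** The two estimates are applied to different functions. Passing from averages over shrinking cubes
    to a pointwise value uses continuity, so the Sobolev part is proved for the smooth approximants.
    A vanishing trace need not pass from [u] to these, so the bound on the top average is proved for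
    [u] itself, after extending (H6)(b) to [u] with [v] in place of the gradient. The two estimates
    meet in the average over the inscribed ball of [I0], which converges by the definition of [W].
    The chaining must stay inside [T], so that only the energy over [T] appears, although [T] is an
    irregular union of Whitney cubes of different sizes, linked by chains of balls. Cubes of
    comparable size are therefore cut into cells of one generation: a cell meeting a chain ball lies
    in a Whitney cube of the tent, and cells meeting a common ball are joined through common faces.
    Since (H6)(b) concerns balls, the basic step compares two nested balls, and adjacent cells are
    compared through a ball centered on their common face. *)

Lemma enorm_ge0 x : 0 <= enorm x.
Proof. exact: sqrtr_ge0. Qed.

Lemma sumsq_ge0 x : 0 <= \sum_(i < n) x ord0 i ^+ 2.
Proof. by apply: sumr_ge0 => i _; exact: sqr_ge0. Qed.

Lemma enorm_sq x : enorm x ^+ 2 = \sum_(i < n) x ord0 i ^+ 2.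
Proof. by rewrite sqr_sqrtr// sumsq_ge0. Qed.

Lemma enorm0 : enorm (0 : Rn) = 0.
Proof. by rewrite /enorm big1 ?sqrtr0// => i _; rewrite mxE expr0n. Qed.

Lemma enormZ a x : enorm (a *: x) = `|a| * enorm x.
Proof.
rewrite /enorm -sqrtr_sqr -sqrtrM ?sqr_ge0// mulr_sumr.
by congr Num.sqrt; apply: eq_bigr => i _; rewrite mxE exprMn.
Qed.

Lemma enormN x : enorm (- x) = enorm x.
Proof. by rewrite -scaleN1r enormZ normrN1 mul1r. Qed.

Lemma enormB x y : enorm (x - y) = enorm (y - x).
Proof. by rewrite -enormN opprB. Qed.

Lemma coord_le_enorm x i : `|x ord0 i| <= enorm x.
Proof.
rewrite -sqrtr_sqr ler_wsqrtr// (bigD1 i)//= lerDl.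
by apply: sumr_ge0 => j _; exact: sqr_ge0.
Qed.

Lemma enorm_eq0 x : enorm x = 0 -> x = 0.
Proof.
move=> x0; apply/rowP => i; rewrite mxE; apply/eqP.
by rewrite -normr_le0 -x0 coord_le_enorm.
Qed.

Lemma enorm_le_coord x a : (forall i, `|x ord0 i| <= a) -> 0 <= a ->
  enorm x <= Num.sqrt n%:R * a.
Proof.
move=> xa a0; rewrite -(ger0_norm a0) -sqrtr_sqr -sqrtrM ?ler0n//.
rewrite ler_wsqrtr// mulr_natl -[leRHS](_ : \sum_(i < n) a ^+ 2 = _).
  apply: ler_sum => i _; rewrite -real_normK ?num_real//.
  by rewrite lerXn2r ?nnegrE.
by rewrite sumr_const card_ord.
Qed.

(** Cauchy-Schwarz: sum [0 <= (b x_i - a y_i)^2] over the coordinates, where [a] and [b] are the two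
    norms; the division by [a b] is why vanishing norms are treated apart. *)
Lemma dot_le_enorm x y : \sum_(i < n) x ord0 i * y ord0 i <= enorm x * enorm y.
Proof.
set a := enorm x; set b := enorm y.
have [a0|a0] := eqVneq a 0.
  by rewrite a0 mul0r (enorm_eq0 a0) big1// => i _; rewrite mxE mul0r.
have [b0|b0] := eqVneq b 0.
  by rewrite b0 mulr0 (enorm_eq0 b0) big1// => i _; rewrite mxE mulr0.
have ab : 0 < a * b by rewrite mulr_gt0// lt_def ?a0 ?b0 enorm_ge0.
rewrite -(ler_pM2l ab) mulr_sumr.
apply: (@le_trans _ _ (\sum_(i < n) 2^-1 * (b ^+ 2 * x ord0 i ^+ 2 +
   a ^+ 2 * y ord0 i ^+ 2))).
  apply: ler_sum => i _.
  have := sqr_ge0 (b * x ord0 i - a * y ord0 i); nra.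
rewrite -mulr_sumr big_split/= -!mulr_sumr -!enorm_sq -/a -/b; nra.
Qed.

Lemma enormD x y : enorm (x + y) <= enorm x + enorm y.
Proof.
rewrite -[leLHS]ger0_norm ?enorm_ge0// -[leRHS]ger0_norm ?addr_ge0 ?enorm_ge0//.
rewrite -ler_sqr ?nnegrE// ?normr_ge0// !real_normK ?num_real//.
rewrite enorm_sq sqrrD !enorm_sq.
have -> : \sum_(i < n) (x + y) ord0 i ^+ 2 =
    \sum_(i < n) x ord0 i ^+ 2 + (\sum_(i < n) x ord0 i * y ord0 i) *+ 2 +
    \sum_(i < n) y ord0 i ^+ 2.
  rewrite -sumrMnl -!big_split/=; apply: eq_bigr => i _.
  by rewrite mxE sqrrD.
by rewrite lerD2r lerD2l lerMn2r/= dot_le_enorm.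
Qed.

Lemma enormD_sq x y : enorm (x + y) ^+ 2 <= 2 * enorm x ^+ 2 + 2 * enorm y ^+ 2.
Proof.
apply: (@le_trans _ _ ((enorm x + enorm y) ^+ 2)).
  by rewrite lerXn2r ?nnegrE ?addr_ge0 ?enorm_ge0// enormD.
by rewrite -subr_ge0 (_ : _ - _ = (enorm x - enorm y) ^+ 2) ?sqr_ge0//; ring.
Qed.

Lemma enorm_tri x y z : enorm (x - z) <= enorm (x - y) + enorm (y - z).
Proof. by rewrite -[x - z](subrKA y) enormD. Qed.

Lemma coord_continuousr (i : 'I_n) : continuous (fun x : Rn => x ord0 i).
Proof. exact: coord_continuous. Qed.

Lemma sum_continuous (T : topologicalType) (I : Type) (l : seq I) (F : I -> T -> R) :
  (forall i, continuous (F i)) -> continuous (fun t : T => \sum_(i <- l) F i t).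
Proof.
move=> cF; elim: l => [|a l IHs] x.
  rewrite (_ : (fun t => _) = fun=> 0); first exact: cst_continuous.
  by apply/funext => z; rewrite big_nil.
rewrite (_ : (fun t => _) = fun t : T => F a t + \sum_(i <- l) F i t).
  by apply: continuousD; [exact: cF|exact: IHs].
by apply/funext => z; rewrite big_cons.
Qed.

Lemma enorm_continuous : continuous (enorm : Rn -> R).
Proof.
move=> x; apply: (@continuous_comp _ _ _
  (fun x : Rn => \sum_(i < n) x ord0 i ^+ 2) (@Num.sqrt R)).
  apply: sum_continuous => i {}x.
  by apply: (@continuousM _ _ (fun x : Rn => x ord0 i) (fun x : Rn => x ord0 i));
    exact: coord_continuousr.
exact: sqrt_continuous.
Qed.

Lemma eball_open x r : open (eball x r).
Proof.
have -> : eball x r = (fun y => enorm (y - x)) @^-1` [set t | t < r] by [].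
apply: open_comp; last exact: open_lt.
move=> y _; apply: (@continuous_comp _ _ _ (fun y : Rn => y - x) enorm).
  by apply: continuousB; [exact: cvg_id|exact: cst_continuous].
exact: enorm_continuous.
Qed.

Lemma norm_le_enorm x : `|x| <= enorm x.
Proof.
rewrite [leLHS]mx_normrE; apply/bigmax_leP; split; first exact: enorm_ge0.
by move=> [i j] _ /=; rewrite ord1 coord_le_enorm.
Qed.

Lemma nbhs_eball x A : nbhs x A -> exists2 r, 0 < r & eball x r `<=` A.
Proof.
move=> /nbhs_ballP[r r0 rA]; exists r => // y yr; apply: rA.
rewrite -ball_normE /ball_/=; apply: le_lt_trans yr.
by rewrite distrC norm_le_enorm.
Qed.

Definition cball x r : set Rn := [set y | enorm (y - x) <= r].

Lemma cball_closed x r : closed (cball x r).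
Proof.
have -> : cball x r = (fun y => enorm (y - x)) @^-1` [set t | t <= r] by [].
apply: closed_comp; last exact: closed_le.
move=> y _; apply: (@continuous_comp _ _ _ (fun y : Rn => y - x) enorm).
  by apply: continuousB; [exact: cvg_id|exact: cst_continuous].
exact: enorm_continuous.
Qed.

Lemma cball_compact x r : compact (cball x r).
Proof.
apply: bounded_closed_compact; last exact: cball_closed.
rewrite /bounded_set /=; exists (enorm x + r); split; first exact: num_real.
move=> M rM y yr /=; apply: le_trans (norm_le_enorm _) _.
have := enormD x (y - x); rewrite addrC subrK => yx.
by apply: le_trans (ltW rM); apply: le_trans yx _; rewrite lerD2l.
Qed.

Lemma eball_cball x r : eball x r `<=` cball x r.
Proof. by move=> y /ltW. Qed.

Lemma eball_sub x y r s : enorm (x - y) + r <= s -> eball x r `<=` eball y s.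
Proof.
move=> h z; rewrite /eball/= => zr; apply: le_lt_trans (enorm_tri _ x _) _.
by apply: lt_le_trans h; rewrite addrC ltrD2l.
Qed.

Lemma dist_has_inf x A : A !=set0 -> has_inf [set enorm (x - y) | y in A].
Proof.
move=> [y Ay]; split; first by exists (enorm (x - y)), y.
by exists 0 => _ [z _ <-]; exact: enorm_ge0.
Qed.

Lemma dist_le x y A : A y -> dist x A <= enorm (x - y).
Proof.
by move=> Ay; apply: ge_inf; [apply: (dist_has_inf x (ex_intro _ y Ay)).2|exists y].
Qed.

Lemma dist_ge x A r : A !=set0 -> (forall y, A y -> r <= enorm (x - y)) ->
  r <= dist x A.
Proof.
move=> A0 h; apply: lb_le_inf; first exact: (dist_has_inf x A0).1.
by move=> _ [y Ay <-]; exact: h.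
Qed.

Lemma dist_lt x A r : A !=set0 -> dist x A < r -> exists2 y, A y & enorm (x - y) < r.
Proof.
move=> A0 xr; have [_ [y Ay <-] yr] := inf_lt (dist_has_inf x A0).1 xr.
by exists y.
Qed.

Lemma dist_lip x y A : A !=set0 -> dist x A <= enorm (x - y) + dist y A.
Proof.
move=> A0; rewrite addrC -lerBlDr; apply: dist_ge => // z Az.
by rewrite lerBlDr addrC; apply: le_trans (enorm_tri _ y _); exact: dist_le.
Qed.

Lemma setdist_has_inf A B : A !=set0 -> B !=set0 ->
  has_inf [set enorm (p.1 - p.2) | p in A `*` B].
Proof.
move=> [a Aa] [b Bb]; split; first by exists (enorm (a - b)), (a, b).
by exists 0 => _ [z _ <-]; exact: enorm_ge0.
Qed.

Lemma setdist_le A B x y : A x -> B y -> setdist A B <= enorm (x - y).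
Proof.
move=> Ax By; apply: ge_inf; last by exists (x, y).
by apply: (setdist_has_inf (ex_intro _ x Ax) (ex_intro _ y By)).2.
Qed.

Lemma setdist_ge A B r : A !=set0 -> B !=set0 ->
  (forall x y, A x -> B y -> r <= enorm (x - y)) -> r <= setdist A B.
Proof.
move=> A0 B0 h; apply: lb_le_inf; first exact: (setdist_has_inf A0 B0).1.
by move=> _ [[x y] [/= Ax By] <-]; exact: h.
Qed.

Lemma setdist_lt A B r : A !=set0 -> B !=set0 -> setdist A B < r ->
  exists x y, [/\ A x, B y & enorm (x - y) < r].
Proof.
move=> A0 B0 xr; have [_ [[x y] [/= Ax By] <-] yr] := inf_lt (setdist_has_inf A0 B0).1 xr.
by exists x, y.
Qed.

Lemma segment_sub_connected (x y : Rn) :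
  connected [set x + t *: (y - x) | t in `[0, 1]%classic].
Proof.
apply: connected_continuous_connected; first exact: segment_connected.
apply: continuous_subspaceT => t.
apply: (@continuousD _ _ _ (fun=> x) (fun t : R => t *: (y - x))).
  exact: cst_continuous.
by apply: continuousZl; exact: cvg_id.
Qed.

Lemma boundary_notin (Om : set Rn) y : open Om -> boundary Om y -> ~ Om y.
Proof. by move=> oOm [_ yi] Oy; apply: yi; rewrite (interior_id _).1. Qed.

(** As [A] avoids the boundary, the open set [Om] and the closed set [closure Om] cut out the same
    part of it; this part is open, closed and nonempty in the connected set [A]. *)
Lemma connected_avoid_boundary (Om A : set Rn) : open Om -> connected A ->
  (A `&` Om) !=set0 -> (forall y, A y -> ~ boundary Om y) -> A `<=` Om.
Proof.
move=> oOm cA A0 Ab; suff AO : A `&` Om = A by rewrite -AO => y [].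
apply: cA => //; first by exists Om.
exists (closure Om); first exact: closed_closure.
apply/seteqP; split => y [Ay yO]; split => //; first exact: subset_closure.
apply: contrapT => nO; apply: (Ab _ Ay); split => //.
by rewrite ((interior_id _).1 oOm).
Qed.

(** The segment from [x] to a point of the ball is connected and too short to reach the boundary. *)
Lemma eball_delta_sub (Om : set Rn) x : open Om -> Om x ->
  eball x (delta Om x) `<=` Om.
Proof.
move=> oOm Ox y xy.
have H := connected_avoid_boundary oOm (@segment_sub_connected x y).
apply: H.
- exists x; split => //; exists 0; first by rewrite /= in_itv/= lexx ler01.
  by rewrite scale0r addr0.
- move=> z [t /=]; rewrite in_itv/= => /andP[t0 t1] <- /(@dist_le x).
  rewrite opprD addrA subrr sub0r enormN enormZ ger0_norm// => /(lt_le_trans xy).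
  by rewrite ltNge ler_piMl// enorm_ge0.
- by exists 1; [rewrite /= in_itv/= lexx ler01|rewrite scale1r addrC subrK].
Qed.

Lemma delta_gt0 (Om : set Rn) x : open Om -> boundary Om !=set0 -> Om x ->
  0 < delta Om x.
Proof.
move=> oOm b0 Ox; have [r r0 rO] := nbhs_eball (open_nbhs_nbhs (conj oOm Ox)).
apply: (lt_le_trans r0); apply: dist_ge => // y /(boundary_notin oOm) yb.
by rewrite leNgt; apply/negP => xy; apply/yb/rO; rewrite /eball/= enormB.
Qed.

Lemma delta_ge (Om : set Rn) x r : open Om -> boundary Om !=set0 ->
  eball x r `<=` Om -> r <= delta Om x.
Proof.
move=> oOm b0 rO; apply: dist_ge => // y /(boundary_notin oOm) yb.
by rewrite leNgt; apply/negP => xy; apply/yb/rO; rewrite /eball/= enormB.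
Qed.

End Euclid.

(** * Dyadic and Whitney cubes *)

Section Dyadic.
Context {R : realType} {n : nat}.
Local Notation Rn := 'rV[R]_n.
Local Notation len := (@len R).
Local Notation sn := (Num.sqrt n%:R : R).
Implicit Types (x y X : Rn) (I : dyadic n) (z w : 'rV[int]_n) (g : int).

Lemma len_gt0 g : 0 < len g.
Proof. by rewrite /Defs.len exprz_gt0. Qed.

Lemma lenD g h : len (g + h) = len g * len h.
Proof. by rewrite /Defs.len opprD expfzDr. Qed.

Lemma len_nat (d : nat) : len d%:Z = 2^-1 ^+ d.
Proof. by rewrite /Defs.len -exprnN exprVn. Qed.

Lemma lenS (g : int) : len (g + 1) = len g / 2.
Proof. by rewrite lenD (len_nat 1) expr1. Qed.

Lemma lenP (g : int) : len (g - 1) = 2 * len g.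
Proof. by rewrite -{2}(subrK 1 g) lenS mulrC divfK. Qed.

Lemma len_le g h : (len g <= len h) = (h <= g).
Proof. by rewrite /Defs.len ler_eXz2l ?lerN2// ltr1n. Qed.

Lemma len_small (a : R) : 0 < a -> exists d : nat, len d%:Z <= a.
Proof.
move=> a0; exists (Num.Def.archi_bound a^-1).
rewrite len_nat exprVn -[leRHS]invrK lef_pV2 ?posrE ?invr_gt0 ?exprn_gt0//.
by apply: ltW; exact: upper_nthrootP.
Qed.

Lemma len_big (a : R) : exists d : nat, a < len (- d%:Z).
Proof.
exists (Num.Def.archi_bound a).
by rewrite /Defs.len opprK; exact: upper_nthrootP.
Qed.

Lemma sideE g z : side (g, z) = len g :> R.
Proof. by []. Qed.

Lemma side_gt0 I : 0 < side I :> R.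
Proof. exact: len_gt0. Qed.

Lemma dcube1P g z x : dcube 1 (g, z) x <->
  forall i, len g * (z ord0 i)%:~R <= x ord0 i <= len g * ((z ord0 i)%:~R + 1).
Proof.
rewrite /dcube/=; split => h i; have := h i.
  by rewrite ler_distl /center mxE/= sideE; move: (len g) => a; lra.
by rewrite ler_distl /center mxE/= sideE; move: (len g) => a; lra.
Qed.

(** The closed cubes of one generation overlap along their faces; the half-open grid assigns exactly
    one of them to each point. *)
Definition dcell g x : dyadic n := (g, \row_i Num.floor (x ord0 i / len g)).

Lemma dcellP g z x : dcell g x = (g, z) <->
  forall i, len g * (z ord0 i)%:~R <= x ord0 i < len g * ((z ord0 i)%:~R + 1).
Proof.
have g0 := len_gt0 g; split => [[<-] i|h].
  rewrite mxE; have := floor_itv (x ord0 i / len g).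
  by rewrite ler_pdivlMr// ltr_pdivrMr// intrD mulrC [_ * len g]mulrC.
congr pair; apply/rowP => i; rewrite mxE; apply: floor_def.
by rewrite ler_pdivlMr// ltr_pdivrMr// intrD mulrC [_ * len g]mulrC.
Qed.

Lemma dcell_mem g x : dcube 1 (dcell g x) x.
Proof.
have /dcellP h : dcell g x = (g, (dcell g x).2) by [].
by apply/dcube1P => i; have /andP[-> /ltW ->] := h i.
Qed.

(** Ancestry of dyadic cubes expressed on integer indices, whatever the generation, so that it can
    be settled by integer arithmetic: [w] lies [d] generations below [z]. *)
Definition desc (d : nat) z w := forall i,
  2 ^+ d * z ord0 i <= w ord0 i < 2 ^+ d * (z ord0 i + 1).

Lemma desc0 z : desc 0 z z.
Proof. by move=> i; rewrite expr0 !mul1r lexx ltrDl. Qed.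

Lemma desc_trans (d e : nat) z w v : desc d z w -> desc e w v -> desc (d + e) z v.
Proof.
move=> zw wv i; have := zw i; have := wv i; rewrite exprD.
have : (0 : int) < 2 ^+ e by rewrite exprn_gt0.
move: (2 ^+ d : int) (2 ^+ e : int) (z ord0 i) (w ord0 i) (v ord0 i) => a b c f h.
nia.
Qed.

Lemma desc_sub (d : nat) g z w : desc d z w ->
  (dcube 1 (g + d%:Z, w) : set Rn) `<=` dcube 1 (g, z).
Proof.
move=> zw x /dcube1P h; apply/dcube1P => i.
have g0 := len_gt0 g; have := h i; have := zw i.
rewrite lenD len_nat -(ler_int R) -lezD1 -(ler_int R) !intrD !intrM !intrD rmorphXn/=.
rewrite exprVn => /andP[h1 h2].
have p0 : 0 < (2 ^+ d : R) by rewrite exprn_gt0.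
set p := (2 ^+ d : R) in h1 h2 p0 *.
move: (z ord0 i)%:~R (w ord0 i)%:~R h1 h2 => a b h1 h2 /andP[h3 h4].
apply/andP; split.
  apply: le_trans h3; rewrite -mulrA ler_pM2l// ler_pdivlMl//.
apply: (le_trans h4); rewrite -mulrA ler_pM2l// ler_pdivrMl//.
Qed.

Lemma dcell_desc g (d : nat) x : exists2 w, dcell (g + d%:Z) x = (g + d%:Z, w) &
  desc d (dcell g x).2 w.
Proof.
exists (dcell (g + d%:Z) x).2 => // i.
have /dcellP/(_ i) : dcell g x = (g, (dcell g x).2) by [].
have /dcellP/(_ i) : dcell (g + d%:Z) x = (g + d%:Z, (dcell (g + d%:Z) x).2) by [].
rewrite lenD len_nat exprVn.
have p0 : 0 < (2 ^+ d : R) by rewrite exprn_gt0.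
have g0 := len_gt0 g.
set a := (dcell g x).2 ord0 i; set b := (dcell (g + d%:Z) x).2 ord0 i.
move=> /andP[h1 h2] /andP[h3 h4].
have := le_lt_trans h1 h4; have := le_lt_trans h3 h2.
rewrite -!mulrA !ltr_pM2l// ltr_pdivlMl// ltr_pdivrMl// => k1 k2.
by apply/andP; split; [rewrite -ltzD1|]; rewrite -(ltr_int R) !(intrD, intrM) rmorphXn.
Qed.

Lemma dcube_diff I (lam mu : R) x y : 0 <= lam -> 0 <= mu -> dcube lam I x -> dcube mu I y ->
  enorm (x - y) <= sn * ((lam + mu) / 2 * side I).
Proof.
move=> l0 m0 hx hy; apply: enorm_le_coord => [i|]; last first.
  by rewrite !mulr_ge0 ?addr_ge0 ?invr_ge0// ltW// side_gt0.
rewrite !mxE; have := hx i; have := hy i; rewrite !ler_distl.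
by move: (side I) (center I ord0 i) => a b; lra.
Qed.

Lemma center_mem I (lam : R) : 0 <= lam -> dcube lam I (center I).
Proof.
by move=> l0 i; rewrite subrr normr0 !mulr_ge0 ?invr_ge0// ltW// side_gt0.
Qed.

Lemma dcube_diam I x y : dcube 1 I x -> dcube 1 I y -> enorm (x - y) <= sn * side I.
Proof.
move=> hx hy; have := dcube_diff ler01 ler01 hx hy.
by rewrite (_ : (1 + 1) / 2 = 1 :> R) ?mul1r//; lra.
Qed.

Lemma dcube_center I x : dcube 1 I x -> enorm (x - center I) <= sn * (side I / 2).
Proof.
move=> hx; have := dcube_diff ler01 (lexx 0) hx (center_mem I (lexx 0)).
by rewrite addr0 mul1r [2^-1 * _]mulrC.
Qed.

Lemma dcube_mono I (lam mu : R) : lam <= mu -> (dcube lam I : set Rn) `<=` dcube mu I.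
Proof.
move=> lm x h i; apply: le_trans (h i) _.
by rewrite ler_pM2r ?invr_gt0// ler_pM2r// side_gt0.
Qed.

Lemma eball_sub_dcube I : (eball (center I) (side I / 2) : set Rn) `<=` dcube 1 I.
Proof.
move=> x xr i; rewrite mul1r; apply: le_trans (ltW xr).
by have := coord_le_enorm (x - center I) i; rewrite !mxE.
Qed.

Lemma ediam_dcube I : (ediam (dcube 1 I : set Rn) = (sn * side I)%:E)%E.
Proof.
apply/eqP; rewrite eq_le; apply/andP; split.
  apply: ge_ereal_sup => _ [[x y] [/= hx hy] <-].
  by rewrite lee_fin; exact: dcube_diam.
apply: le_ereal_sup_tmp.
pose a t : Rn := center I + const_mx t.
exists (enorm (a (side I / 2) - a (- (side I / 2))))%:E.
  exists (a (side I / 2), a (- (side I / 2))) => //.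
  have s0 := side_gt0 I.
  split => i /=; rewrite !mxE addrAC subrr add0r mul1r ?normrN ger0_norm//; lra.
rewrite lee_fin /enorm (eq_bigr (fun=> side I ^+ 2)); last first.
  by move=> i _; rewrite !mxE; congr (_ ^+ 2); move: (side I) => s; lra.
rewrite sumr_const card_ord -[X in _ <= Num.sqrt X]mulr_natl sqrtrM ?ler0n// sqrtr_sqr ger0_norm//.
exact/ltW/side_gt0.
Qed.

Lemma dparent_dcell g x : dparent (dcell g x) = dcell (g - 1) x.
Proof.
rewrite /dparent/=; congr pair; apply/rowP => i; rewrite !mxE; apply/esym.
apply: floor_def; rewrite lenP.
set a := x ord0 i; have g0 := len_gt0 g; have := floor_itv (a / len g).
set f := Num.floor _.
have -> : a / (2 * len g) = (a / len g) / 2 by field; lra.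
move: (a / len g) => t.
have : (2 * (f %/ 2)%Z <= f)%R && (f + 1 <= 2 * ((f %/ 2)%Z + 1)) by lia.
rewrite -!(ler_int R) !intrM !intrD.
move: (f%:~R) ((f %/ 2)%Z%:~R) => p q /andP[h1 h2] /andP[h3 h4].
by apply/andP; split; [rewrite ler_pdivlMr//|rewrite ltr_pdivrMr//]; lra.
Qed.

Lemma dparent_sub I : (dcube 1 I : set Rn) `<=` dcube 1 (dparent I).
Proof.
case: I => g z x /dcube1P h; apply/dcube1P => i; have := h i.
rewrite /dparent/= mxE lenP; set f := z ord0 i; have g0 := len_gt0 g.
have : (2 * (f %/ 2)%Z <= f)%R && (f + 1 <= 2 * ((f %/ 2)%Z + 1)) by lia.
rewrite -!(ler_int R) !intrM !intrD.
move: (f%:~R) ((f %/ 2)%Z%:~R) => p q /andP[h1 h2] /andP[h3 h4].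
apply/andP; split.
  by apply: le_trans h3; rewrite -mulrA mulrCA ler_pM2l//; lra.
by apply: le_trans h4 _; rewrite -mulrA mulrCA ler_pM2l//; lra.
Qed.

Lemma side_parent I : side (dparent I) = 2 * side I :> R.
Proof. by case: I => g z; rewrite /dparent !sideE lenP. Qed.

Section Whitney.
Variable Om : set Rn.
Hypotheses (n0 : (0 < n)%N) (oOm : open Om) (b0 : boundary Om !=set0).

Lemma sn_ge1 : 1 <= sn.
Proof. by rewrite -[leLHS]sqrtr1 ler_wsqrtr// ler1n. Qed.

Lemma farP I : far_from_boundary Om I <->
  4 * (sn * side I) <= setdist (dcube 4 I) (boundary Om).
Proof. by rewrite /far_from_boundary ediam_dcube -EFinM lee_fin. Qed.

Lemma far_dist I x y : far_from_boundary Om I -> dcube 4 I x -> boundary Om y ->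
  4 * (sn * side I) <= enorm (x - y).
Proof. by move=> /farP h Ix By; apply: le_trans h _; exact: setdist_le. Qed.

Lemma far_delta I x : far_from_boundary Om I -> dcube 4 I x ->
  4 * (sn * side I) <= delta Om x.
Proof. by move=> h Ix; apply: dist_ge => // y; exact: far_dist. Qed.

Lemma whitney_sub I : whitney Om I -> dcube 1 I `<=` Om.
Proof. by case. Qed.

Lemma whitney_dist I x y : whitney Om I -> dcube 1 I x -> boundary Om y ->
  4 * (sn * side I) <= enorm (x - y).
Proof.
move=> [_ f _] Ix; apply: far_dist => //.
by apply: dcube_mono Ix; rewrite ler1n.
Qed.

Lemma whitney_delta_ge I x : whitney Om I -> dcube 1 I x ->
  4 * (sn * side I) <= delta Om x.
Proof. by move=> h Ix; apply: dist_ge => // y; exact: whitney_dist. Qed.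

(** Since the parent is not far from the boundary, a point [p] of its fourfold dilate is within
    [8 sn side] of the boundary; [p] is within [5 sn side] of [x], and [8 + 5 < 16]. *)
Lemma whitney_delta_lt I x : whitney Om I -> dcube 1 I x ->
  delta Om x < 16 * (sn * side I).
Proof.
move=> [_ _ nf] Ix.
have /setdist_lt : setdist (dcube 4 (dparent I)) (boundary Om) <
    4 * (sn * side (dparent I)) by rewrite ltNge; apply/negP => /farP.
case=> //; first by exists (center (dparent I)); exact: center_mem.
move=> p [y [Ip By py]]; rewrite side_parent in py.
have h4 : (0 : R) <= 4 by [].
have := dcube_diff ler01 h4 (dparent_sub Ix) Ip; rewrite side_parent => xp.
have := dist_lip x p b0; rewrite -/(delta Om x).
have := dist_le p By; have := sn_ge1; have := side_gt0 I; nra.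
Qed.

(** The coarsest cell of [x] that is far from the boundary. Cells of side at most
    [delta Om x / (7 sn)] are far, because [4 + 5/2 < 7], while a cell of side above [delta Om x] is
    not, so a coarsest far cell exists and its parent is not far. *)
Lemma whitney_exists x : Om x -> exists g, whitney Om (dcell g x).
Proof.
move=> Ox; have d0 := delta_gt0 oOm b0 Ox; have s1 := sn_ge1.
have s0 : 0 < sn by apply: lt_le_trans s1.
have [k1 hk1] := len_big (delta Om x).
have [k2 hk2] := len_small (divr_gt0 d0 (mulr_gt0 (ltr0n _ 7) s0)).
have far2 : far_from_boundary Om (dcell k2%:Z x).
  apply/farP; apply: setdist_ge => //.
    by exists (center (dcell k2%:Z x)); exact: center_mem.
  move=> p y Ip By; have h4 : (0 : R) <= 4 by [].
  have := dcube_diff ler01 h4 (dcell_mem k2%:Z x) Ip; rewrite sideE => xp.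
  have := dist_le x By; rewrite -/(delta Om x) => xy.
  have := enorm_tri x p y; move: hk2; rewrite ler_pdivlMr ?mulr_gt0//.
  have := len_gt0 k2%:Z; nra.
have nfar1 : ~ far_from_boundary Om (dcell (- k1%:Z) x).
  move=> f1; have h4 : (1 : R) <= 4 by rewrite ler1n.
  have := far_delta f1 (dcube_mono h4 (dcell_mem (- k1%:Z) x)); rewrite sideE.
  have := len_gt0 (- k1%:Z); nra.
pose P (d : nat) := `[< far_from_boundary Om (dcell (d%:Z - k1%:Z) x) >].
have exP : exists d, P d.
  by exists (k2 + k1)%N; apply/asboolP; rewrite PoszD addrK.
case: (ex_minnP exP) => d /asboolP fd dmin; exists (d%:Z - k1%:Z).
have dpos : (0 < d)%N.
  by rewrite lt0n; apply/eqP => d00; apply: nfar1; rewrite d00 sub0r in fd.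
split => //.
- have h4 : (1 : R) <= 4 by rewrite ler1n.
  have := far_delta fd (dcube_mono h4 (dcell_mem _ x)) => xd p Ip.
  apply: (eball_delta_sub oOm Ox); rewrite /eball/=.
  apply: le_lt_trans (dcube_diam Ip (dcell_mem _ x)) _.
  apply: lt_le_trans xd; have := side_gt0 (dcell (d%:Z - k1%:Z) x); nra.
- rewrite dparent_dcell => f'; have : (d <= d.-1)%N.
    apply: dmin; apply/asboolP.
    by rewrite (_ : d.-1%:Z - k1%:Z = d%:Z - k1%:Z - 1)//; lia.
  by lia.
Qed.

End Whitney.
End Dyadic.

(** * Chains of dyadic cubes *)

Section Linking.
Context {R : realType} {n : nat}.
Local Notation Rn := 'rV[R]_n.
Local Notation len := (@len R).
Local Notation sn := (Num.sqrt n%:R : R).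
Implicit Types (x y X : Rn) (I : dyadic n) (z w : 'rV[int]_n) (g : int).

Lemma enorm_mono (x y : Rn) : (forall i, `|x ord0 i| <= `|y ord0 i|) ->
  enorm x <= enorm y.
Proof.
move=> h; rewrite /enorm ler_wsqrtr//; apply: ler_sum => i _.
by rewrite -(real_normK (num_real (x ord0 i))) -(real_normK (num_real (y ord0 i)))
  lerXn2r ?nnegrE.
Qed.

(** A point [y] of the closed cube may lie on a face that belongs to another half-open cell. A small
    move towards the center keeps it in the open ball and brings it inside the cell. *)
Lemma dcell_approx g z (y Z : Rn) (r : R) : dcube 1 (g, z) y -> eball Z r y ->
  exists2 P, eball Z r P & dcell g P = (g, z).
Proof.
move=> yI yZ; set c : Rn := center (g, z); set a := enorm (c - y) + 1.
have a0 : 0 < a by rewrite ltr_pwDr// enorm_ge0.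
set b := r - enorm (y - Z); have b0 : 0 < b by rewrite subr_gt0.
pose t := Num.min 1 (b / a / 2).
have t0 : 0 < t by rewrite /t lt_min ltr01 !divr_gt0.
have t1 : t <= 1 by rewrite /t ge_min lexx.
have tb : t * enorm (c - y) < b.
  apply: (@le_lt_trans _ _ (b / a / 2 * a)).
    apply: ler_pM; rewrite ?enorm_ge0//; first exact: ltW.
      by rewrite /t ge_min lexx orbT.
    by rewrite lerDl.
  by rewrite mulrAC divfK ?gt_eqF// ltr_pdivrMr// ltr_pMr// ltr1n.
exists (y + t *: (c - y)).
  rewrite /eball/= addrAC; apply: le_lt_trans (enormD _ _) _.
  by rewrite enormZ (ger0_norm (ltW t0)) -ltrBrDl.
apply/dcellP => i; have /dcube1P/(_ i) := yI.
rewrite /c !mxE sideE /=; have g0 := len_gt0 (R := R) g.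
move: (_)%:~R => u /andP[h1 h2]; move: (len g) (y ord0 i) g0 h1 h2 => l v g0 h1 h2.
apply/andP; split; nra.
Qed.

Lemma rvsubE (x y : Rn) k : (x - y) ord0 k = x ord0 k - y ord0 k.
Proof. by rewrite !mxE. Qed.

(** * Comparing averages over dyadic cubes by nested balls *)

Section Step.
Variables (Om T : set Rn) (av : Rn -> R -> R) (Y : Rn) (rad rmax rmin cost : R).

(** The only analytic input of the chaining. The function [av] of balls is abstract, which separates
    the geometry from the measure; the upper bound on the outer radius and the lower bound on the
    inner one are what make the masses of the two balls comparable. *)
Definition nested_bound := forall (z1 : Rn) (r1 : R) (z2 : Rn) (r2 : R),
  eball z2 r2 `<=` eball z1 r1 -> eball z1 r1 `<=` T -> eball z1 (2 * r1) `<=` Om ->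
  enorm (z1 - Y) <= rad -> r1 <= rmax -> rmin <= r2 -> 0 < r2 ->
  `|av z2 r2 - av z1 r1| <= cost.

Definition avd (I : dyadic n) : R := av (center I) (side I / 2).

(** Room for the balls used below: the inscribed ball and the ball of the same radius centered on a
    face have doubles of radius [side I], which stay in [Om]. *)
Definition good_cube I := [/\ dcube 1 I `<=` T,
  (forall x, dcube 1 I x -> eball x (side I) `<=` Om) &
  (forall x, dcube 1 I x -> enorm (x - Y) <= rad)].

Hypothesis nb : nested_bound.

Lemma nested_inner I (p : Rn) (r : R) : good_cube I -> side I / 2 <= rmax ->
  rmin <= r -> 0 < r -> eball p r `<=` eball (center I) (side I / 2) ->
  `|av p r - avd I| <= cost.
Proof.
move=> [IT IO IY] rM rm r0 pI; apply: nb => //.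
- exact: subset_trans (@eball_sub_dcube _ _ _) IT.
- by rewrite mulrC divfK//; apply/IO/center_mem.
- exact/IY/center_mem.
Qed.

(** The inscribed balls of adjacent cubes are not nested. The ball of radius [l / 2] at the center
    of the common face shares a ball of radius [l / 4] with each of them, which gives four nested
    pairs. *)
Lemma face_step g z i : let z' := z + delta_mx ord0 i in
  good_cube (g, z) -> good_cube (g, z') -> len g / 2 <= rmax ->
  rmin <= len g / 4 -> `|avd (g, z) - avd (g, z')| <= 4 * cost.
Proof.
move=> z' gz gz' rM rm.
set l := len g in rM rm *; have l0 : 0 < l := len_gt0 g.
pose a : Rn := center (g, z); pose e : Rn := delta_mx ord0 i.
have bE : center (g, z') = a + l *: e.
  apply/rowP => k; rewrite !mxE !sideE eqxx/= -/l !intrD.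
  by case: (k == i) => /=; rewrite ?mulr1 ?mulr0; ring.
have en : enorm e = 1.
  rewrite /enorm (bigD1 i)//= big1 ?addr0.
    by rewrite mxE !eqxx expr1n sqrtr1.
  by move=> k /negPf ki; rewrite mxE ki andbF expr0n.
have enl t : enorm (t *: e) = `|t| by rewrite enormZ en mulr1.
have pz : dcube 1 (g, z) (a + (l / 2) *: e).
  move=> k; rewrite !mxE/= addrAC subrr add0r mul1r sideE -/l normrM.
  rewrite ger0_norm; last by rewrite divr_ge0// ltW.
  by apply: ler_piMr; [rewrite divr_ge0// ltW|rewrite normr_nat lern1 leq_b1].
have l4 : 0 < l / 4 by rewrite divr_gt0.
have [zT zO zY] := gz; have [z'T _ _] := gz'.
have co t k : (a + t *: e) ord0 k = a ord0 k + t * (k == i)%:R.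
  by rewrite mxE [(t *: e) _ _]mxE [e _ _]mxE eqxx.
(* The hyperplane of the face cuts this ball into two halves, one in each cube. *)
have pT : eball (a + (l / 2) *: e) (l / 2) `<=` T.
  move=> y yp.
  have yk k : `|y ord0 k - (a + (l / 2) *: e) ord0 k| <= l / 2.
    apply: le_trans (ltW yp).
    by have := coord_le_enorm (y - (a + (l / 2) *: e)) k; rewrite rvsubE.
  have [yi|yi] := leP (y ord0 i) ((a + (l / 2) *: e) ord0 i).
    apply: zT => k; have := yk k; rewrite mul1r sideE -/l co.
    have [->|ki] := eqVneq k i; last by rewrite mulr0 addr0.
    move: yi; rewrite co !eqxx /= !mulr1 -/a.
    by move: (y ord0 i) (a ord0 i) => u v; rewrite !ler_norml; lra.
  apply: z'T => k; have := yk k; rewrite mul1r sideE -/l bE !co.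
  have [->|ki] := eqVneq k i; last by rewrite !mulr0 !addr0.
  move: yi; rewrite co !eqxx /= !mulr1.
  by move: (y ord0 i) (a ord0 i) => u v; rewrite !ler_norml; lra.
have step t : eball (a + t *: e) (l / 4) `<=` eball (a + (l / 2) *: e) (l / 2) ->
  `|av (a + t *: e) (l / 4) - av (a + (l / 2) *: e) (l / 2)| <= cost.
  move=> tsub; apply: nb => //; last exact: zY.
  by rewrite (_ : 2 * (l / 2) = l); [exact: zO|lra].
have sub t s r : `|t - s| + l / 4 <= r ->
    eball (a + t *: e) (l / 4) `<=` eball (a + s *: e) r.
  move=> h; apply: eball_sub; rewrite opprD addrACA subrr add0r -scalerBl enl.
  exact: h.
have h1 : `|av (a + (l / 4) *: e) (l / 4) - avd (g, z)| <= cost.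
  apply: nested_inner => //.
  rewrite -/a [X in _ `<=` eball X _](_ : a = a + 0 *: e) ?scale0r ?addr0//.
  rewrite -[X in _ `<=` eball X _]addr0 -(scale0r e).
  by apply: sub; rewrite subr0 (ger0_norm (ltW l4)) sideE -/l; lra.
have h2 : `|av (a + (3 * l / 4) *: e) (l / 4) - avd (g, z')| <= cost.
  apply: nested_inner => //; rewrite bE.
  apply: sub; rewrite distrC sideE -/l. rewrite ger0_norm. lra. lra.
have h3 := step (l / 4); have h4 := step (3 * l / 4).
have {}h3 := h3 (sub _ _ _ _); have {}h4 := h4 (sub _ _ _ _).
have {}h3 : `|av (a + (l / 4) *: e) (l / 4) - av (a + (l / 2) *: e) (l / 2)| <= cost.
  by apply: h3; rewrite distrC ger0_norm; lra.
have {}h4 : `|av (a + (3 * l / 4) *: e) (l / 4) - av (a + (l / 2) *: e) (l / 2)| <= cost.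
  by apply: h4; rewrite ger0_norm; lra.
move: h1 h2 h3 h4; rewrite !ler_norml.
move: (av _ _) (av _ _) (av _ _) (avd _) (avd _) => ? ? ? ? ?; lra.
Qed.

Lemma good_index_dist g z w : good_cube (g, z) -> good_cube (g, w) -> forall i,
  len g * (`|z ord0 i - w ord0 i|%N)%:R <= 2 * rad.
Proof.
move=> [_ _ h1] [_ _ h2] i; have g0 := len_gt0 (R := R) g.
have hz : enorm (center (g, z) - Y) <= rad by apply: h1; exact: center_mem.
have hw : enorm (center (g, w) - Y) <= rad by apply: h2; exact: center_mem.
have := le_trans (coord_le_enorm (center (g, z) - center (g, w)) i)
  (enorm_tri _ Y _).
rewrite [in X in _ <= X](enormB Y) !mxE !sideE -mulrBr normrM gtr0_norm//.
rewrite opprD addrACA subrr addr0 -intrB -intr_norm -abszE -pmulrn.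
by move=> h; apply: le_trans h _; lra.
Qed.

(** A walk by face steps that decrease the l1 distance to [t], so [S] only has to be stable under
    steps towards [t]. There are at most [2 n rad / len g] steps of cost [4 cost] each, whence the
    factor [8]. *)
Lemma path_bound g (S : set 'rV[int]_n) t (Np : R) :
  S t -> (forall z, S z -> good_cube (g, z)) ->
  (forall z i, S z -> z ord0 i < t ord0 i -> S (z + delta_mx ord0 i)) ->
  (forall z i, S z -> t ord0 i < z ord0 i -> S (z - delta_mx ord0 i)) ->
  len g / 2 <= rmax -> rmin <= len g / 4 -> 0 <= cost ->
  n%:R * (8 * rad) <= Np * len g ->
  forall z, S z -> `|avd (g, z) - avd (g, t)| <= Np * cost.
Proof.
move=> St Sg Sp Sm rM rm c0 hN.
have dz z : z != t -> exists i, z ord0 i != t ord0 i.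
  apply: contraNP => /forallNP h; apply/eqP/rowP => i.
  by apply/eqP; apply: contrapT => /negP; exact: h.
have main k : forall z, (\sum_(i < n) `|z ord0 i - t ord0 i|%N)%N = k -> S z ->
    `|avd (g, z) - avd (g, t)| <= k%:R * (4 * cost).
  elim: k => [|k IH] z zk Sz.
    have [->|/dz[i]] := eqVneq z t; first by rewrite subrr normr0 mul0r.
    move/eqP: zk; rewrite sum_nat_eq0 => /forallP/(_ i) /=.
    by rewrite absz_eq0 subr_eq0 => /eqP ->; rewrite eqxx.
  have [zt|/dz[i zi]] := eqVneq z t.
    by move: zk; rewrite zt big1// => i _; rewrite subrr.
  have sumE (z' : 'rV[int]_n) : (forall j, j != i -> z' ord0 j = z ord0 j) ->
      (`|z' ord0 i - t ord0 i|%N.+1 = `|z ord0 i - t ord0 i|%N)%N ->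
      (\sum_(i < n) `|z' ord0 i - t ord0 i|%N)%N = k.
    move=> zj zzi; apply: succn_inj; rewrite -zk (bigD1 i)//= -addSn zzi.
    by rewrite [RHS](bigD1 i)//=; congr addn; apply: eq_bigr => j /zj ->.
  have fin (z' : 'rV[int]_n) : (\sum_(i < n) `|z' ord0 i - t ord0 i|%N)%N = k ->
      S z' -> `|avd (g, z) - avd (g, z')| <= 4 * cost ->
      `|avd (g, z) - avd (g, t)| <= k.+1%:R * (4 * cost).
    move=> zk' Sz' h; have h' := IH z' zk' Sz'.
    have := ler_distD (avd (g, z')) (avd (g, z)) (avd (g, t)).
    by move/le_trans; apply; rewrite -natr1 mulrDl mul1r addrC lerD.
  have [zlt|zgt|zeq] := ltgtP (z ord0 i) (t ord0 i).
  - have Sz' := Sp z i Sz zlt; apply: (fin (z + delta_mx ord0 i)) => //.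
      apply: sumE => [j /negPf ji|]; rewrite !mxE ?ji ?andbF ?addr0// !eqxx/=.
      by move: zlt; move: (z ord0 i) (t ord0 i) => a b; lia.
    by apply: face_step => //; exact: Sg.
  - have Sz' := Sm z i Sz zgt; apply: (fin (z - delta_mx ord0 i)) => //.
      apply: sumE => [j /negPf ji|]; rewrite !mxE ?ji ?andbF ?subr0// !eqxx/=.
      by move: zgt; move: (z ord0 i) (t ord0 i) => a b; lia.
    have := @face_step g (z - delta_mx ord0 i) i; rewrite subrK distrC.
    by apply => //; exact: Sg.
  - by rewrite zeq eqxx in zi.
move=> z Sz; apply: le_trans (main _ z erefl Sz) _.
rewrite mulrA ler_wpM2r//; have g0 := len_gt0 (R := R) g.
rewrite -(ler_pM2r g0); apply: le_trans hN.
rewrite natr_sum mulrAC -mulrA mulr_suml.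
apply: (@le_trans _ _ (\sum_(i < n) 8 * rad)); last first.
  by rewrite sumr_const card_ord [leRHS]mulr_natl.
apply: ler_sum => i _.
have := good_index_dist (Sg _ Sz) (Sg _ St) i.
by move: (_)%:R => a; lra.
Qed.

(** For [0 < e], the descendant whose lowest vertex is the center of the cube: once [e] is large its
    inscribed ball lies in that of the cube. *)
Definition cdesc (e : nat) z : 'rV[int]_n := \row_i (2 ^+ e * z ord0 i + 2 ^+ e.-1).

Lemma desc_cdesc e z : (0 < e)%N -> desc e z (cdesc e z).
Proof.
case: e => // e _ i; rewrite mxE /= lerDl exprn_ge0//= mulrDr mulr1 ltrD2l.
by rewrite exprS ltr_pMl// exprn_gt0.
Qed.

Lemma good_desc g z d w : good_cube (g, z) -> desc d z w -> good_cube (g + d%:Z, w).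
Proof.
move=> [T1 O1 Y1] zw; have sub := @desc_sub R n d g z w zw; split.
- exact: subset_trans sub T1.
- move=> x /sub xz; apply: subset_trans (O1 x xz) => y; rewrite /eball/= !sideE => h.
  by apply: lt_le_trans h _; rewrite len_le lerDl.
- by move=> x /sub /Y1.
Qed.

(** One nested pair leads to the central descendant, whose inscribed ball fits because
    [(sn + 1) len e <= 1]; a walk among the descendants of the same generation leads from there to
    [w]. *)
Lemma descendant_bound g z e w (Np : R) : (0 < e)%N -> good_cube (g, z) ->
  desc e z w ->
  (sn + 1) * len e%:Z <= 1 -> len g / 2 <= rmax -> rmin <= len (g + e%:Z) / 4 ->
  0 <= cost -> n%:R * (8 * rad) <= Np * len (g + e%:Z) ->
  `|avd (g, z) - avd (g + e%:Z, w)| <= (Np + 1) * cost.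
Proof.
move=> e0 gz zw sn1 rM rm c0 hN.
have g0 := len_gt0 (R := R) g; have ge0 := len_gt0 (R := R) (g + e%:Z).
have glen : len (g + e%:Z) <= len g by rewrite len_le lerDl.
have h1 := desc_cdesc z e0.
have gd v : desc e z v -> good_cube (g + e%:Z, v) by exact: good_desc.
have sl : sn * len (g + e%:Z) + len (g + e%:Z) <= len g.
  by rewrite lenD; have := ler_wpM2l (ltW g0) sn1; lra.
have h2 : `|avd (g + e%:Z, cdesc e z) - avd (g, z)| <= cost.
  apply: (nested_inner gz) => //.
  - by apply: le_trans rm _; rewrite sideE; lra.
  - by rewrite sideE divr_gt0.
  apply: eball_sub; rewrite !sideE.
  have : enorm (center (g + e%:Z, cdesc e z) - center (g, z) : Rn) <=
      sn * (len (g + e%:Z) / 2).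
    apply: enorm_le_coord => [i|]; last by rewrite divr_ge0// ltW.
    rewrite rvsubE /center !mxE /= !sideE intrD intrM !rmorphXn/=.
    have -> : len g = len (g + e%:Z) * 2 ^+ e.
      by rewrite lenD len_nat exprVn -mulrA mulVf ?mulr1// expf_neq0// pnatr_eq0.
    rewrite -[X in 2 ^+ X](prednK e0) exprS.
    rewrite ler_norml; move: (len _) ge0 (2 ^+ e.-1) (z ord0 i)%:~R => l l0 p q.
    by lra.
  move: sl; lra.
have h3 : `|avd (g + e%:Z, w) - avd (g + e%:Z, cdesc e z)| <= Np * cost.
  apply: (@path_bound (g + e%:Z) [set v | desc e z v] (cdesc e z) Np h1 gd) => //.
  - move=> v i dv vt k; have := dv k; have := h1 k; rewrite !mxE /=.
    by have [ki|_] := eqVneq k i; [move: vt; rewrite ki !mxE /=|]; lia.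
  - move=> v i dv vt k; have := dv k; have := h1 k; rewrite !mxE /=.
    by have [ki|_] := eqVneq k i; [move: vt; rewrite ki !mxE /=|]; lia.
  - by apply: le_trans rM; rewrite ler_pM2r ?invr_gt0.
move: h2 h3; rewrite !ler_norml; move: (avd _) (avd _) (avd _) => a b d.
by move: (Np * cost) (mulrDl Np 1 cost) => u ->; lra.
Qed.

(** Both cubes are joined to the cell of the center [Z]. A cube meeting the ball still meets it
    after a step towards this cell, so the walk stays among cubes that are good. *)
Lemma ball_bound g z w (Z : Rn) (r Np : R) :
  (forall v, (dcube 1 (g, v) `&` eball Z r) !=set0 -> good_cube (g, v)) ->
  (dcube 1 (g, z) `&` eball Z r) !=set0 ->
  (dcube 1 (g, w) `&` eball Z r) !=set0 ->
  len g / 2 <= rmax -> rmin <= len g / 4 -> 0 <= cost ->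
  n%:R * (8 * rad) <= Np * len g ->
  `|avd (g, z) - avd (g, w)| <= 2 * (Np * cost).
Proof.
move=> hg hz hw rM rm c0 hN.
pose S : set 'rV[int]_n := [set v | (dcube 1 (g, v) `&` eball Z r) !=set0].
pose t := (dcell g Z).2.
have tP : forall i, len g * (t ord0 i)%:~R <= Z ord0 i < len g * ((t ord0 i)%:~R + 1).
  by apply/dcellP.
have r0 : 0 < r.
  by case: hz => y [_]; rewrite /eball/=; apply: le_lt_trans; exact: enorm_ge0.
have g0 := len_gt0 (R := R) g.
have St : S t.
  by exists Z; split; [exact: dcell_mem|rewrite /eball/= subrr enorm0].
have P := @path_bound g S t Np St hg _ _ rM rm c0 hN.
(* Replacing one coordinate of a point of the ball by one closer to that of [Z] keeps the point in
   the ball; the new coordinate [a] is taken on the face between the two cubes. *)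
have mv (v v' : 'rV[int]_n) (i : 'I_n) (a : R) : S v ->
    (forall k, k != i -> v' ord0 k = v ord0 k) ->
    (len g * (v' ord0 i)%:~R <= a <= len g * ((v' ord0 i)%:~R + 1)) ->
    (forall b : R, len g * (v ord0 i)%:~R <= b <= len g * ((v ord0 i)%:~R + 1) ->
       `|a - Z ord0 i| <= `|b - Z ord0 i|) -> S v'.
  move=> [y [/dcube1P yv yZ]] vk av' ya.
  exists (\row_k if k == i then a else y ord0 k); split.
    apply/dcube1P => k; rewrite mxE; have [->//|ki] := eqVneq k i.
    by rewrite vk.
  apply: le_lt_trans yZ; apply: enorm_mono => k; rewrite !rvsubE mxE.
  by have [->|//] := eqVneq k i; exact: ya.
have {}P : forall v, S v -> `|avd (g, v) - avd (g, t)| <= Np * cost.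
  apply: P => v i Sv.
    move=> vt; have := tP i.
    have : (v ord0 i + 1 <= t ord0 i)%R by rewrite lezD1.
    rewrite -(ler_int R) intrD => vt' /andP[tZ _].
    have vZ : len g * ((v ord0 i)%:~R + 1) <= Z ord0 i.
      by apply: le_trans tZ; rewrite ler_pM2l.
    apply: (mv v _ i (len g * ((v ord0 i)%:~R + 1))) => //.
    - by move=> k /negPf ki; rewrite !mxE ki andbF addr0.
    - by rewrite !mxE !eqxx/= intrD lexx/= ler_pM2l// lerDl.
    - move=> y /andP[_ y2]; rewrite !ler0_norm ?subr_le0//; last exact: le_trans vZ.
      by rewrite lerN2 lerD2r.
  move=> vt; have := tP i.
  have : (t ord0 i + 1 <= v ord0 i)%R by rewrite lezD1.
  rewrite -(ler_int R) intrD => vt' /andP[_ tZ].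
  have vZ : Z ord0 i <= len g * (v ord0 i)%:~R.
    by apply: le_trans (ltW tZ) _; rewrite ler_pM2l.
  apply: (mv v _ i (len g * (v ord0 i)%:~R)) => //.
  - by move=> k /negPf ki; rewrite !mxE ki andbF subr0.
  - rewrite !mxE !eqxx/= intrD rmorphN /= subrK lexx andbT ler_pM2l//.
    by rewrite gerDl lerN10.
  - move=> y /andP[y1 _]; rewrite !ger0_norm ?subr_ge0//; last exact: le_trans vZ _.
    by rewrite lerD2r.
have := P _ hz; have := P _ hw; rewrite !ler_norml.
by move: (avd _) (avd _) (avd _) (Np * cost) => ? ? ? ?; lra.
Qed.

End Step.
End Linking.

Lemma int_le_shift (a b : int) (d e : nat) : a + d%:Z <= b + e%:Z ->
  exists2 k : nat, b + e%:Z = a + k%:Z & (d <= k)%N.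
Proof. by move=> h; exists (absz (b + e%:Z - a)%R); lia. Qed.

(** * Telescoping in tents and cones *)

Section TentGeometry.
Context {R : realType} {n : nat}.
Local Notation Rn := 'rV[R]_n.
Local Notation len := (@len R).
Local Notation sn := (Num.sqrt n%:R : R).
Variables (Om : set Rn) (C1 : R) (D : int -> set (set Rn)) (a0 : R) (M : nat)
  (c C0 : R) (Z : int -> set Rn -> dyadic n -> dyadic n -> nat -> Rn).
Hypotheses (n0 : (0 < n)%N) (oOm : open Om) (b0 : boundary Om !=set0)
  (C1_gt0 : 0 < C1) (h1 : H1 Om C1) (hD : christ_cubes Om D a0)
  (c_gt0 : 0 < c) (C0_gt0 : 0 < C0) (hZ : harnack_chains Om C1 D M c C0 Z).
Implicit Types (x y X p : Rn) (I J : dyadic n) (i j : int) (Q : set Rn).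

Let s1 : 1 <= sn := sn_ge1 n0.

(** * Whitney regions of a boundary cube *)

Lemma cube_boundary i Q : D i Q -> Q `<=` boundary Om.
Proof.
move=> DQ; have [+ _ _ _ _] := hD => /(_ i)[<- _ _] y Qy; exists Q => //.
Qed.

Lemma cube_nonempty i Q : D i Q -> Q !=set0.
Proof. by move=> DQ; have [+ _ _ _ _] := hD => /(_ i)[_ _]; apply. Qed.

Lemma cube_exists i x : boundary Om x -> exists2 Q, D i Q & Q x.
Proof.
by have [+ _ _ _ _] := hD => /(_ i)[<- _ _] [Q]; exists Q.
Qed.

Lemma cube_diam i Q x y : D i Q -> Q x -> Q y -> enorm (x - y) <= len i.
Proof.
move=> DQ Qx Qy; have [_ _ _ _ /(_ i Q DQ)[+ _]] := hD.
by move=> /ereal_supP; rewrite -lee_fin; apply; exists (x, y).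
Qed.

Lemma cube_parent i Q Q' x : D i Q -> D (i - 1) Q' -> Q x -> Q' x -> Q `<=` Q'.
Proof.
move=> DQ DQ' Qx Q'x; have [_ _ /(_ (i - 1) i Q' Q) h _ _] := hD.
have ii : i - 1 <= i by rewrite gerBl.
case: (h ii DQ DQ') => // QQ.
by have : (Q `&` Q') x by []; rewrite QQ.
Qed.

(** The [2] of [W_Q] becomes [3] because the infimum need not be attained. The Whitney condition
    then gives [sn side <= 3/4 len i], and [3/4 + 3 + 1 < 5]. *)
Lemma whitneyQ_near i Q I x p : D i Q -> Q x -> whitneyQ Om C1 i Q I ->
  dcube 1 I p -> enorm (p - x) <= 5 * len i /\ sn * side I <= len i.
Proof.
move=> DQ Qx [wI _ sI] Ip; have l0 := len_gt0 (R := R) i.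
have : setdist (dcube 1 I) Q < 3 * len i.
  by apply: le_lt_trans sI _; rewrite ltr_pM2r// ltr_nat.
case/setdist_lt; [by exists p|by exists x|] => p0 [q [Ip0 Qq pq]].
have := whitney_dist wI Ip0 (cube_boundary DQ Qq).
have := cube_diam DQ Qq Qx; have := dcube_diam Ip Ip0.
have := enorm_tri p p0 x; have := enorm_tri p0 q x => ? ? ? ? ?; split; lra.
Qed.

Lemma delta_le_near x p : boundary Om x -> delta Om p <= enorm (p - x).
Proof. exact: dist_le. Qed.

(** [X] is within [10 len i] of [x], as the parent has twice the length; [y] is within
    [delta Om X / 2 <= 5 len i] of [X]; the diameter of the cube is at most [delta Om y / 4]. In
    total [10 + 5 + 15/4 < 20]. *)
Lemma whitney0_near i Q J x p : D i Q -> Q x -> whitney0 Om C1 D i Q J ->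
  dcube 1 J p -> enorm (p - x) <= 20 * len i.
Proof.
move=> DQ Qx [wJ [X [XU [y [Jy Xy]]]]] Jp; have l0 := len_gt0 (R := R) i.
have Bx := cube_boundary DQ Qx.
have Xx : enorm (X - x) <= 10 * len i.
  case: XU => [[I WI IX]|[Q' [DQ' QQ' [I WI IX]]]].
    by have [+ _] := whitneyQ_near DQ Qx WI IX; lra.
  have [+ _] := whitneyQ_near DQ' (QQ' _ Qx) WI IX.
  by rewrite (_ : len (i - 1) = 2 * len i) ?lenP//; lra.
have := delta_le_near X Bx; have := whitney_delta_ge b0 wJ Jy.
have := delta_le_near y Bx; have := dcube_diam Jp Jy; have := enorm_tri p y x.
have := enorm_tri y X x; move: Xy; rewrite /eball/=; lra.
Qed.

Lemma delta_lip x y : delta Om x <= enorm (x - y) + delta Om y.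
Proof. exact: dist_lip. Qed.

Lemma whitneyQ_0 i Q I : D i Q -> whitneyQ Om C1 i Q I -> whitney0 Om C1 D i Q I.
Proof.
move=> DQ WI; have [wI _ _] := WI; split => //.
have Ic : dcube 1 I (center I : Rn) by exact: center_mem.
exists (center I); split; first by left; exists I.
exists (center I); split => //.
by rewrite /eball/= subrr enorm0 divr_gt0// delta_gt0//; exact: whitney_sub wI _ Ic.
Qed.

Lemma whitneyQ_parent0 i Q Q' I : D (i - 1) Q' -> Q `<=` Q' ->
  whitneyQ Om C1 (i - 1) Q' I -> whitney0 Om C1 D i Q I.
Proof.
move=> DQ' QQ' WI; have [wI _ _] := WI; split => //.
have Ic : dcube 1 I (center I : Rn) by exact: center_mem.
exists (center I); split; first by right; exists Q'; split => //; exists I.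
exists (center I); split => //.
by rewrite /eball/= subrr enorm0 divr_gt0// delta_gt0//; exact: whitney_sub wI _ Ic.
Qed.

Lemma whitney0_star i Q I : D i Q -> whitney0 Om C1 D i Q I ->
  whitney_star Om C1 D M Z i Q I.
Proof.
move=> DQ WI; have [wI _] := WI; split => //; exists I, I, 0%N; split => //.
have [-> _ _ _ _] := hZ DQ WI WI.
have Ic : dcube 1 I (center I : Rn) by exact: center_mem.
exists (center I); split => //.
by rewrite /eball/= subrr enorm0 divr_gt0// delta_gt0//; exact: whitney_sub wI _ Ic.
Qed.

(** In units of [len i], [20] reaches the first point of a chain and [C0] the other ones. *)
Let K0 : R := 20 + C0.

Lemma chain_near i Q J J' x l : D i Q -> Q x -> whitney0 Om C1 D i Q J ->
  whitney0 Om C1 D i Q J' -> (l <= M)%N ->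
  let z := Z i Q J J' l in
  [/\ Om z, enorm (z - x) <= K0 * len i, c * len i <= delta Om z &
      delta Om z <= K0 * len i].
Proof.
move=> DQ Qx WJ WJ' lM z; have [z0 zM zz zd zC] := hZ DQ WJ WJ'.
have Bx := cube_boundary DQ Qx.
have Jc : dcube 1 J (center J : Rn) by exact: center_mem.
have zx : enorm (z - x) <= K0 * len i.
  have := enorm_tri z (center J) x; have := whitney0_near DQ Qx WJ Jc.
  by have := zC _ lM; rewrite /K0 -/z; lra.
split => //; last by apply: le_trans zx; exact: delta_le_near.
  rewrite /z; elim: l lM {z zx} => [_|l IH lM].
    by rewrite z0; case: WJ => wJ _; exact: whitney_sub wJ _ Jc.
  have Ol := IH (ltnW lM); apply: (eball_delta_sub oOm Ol).
  rewrite /eball/= enormB; apply: le_lt_trans (zz _ lM) _.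
  have := delta_gt0 oOm b0 Ol; lra.
exact: zd.
Qed.

(** A point of a chain ball has [delta] at least half that of the center [z], hence at least
    [c len i / 2], while [delta] is below [16 sn side] on the cube; this is the lower bound on the
    side. The upper bounds come from the distance to [x]. *)
Lemma whitney_star_near i Q I x p : D i Q -> Q x ->
  whitney_star Om C1 D M Z i Q I -> dcube 1 I p ->
  [/\ enorm (p - x) <= 2 * K0 * len i, c * len i <= 32 * (sn * side I) &
      2 * (sn * side I) <= K0 * len i].
Proof.
move=> DQ Qx [wI [J [J' [l [WJ WJ' lM [y [Iy yz]]]]]]] Ip.
have Bx := cube_boundary DQ Qx.
have [Oz zx zd zK] := chain_near DQ Qx WJ WJ' lM.
move: (Z i Q J J' l) yz Oz zx zd zK => z yz Oz zx zd zK.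
have := whitney_delta_lt n0 b0 wI Iy; have := whitney_delta_ge b0 wI Iy.
have := dcube_diam Ip Iy; have := enorm_tri p y x; have := enorm_tri y z x.
have := delta_le_near y Bx; have := delta_lip z y; rewrite (enormB z).
have : 0 < K0 * len i by rewrite mulr_gt0 ?len_gt0// /K0 ltr_pwDr.
move: yz; rewrite /eball/= => *; split; lra.
Qed.

(** The corkscrew point of (H1) at scale [len i / 2] has [delta] at least [len i / (2 C1)], so its
    Whitney cube has side above [len i / (32 C1 sn)], well above the threshold of [W_Q]. *)
Lemma whitneyQ_exists i Q z : D i Q -> Q z -> exists I X,
  [/\ whitneyQ Om C1 i Q I, dcube 1 I X & enorm (X - z) < len i / 2].
Proof.
move=> DQ Qz; have l0 := len_gt0 (R := R) i.
have [X Xz XO] := h1 (cube_boundary DQ Qz) (divr_gt0 l0 (ltr0n _ 2)).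
have OX : Om X.
  by apply: XO; rewrite /eball/= subrr enorm0 mulr_gt0 ?invr_gt0// divr_gt0.
have [g wg] := whitney_exists n0 oOm b0 OX; have Xg := dcell_mem g X.
exists (dcell g X), X; split => //; split => //.
  have h3 := delta_ge oOm b0 XO; have h2 := whitney_delta_lt n0 b0 wg Xg.
  have s0 : 0 < sn by apply: lt_le_trans s1.
  have h4 := le_lt_trans h3 h2.
  rewrite ltr_pdivrMl// in h4.
  have [k [k0 k32 ->]] : exists k : R, [/\ 0 < k, 32 <= k & 1000 = k].
    by exists 1000; split; rewrite ?ltr0n ?ler_nat.
  rewrite ler_pdivrMl; last by rewrite !mulr_gt0.
  have p0 : 0 <= C1 * (sn * side (dcell g X)).
    by rewrite !mulr_ge0 ?(ltW C1_gt0) ?(ltW s0) ?(ltW (side_gt0 _)).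
  rewrite -!mulrA; apply: (@le_trans _ _ (32 * (C1 * (sn * side (dcell g X))))).
    by move: h4; move: (len i) (sn * side _) => a b; lra.
  by rewrite ler_wpM2r.
apply: le_trans (setdist_le Xg Qz) _; apply: le_trans (ltW Xz) _; lra.
Qed.

(** A corkscrew point taken at a point of [Q] close to [x] is within [(1/2 + 5/4) len i] of [x],
    below the tolerance [2 len i] of the Whitney region of [Q']. *)
Lemma whitneyQ_common i Q Q' x : D i Q -> D i Q' -> Q' x -> dist x Q <= len i ->
  exists I, whitneyQ Om C1 i Q I /\ whitneyQ Om C1 i Q' I.
Proof.
move=> DQ DQ' Q'x xQ; have l0 := len_gt0 (R := R) i.
have : dist x Q < 5 / 4 * len i by lra.
case/(dist_lt (cube_nonempty DQ)) => z Qz xz.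
have [I [X [WI IX Xz]]] := whitneyQ_exists DQ Qz.
exists I; split => //; have [wI sI _] := WI; split => //.
apply: le_trans (setdist_le IX Q'x) _; have := enorm_tri X z x.
by rewrite (enormB z); lra.
Qed.

Lemma regionU_star i Q X p : D i Q -> regionU Om C1 i Q X ->
  eball X (delta Om X / 2) p -> exists g, whitney_star Om C1 D M Z i Q (dcell g p).
Proof.
move=> DQ UX Xp.
have OX : Om X by case: UX => I [wI _ _]; exact: whitney_sub.
have Op : Om p.
  apply: (eball_delta_sub oOm OX); apply: lt_le_trans Xp _.
  by have := delta_gt0 oOm b0 OX; lra.
have [g wg] := whitney_exists n0 oOm b0 Op; exists g.
apply: whitney0_star => //; split => //; exists X; split; first by left.
by exists p; split => //; exact: dcell_mem.
Qed.

Lemma regionU_ball i Q X : D i Q -> regionU Om C1 i Q X ->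
  eball X (delta Om X / 2) `<=` region_star Om C1 D M Z i Q.
Proof.
move=> DQ UX p /(regionU_star DQ UX)[g wg].
by exists (dcell g p) => //; exact: dcell_mem.
Qed.

(** [d1] is the depth at which a central descendant fits in the inscribed ball of its ancestor. As
    the cubes of [W*_Q] have side at least [c len i / (32 sn)], [g0] makes generation [i + g0] finer
    than all of them by at least [d1] generations. *)
Lemma scale_exists : exists d1 g0 : nat,
  [/\ (0 < d1)%N, (sn + 1) * len d1%:Z <= 1 & 32 * sn * len g0%:Z <= c * len d1%:Z].
Proof.
have s0 : 0 < sn by apply: lt_le_trans s1.
have s10 : 0 < sn + 1 by rewrite ltr_pwDr// ltW.
have [d hd] := len_small (divr_gt0 ltr01 s10).
have [g hg] := len_small (divr_gt0 (mulr_gt0 c_gt0 (len_gt0 d.+1%:Z)) (mulr_gt0 (ltr0n _ 32) s0)).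
exists d.+1, g; split => //.
  rewrite mulrC -ler_pdivlMr//; apply: le_trans hd.
  by rewrite len_le lez_nat.
by move: hg; rewrite ler_pdivlMr ?mulr_gt0// mulrC.
Qed.

Variables (d1 g0 : nat).
Hypotheses (d1_gt0 : (0 < d1)%N) (hd1 : (sn + 1) * len d1%:Z <= 1)
  (hg0 : 32 * sn * len g0%:Z <= c * len d1%:Z).

(** [KA = 2 K0 + 3 K0] adds the distance from [x] to a cube of [W*_Q] and that from [x] to [Y].
    [theta] is a quarter of the finest cell used at one scale, the smallest radius in a face step,
    and [Np] bounds four times the number of face steps between such cells. *)
Let KA : R := 5 * K0.
Let theta : R := len (g0 + d1).+1%:Z / 4.
Let Np : R := n%:R * (8 * KA) / len (g0 + d1).+1%:Z.

Let K0_gt0 : 0 < K0. Proof. by rewrite /K0 ltr_pwDr. Qed.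
Let Np_ge0 : 0 <= Np.
Proof. by rewrite !mulr_ge0 ?invr_ge0 ?(ltW K0_gt0) ?(ltW (len_gt0 _)). Qed.

Definition scale_nested (T : set Rn) (av : Rn -> R -> R) (Y : Rn) (cost : R) i :=
  nested_bound Om T av Y (KA * len i) (KA * len i) (theta * len i) cost.

Lemma star_index_le i Q I x : D i Q -> Q x -> whitney_star Om C1 D M Z i Q I ->
  exists2 e : nat, i + g0%:Z = I.1 + e%:Z & (d1 <= e)%N.
Proof.
move=> DQ Qx WI.
have [_ h _] := whitney_star_near DQ Qx WI (center_mem I ler01).
have s0 : 0 < sn by apply: lt_le_trans s1.
have : len (i + g0%:Z) <= len (I.1 + d1%:Z).
  rewrite !lenD -(ler_pM2l (mulr_gt0 (ltr0n _ 32) s0)).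
  rewrite -[len I.1]/(side I) in h *.
  have := ler_wpM2r (ltW (len_gt0 d1%:Z)) h.
  have := ler_wpM2l (ltW (len_gt0 i)) hg0.
  move: (len _) (len _) (len _) (side _) => l1 l2 l3 l4; lra.
by rewrite len_le; exact: int_le_shift.
Qed.

Lemma star_good (T : set Rn) (Y : Rn) i Q I x : D i Q -> Q x ->
  region_star Om C1 D M Z i Q `<=` T ->
  enorm (Y - x) <= 3 * K0 * len i -> whitney_star Om C1 D M Z i Q I ->
  good_cube Om T Y (KA * len i) I.
Proof.
move=> DQ Qx UT Yx WI; have [wI _] := WI; split.
- by move=> p Ip; apply: UT; exists I.
- move=> p Ip; have := whitney_delta_ge b0 wI Ip => dp.
  have Op := whitney_sub wI Ip.
  move=> y yp; apply: (eball_delta_sub oOm Op); apply: lt_le_trans yp _.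
  apply: le_trans dp; have sI := side_gt0 (R := R) I.
  have h : side I <= sn * side I by rewrite ler_peMl// ltW.
  by lra.
- move=> p Ip; have [px _ _] := whitney_star_near DQ Qx WI Ip.
  by have := enorm_tri p x Y; rewrite (enormB x) /KA; lra.
Qed.

Lemma theta_le i (e : nat) : (e <= (g0 + d1).+1)%N ->
  theta * len i <= len (i + e%:Z) / 4.
Proof.
move=> h; rewrite /theta mulrAC ler_pM2r ?invr_gt0// mulrC -lenD len_le.
by rewrite lerD2l.
Qed.

Lemma Np_le i (e : nat) : (e <= (g0 + d1).+1)%N ->
  n%:R * (8 * (KA * len i)) <= Np * len (i + e%:Z).
Proof.
move=> h; apply: (@le_trans _ _ (Np * len (i + (g0 + d1).+1%:Z))).
  rewrite lenD /Np; have := len_gt0 (R := R) (g0 + d1).+1.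
  move: (len (g0 + d1).+1) (len i) KA n%:R => l l' a m l0.
  by rewrite (_ : m * (8 * a) / l * (l' * l) = m * (8 * (a * l')))//; field; lra.
by rewrite ler_wpM2l// len_le lerD2l lez_nat.
Qed.

Lemma half_le i g : sn * len g <= K0 * len i -> len g / 2 <= KA * len i.
Proof.
move=> h; have g1 : len g <= sn * len g by rewrite ler_peMl// ltW// len_gt0.
have := len_gt0 (R := R) g; rewrite /KA -mulrA.
by move: (K0 * len i) (sn * len g) h g1 => a b; lra.
Qed.

(** * Linking the cubes of one region [U*_Q] *)

Section Link.
Variables (T : set Rn) (av : Rn -> R -> R) (Y x : Rn) (cost : R) (i : int) (Q : set Rn).
Hypotheses (DQ : D i Q) (Qx : Q x) (UT : region_star Om C1 D M Z i Q `<=` T)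
  (Yx : enorm (Y - x) <= 3 * K0 * len i) (cost_ge0 : 0 <= cost)
  (nb : scale_nested T av Y cost i).

(** The single generation to which all cubes of [W*_Q] are refined before being compared. *)
Let G := i + g0%:Z.

Let G_half : len G / 2 <= KA * len i.
Proof.
have : len G <= len i by rewrite len_le lerDl.
have : 1 * len i <= K0 * len i.
  by rewrite ler_pM2r ?len_gt0// /K0; have := C0_gt0; lra.
by have := len_gt0 (R := R) i; rewrite /KA -mulrA; move: (K0 * len i) => a; lra.
Qed.

Lemma star_half I : whitney_star Om C1 D M Z i Q I -> side I / 2 <= KA * len i.
Proof.
move=> WI; have [_ _ h] := whitney_star_near DQ Qx WI (center_mem I ler01).
apply: half_le; rewrite -[len I.1]/(side I).
have : 0 <= sn * side I by rewrite mulr_ge0 ?sqrtr_ge0// ltW// side_gt0.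
lra.
Qed.

Lemma star_descendant I w : whitney_star Om C1 D M Z i Q I ->
  (forall e : nat, G = I.1 + e%:Z -> desc e I.2 w) ->
  `|avd av I - avd av (G, w)| <= (Np + 1) * cost.
Proof.
move=> WI hw; have [e Ge d1e] := star_index_le DQ Qx WI.
have e0 : (0 < e)%N by apply: leq_trans d1e.
have gI := star_good DQ Qx UT Yx WI; have hI := star_half WI.
move: gI hI hw Ge {WI}; case: I => g z /= gI hI hw Ge.
rewrite -/G in Ge; rewrite Ge; apply: (descendant_bound nb) => //.
- exact: hw.
- apply: le_trans hd1; apply: ler_wpM2l; first by rewrite addr_ge0 ?sqrtr_ge0.
  by rewrite len_le lez_nat.
- by rewrite -Ge; apply: theta_le; rewrite -addnS leq_addr.
- by rewrite -Ge; apply: Np_le; rewrite -addnS leq_addr.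
Qed.

Lemma dcell_descendant I (P : Rn) : dcell I.1 P = I -> forall e : nat, G = I.1 + e%:Z ->
  desc e I.2 (dcell G P).2.
Proof.
move=> PI e ->; have [w -> h] := dcell_desc I.1 e P.
by rewrite PI in h.
Qed.

(** The common point is moved to a point [P] of the ball whose cell of generation [G] is [v]. The
    Whitney cube at [P] meets the chain ball, hence belongs to [W*_Q]; being coarser than [G], it
    contains the cell [v]. *)
Lemma chain_ball_good J J' l v : whitney0 Om C1 D i Q J -> whitney0 Om C1 D i Q J' ->
  (l <= M)%N -> let z := Z i Q J J' l in
  (dcube 1 (G, v) `&` eball z (delta Om z / 2)) !=set0 ->
  good_cube Om T Y (KA * len i) (G, v).
Proof.
move=> WJ WJ' lM z [y [yv yz]].
have [P Pz PG] := dcell_approx yv yz.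
have [Oz _ _ _] := chain_near DQ Qx WJ WJ' lM.
have OP : Om P.
  apply: (eball_delta_sub oOm Oz); apply: lt_le_trans Pz _.
  by have := delta_gt0 oOm b0 Oz; rewrite -/z; lra.
have [g wg] := whitney_exists n0 oOm b0 OP.
have WI : whitney_star Om C1 D M Z i Q (dcell g P).
  split => //; exists J, J', l; split => //; exists P; split => //.
  exact: dcell_mem.
have [e Ge _] := star_index_le DQ Qx WI.
have gI := star_good DQ Qx UT Yx WI.
have [w wE dw] := dcell_desc g e P.
rewrite -PG /G Ge /= wE; exact: (good_desc gI dw).
Qed.

Lemma chain_ball_bound J J' l v w : whitney0 Om C1 D i Q J -> whitney0 Om C1 D i Q J' ->
  (l <= M)%N -> let z := Z i Q J J' l in
  (dcube 1 (G, v) `&` eball z (delta Om z / 2)) !=set0 ->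
  (dcube 1 (G, w) `&` eball z (delta Om z / 2)) !=set0 ->
  `|avd av (G, v) - avd av (G, w)| <= 2 * (Np * cost).
Proof.
move=> WJ WJ' lM z hv hw; apply: (ball_bound nb) hv hw _ _ _ _ => //.
- by move=> u; exact: chain_ball_good.
- by apply: theta_le; rewrite -addnS leq_addr.
- by apply: Np_le; rewrite -addnS leq_addr.
Qed.

Lemma chain_bound J J' l v w : whitney0 Om C1 D i Q J -> whitney0 Om C1 D i Q J' ->
  (l <= M)%N -> let z k := Z i Q J J' k in
  (dcube 1 (G, v) `&` eball (z 0%N) (delta Om (z 0%N) / 2)) !=set0 ->
  (dcube 1 (G, w) `&` eball (z l) (delta Om (z l) / 2)) !=set0 ->
  `|avd av (G, v) - avd av (G, w)| <= l.+1%:R * (2 * (Np * cost)).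
Proof.
move=> WJ WJ' + z hv; elim: l w => [|l IH] w lM hw.
  by rewrite mul1r; exact: chain_ball_bound hv hw.
have [_ _ zz _ _] := hZ DQ WJ WJ'.
have [Ol _ _ _] := chain_near DQ Qx WJ WJ' (ltnW lM).
have dl := delta_gt0 oOm b0 Ol; have zl := zz _ lM.
rewrite -![Z i Q J J' _]/(z _) in dl zl.
have dlip := delta_lip (z l) (z l.+1).
(* A point in both open balls. The next center itself may be on the boundary of the ball at [z l];
   as [delta] at [z l.+1] is at least half of [delta] at [z l], a quarter of the way back is
   enough. *)
pose P := z l.+1 + 4^-1 *: (z l - z l.+1).
have P1 : enorm (P - z l.+1) = 4^-1 * enorm (z l - z l.+1).
  by rewrite /P addrAC subrr add0r enormZ ger0_norm.
have P0 : enorm (P - z l) <= 3 / 4 * enorm (z l - z l.+1).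
  rewrite (_ : P - z l = (- (3 / 4)) *: (z l - z l.+1)).
    by rewrite enormZ normrN ger0_norm ?divr_ge0.
  apply/rowP => k; rewrite !mxE; move: (z l _ _) (z l.+1 _ _) => a b; lra.
pose v' := (dcell G P).2.
have hP r y : eball y r P -> (dcube 1 (G, v') `&` eball y r) !=set0.
  by move=> Py; exists P; split => //; exact: dcell_mem.
have b1 := IH v' (ltnW lM) (hP _ _ _).
have {}b1 : `|avd av (G, v) - avd av (G, v')| <= l.+1%:R * (2 * (Np * cost)).
  by apply: b1; rewrite /eball/=; lra.
have b2 : `|avd av (G, v') - avd av (G, w)| <= 2 * (Np * cost).
  by apply: (chain_ball_bound WJ WJ' lM _ hw); apply: hP; rewrite /eball/= -/(z _); lra.
have := ler_distD (avd av (G, v')) (avd av (G, v)) (avd av (G, w)).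
by move/le_trans; apply; rewrite -[l.+2%:R]natr1 mulrDl mul1r lerD.
Qed.

(** Two passages to generation [G] and at most [M + 1] chain balls, each of cost [2 Np]. *)
Definition L1 : R := 2 * (Np + 1) + M.+1%:R * (2 * Np).

Lemma star_chain_bound J J' l I : whitney0 Om C1 D i Q J -> whitney0 Om C1 D i Q J' ->
  (l <= M)%N -> let z := Z i Q J J' l in whitney Om I ->
  (dcube 1 I `&` eball z (delta Om z / 2)) !=set0 ->
  `|avd av I - avd av J| <= L1 * cost.
Proof.
move=> WJ WJ' lM z wI [y [Iy yz]].
have WI : whitney_star Om C1 D M Z i Q I.
  by split => //; exists J, J', l; split => //; exists y.
have [z0 _ _ _ _] := hZ DQ WJ WJ'.
have [P Pz PI] : exists2 P, eball z (delta Om z / 2) P & dcell I.1 P = I.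
  by move: Iy; case: (I) => g u Iy; exact: dcell_approx Iy yz.
have b1 := star_descendant WI (dcell_descendant PI).
have JC : dcell J.1 (center J : Rn) = J.
  case: (J) => g u; apply/dcellP => k; rewrite mxE sideE /=.
  have := len_gt0 (R := R) g; move: (len g) (_)%:~R => a b a_gt0; apply/andP; split; nra.
have b2 := star_descendant (whitney0_star DQ WJ) (dcell_descendant JC).

have b3 : `|avd av (G, (dcell G (center J : Rn)).2) - avd av (G, (dcell G P).2)| <=
    l.+1%:R * (2 * (Np * cost)).
  have cb := @chain_bound J J' l (dcell G (center J : Rn)).2 (dcell G P).2 WJ WJ' lM.
  apply: cb.
    exists (center J); split; first exact: dcell_mem.
    rewrite z0 /eball/= subrr enorm0 divr_gt0// delta_gt0//.
    by case: WJ => wJ _; apply: (whitney_sub wJ); exact: center_mem.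
  by exists P; split => //; exact: dcell_mem.
have b4 : l.+1%:R * (2 * (Np * cost)) <= M.+1%:R * (2 * Np) * cost.
  rewrite (_ : _ * (2 * Np) * cost = M.+1%:R * (2 * (Np * cost))); last by ring.
  apply: ler_wpM2r; last by rewrite ler_nat ltnS.
  by apply: mulr_ge0 => //; exact: mulr_ge0.
rewrite /L1 mulrDl; move: b1 b2 b3 b4; rewrite !ler_norml.
move: (avd _ _) (avd _ _) (avd _ _) (avd _ _) (_ * (2 * (Np * cost))) => u1 u2 u3 u4 u5.
by move: (M.+1%:R * _ * _) => u6; lra.
Qed.

(** From [I] to the first cube [J] of its chain, from [J] to [J2] along the chain that joins them,
    and from [J2] to [I']. *)
Lemma star_link I I' : whitney_star Om C1 D M Z i Q I ->
  whitney_star Om C1 D M Z i Q I' -> `|avd av I - avd av I'| <= 3 * L1 * cost.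
Proof.
move=> [wI [J [J' [l [WJ WJ' lM hl]]]]] [wI' [J2 [J2' [l' [WJ2 WJ2' lM' hl']]]]].
have b1 := star_chain_bound WJ WJ' lM wI hl.
have b2 := star_chain_bound WJ2 WJ2' lM' wI' hl'.
have b3 : `|avd av J2 - avd av J| <= L1 * cost.
  apply: (star_chain_bound WJ WJ2 (leqnn M)); first by case: WJ2.
  have [_ zM _ _ _] := hZ DQ WJ WJ2; rewrite zM.
  exists (center J2); split; first exact: center_mem.
  rewrite /eball/= subrr enorm0 divr_gt0// delta_gt0//.
  by case: WJ2 => w _; apply: (whitney_sub w); exact: center_mem.
move: b1 b2 b3; rewrite !ler_norml -mulrA.
by move: (avd _ _) (avd _ _) (avd _ _) (avd _ _) (_ * cost) => *; lra.
Qed.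

End Link.

Lemma L1_ge0 : 0 <= L1.
Proof.
rewrite /L1; apply: addr_ge0; apply: mulr_ge0 => //.
  by rewrite addr_ge0.
exact: mulr_ge0.
Qed.

(** The child of [I] containing [X], selected by comparison with the center. Using [dcell] would not
    do, as a point of the closed cube [I] may belong to the half-open cell of a neighbour. *)
Definition subcube (X : Rn) (I : dyadic n) : dyadic n :=
  (I.1 + 1, \row_k (2 * I.2 ord0 k + (if (center I : Rn) ord0 k < X ord0 k then 1 else 0))).

Lemma subcube_mem X I : dcube 1 I X -> dcube 1 (subcube X I) X.
Proof.
case: I => g z /dcube1P h; apply/dcube1P => k; have := h k.
rewrite !mxE lenS sideE /=; have := len_gt0 (R := R) g.
move: (len g) (X ord0 k) (z ord0 k) => l u a l0.
rewrite intrD intrM; case: ltP => /= hc; rewrite ?intr1 ?intr0;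
  move: (a%:~R : R) hc => b hc /andP[h2 h3]; apply/andP; split; lra.
Qed.

Lemma subcube_desc X I : desc 1 I.2 (subcube X I).2.
Proof.
move=> k; rewrite mxE expr1; move: (I.2 ord0 k) => a.
by case: (_ < _) => /=; lia.
Qed.

Lemma subcubes_desc X I m : desc m I.2 (iter m (subcube X) I).2.
Proof.
elim: m => [|m IH]; first exact: desc0.
by have := desc_trans IH (subcube_desc X _); rewrite addn1.
Qed.

Lemma subcubes_gen X I m : (iter m (subcube X) I).1 = I.1 + m%:Z.
Proof. by elim: m => [|m IH] /=; rewrite ?addr0// IH -addrA -PoszD addn1. Qed.

Lemma subcubes_mem X I m : dcube 1 I X -> dcube 1 (iter m (subcube X) I) X.
Proof. by move=> IX; elim: m => //= m IH; exact: subcube_mem. Qed.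

(** The descent to [X] uses the dyadic subcubes of [I], which lie in [T] along with [I]. The
    inscribed ball of a child need not lie in that of its parent, so both are compared with the
    central descendant [d1] generations below the child. *)
Lemma star_subcubes (T : set Rn) (av : Rn -> R -> R) (cost : nat -> R) i Q I x X :
  D i Q -> Q x -> region_star Om C1 D M Z i Q `<=` T ->
  whitney_star Om C1 D M Z i Q I -> dcube 1 I X ->
  (forall p : nat, 0 <= cost p) ->
  (forall p : nat, scale_nested T av X (cost p) (i + p%:Z)) ->
  forall m, `|avd av (iter m (subcube X) I) - avd av I| <=
    2 * (Np + 1) * \sum_(p < m) cost p.
Proof.
move=> DQ Qx UT WI IX c0 nb m.
have [Xx ld lu] := whitney_star_near DQ Qx WI IX.
have gI := star_good DQ Qx UT (le_trans Xx _) WI.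
have {gI}[IT IO _] : good_cube Om T X (KA * len i) I.
  by apply: gI; rewrite ler_pM2r ?len_gt0// ler_pM2r// ler_nat.
have gK q : good_cube Om T X (KA * len (i + q%:Z)) (iter q (subcube X) I).
  have sub := @desc_sub R n q I.1 I.2 _ (subcubes_desc X I q).
  have KE : (I.1 + q%:Z, (iter q (subcube X) I).2) = iter q (subcube X) I.
    by rewrite -(subcubes_gen X I q) -surjective_pairing.
  rewrite KE -surjective_pairing in sub.
  split; first exact: subset_trans sub IT.
    move=> p /sub Ip y; rewrite /eball/= => yp; apply: (IO p Ip).
    apply: lt_le_trans yp _.
    by rewrite -[side _]/(len _) subcubes_gen -[side _]/(len _) len_le lerDl.
  move=> p pK; have := dcube_diam pK (subcubes_mem q IX).
  move/le_trans; apply; rewrite -[side _]/(len _) subcubes_gen !lenD mulrA mulrA.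
  rewrite ler_pM2r ?len_gt0//.
  have : 0 <= K0 * len i by rewrite mulr_ge0 ?(ltW K0_gt0) ?(ltW (len_gt0 _)).
  by move: lu; rewrite -[len I.1]/(side I) /KA -mulrA; move: (K0 * len i) => a; lra.
elim: m => [|m IH]; first by rewrite subrr normr0 big_ord0 mulr0.
rewrite big_ord_recr/= mulrDr.
set K := iter m _ I in IH *; set K' := subcube X K.
have hK : side K / 2 <= KA * len (i + m%:Z).
  apply: half_le; rewrite -[len K.1]/(side K) -[side _]/(len _) subcubes_gen !lenD !mulrA.
  rewrite ler_pM2r ?len_gt0//.
  have : 0 <= sn * side I by rewrite mulr_ge0 ?sqrtr_ge0// ltW// side_gt0.
  by move: lu; rewrite -[len I.1]/(side I); lra.
have lenK e : (e <= d1.+1)%N -> len ((i + m%:Z) + (g0 + d1).+1%:Z) <= len (K.1 + e%:Z).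
  move=> ed; rewrite /K subcubes_gen.
  have : len (i + g0%:Z) <= len I.1.
    have [e' -> _] := star_index_le DQ Qx WI.
    by rewrite len_le lerDl.
  rewrite len_le => ig; rewrite len_le; clear -ig ed.
  by move: (I.1) ig => a ig; lia.
have db v e : (0 < e <= d1.+1)%N -> (d1 <= e)%N -> desc e K.2 v ->
    `|avd av K - avd av (K.1 + e%:Z, v)| <= (Np + 1) * cost m.
  move=> /andP[e0 ed] de Kv.
  have := gK m; rewrite -/K (surjective_pairing K) => gKm.
  rewrite [in X in `|X - _|](surjective_pairing K).
  apply: (descendant_bound (nb m)) => //.
  - apply: le_trans hd1; apply: ler_wpM2l; first by rewrite addr_ge0 ?sqrtr_ge0.
    by rewrite len_le lez_nat.
  - by apply: le_trans (theta_le _ (leqnn _)) _; rewrite ler_pM2r ?invr_gt0// lenK.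
  - by apply: le_trans (Np_le _ (leqnn _)) _; rewrite ler_wpM2l// lenK.
pose v := cdesc d1 K'.2.
have K'v : desc d1 K'.2 v by exact: desc_cdesc.
have Kv : desc (1 + d1) K.2 v by apply: desc_trans K'v; exact: subcube_desc.
have b1 := db v (1 + d1)%N _ _ Kv.
have {}b1 : `|avd av K - avd av (K.1 + (1 + d1)%:Z, v)| <= (Np + 1) * cost m.
  by apply: b1; rewrite ?leqnn ?leq_addl.
have b2 : `|avd av K' - avd av (K.1 + (1 + d1)%:Z, v)| <= (Np + 1) * cost m.
  have gK' : good_cube Om T X (KA * len (i + m%:Z)) (K.1 + 1, K'.2).
    have := @good_desc _ _ _ _ _ _ K.1 K.2 1 K'.2; rewrite -surjective_pairing.
    by apply; [exact: gK|exact: subcube_desc].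
  have -> : K' = (K.1 + 1, K'.2) by [].
  have K1E : K.1 + 1 + d1%:Z = K.1 + d1.+1%:Z by rewrite -addrA -PoszD.
  rewrite PoszD addrA; apply: (descendant_bound (nb m)) => //.
  - apply: le_trans hK; rewrite ler_pM2r ?invr_gt0// -[side K]/(len _) len_le.
    by rewrite lerDl.
  - apply: le_trans (theta_le _ (leqnn _)) _; rewrite ler_pM2r ?invr_gt0//.
    by rewrite K1E lenK.
  - by apply: le_trans (Np_le _ (leqnn _)) _; rewrite ler_wpM2l// K1E lenK.
move: IH b1 b2; rewrite !ler_norml.
move: (avd av K) (avd av K') (avd av (_, v)) (avd av I) => u1 u2 u3 u4.
by move: (_ * \sum_(_ < _) _) => u5; rewrite -mulrA; move: (_ * cost m) => u6; lra.
Qed.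

(** * Telescoping through the scales of a tent *)

Section Telescope.
Variables (j : int) (Q : set Rn).
Hypothesis DQ : D j Q.
Let T := tent2 Om C1 D M Z j Q.

Lemma sub_dilate : Q `<=` dilate Om 2 j Q.
Proof.
move=> x Qx; split; first exact: cube_boundary DQ _ Qx.
apply: le_trans (dist_le x Qx) _; rewrite subrr enorm0 mulr_ge0 ?(ltW (len_gt0 _))//.
Qed.

Lemma star_sub_tent x (q : nat) Q' : dilate Om 2 j Q x -> D (j + q%:Z) Q' -> Q' x ->
  region_star Om C1 D M Z (j + q%:Z) Q' `<=` T.
Proof.
move=> dx DQ' Q'x p Up; exists x => //; exists (j + q%:Z), Q'; split => //.
by rewrite len_le lerDl.
Qed.

Lemma tent_star X : T X -> exists x (q : nat) Q' I, [/\ dilate Om 2 j Q x,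
  D (j + q%:Z) Q', Q' x, whitney_star Om C1 D M Z (j + q%:Z) Q' I & dcube 1 I X].
Proof.
move=> [x dx [k [Q' [DQ' Q'x kj [I WI IX]]]]].
rewrite len_le in kj; have kE : k = j + (absz (k - j))%:Z by lia.
by exists x, (absz (k - j)), Q', I; rewrite -kE.
Qed.

Section Cost.
Variables (av : Rn -> R -> R) (Y x : Rn) (cost : nat -> R) (I0 : dyadic n).
Hypotheses (WI0 : whitneyQ Om C1 j Q I0) (dx : dilate Om 2 j Q x)
  (cost_ge0 : forall p : nat, 0 <= cost p)
  (nb : forall p : nat, scale_nested T av Y (cost p) (j + p%:Z)).

(** One step up keeps the point [x]: the cubes of [W_Q1], for the parent [Q1], belong to [W^0] of
    the child, so a link inside the region of the child suffices. At the top [x] is in [2Q] but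
    perhaps not in [Q], and two links are made through a Whitney cube common to both; hence
    [6 = 3 + 3]. *)
Lemma star_telescope q Q' I : enorm (Y - x) <= 2 * K0 * len (j + q%:Z) ->
  D (j + q%:Z) Q' -> Q' x -> whitney_star Om C1 D M Z (j + q%:Z) Q' I ->
  `|avd av I - avd av I0| <= 6 * L1 * \sum_(p < q.+1) cost p.
Proof.
elim: q Q' I => [|q IH] Q' I Yx DQ' Q'x WI.
  rewrite addr0 in Yx DQ' WI; rewrite big_ord1/=.
  have nb0 := @nb 0%N; rewrite addr0 in nb0.
  have [Bx xQ] := dx; rewrite (_ : 2 - 1 = 1) ?mul1r in xQ; last by lra.
  have l0 := len_gt0 (R := R) j.
  have [I' [W1 W2]] := whitneyQ_common DQ DQ' Q'x xQ.
  have [z Qz xz] : exists2 z, Q z & enorm (x - z) < 2 * len j.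
    by apply: dist_lt; [exact: cube_nonempty DQ|lra].
  have star i Q0 J : D i Q0 -> whitneyQ Om C1 i Q0 J -> whitney_star Om C1 D M Z i Q0 J.
    by move=> DQ0 h; apply: whitney0_star => //; exact: whitneyQ_0.
  have K0l : 20 * len j <= K0 * len j.
    by rewrite ler_pM2r// /K0; have := C0_gt0; lra.
  have b1 : `|avd av I - avd av I'| <= 3 * L1 * cost 0%N.
    apply: (star_link DQ' Q'x _ _ _ nb0 WI (star _ _ _ DQ' W2)) => //.
      have := @star_sub_tent x 0 Q' dx; rewrite addr0; exact.
    by apply: le_trans Yx _; rewrite ler_pM2r// ler_pM2r// ler_nat.
  have b2 : `|avd av I' - avd av I0| <= 3 * L1 * cost 0%N.
    apply: (star_link DQ Qz _ _ _ nb0 (star _ _ _ DQ W1) (star _ _ _ DQ WI0)) => //.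
      have := @star_sub_tent z 0 Q (sub_dilate Qz); rewrite addr0; exact.
    by have := enorm_tri Y x z; move: Yx; rewrite -!mulrA; lra.
  have := ler_distD (avd av I') (avd av I) (avd av I0).
  move/le_trans; apply; apply: le_trans (lerD b1 b2) _.
  by rewrite -!mulrA; move: (L1 * _) => a; lra.
have l0 := len_gt0 (R := R) (j + q.+1%:Z).
have jq : j + q.+1%:Z - 1 = j + q%:Z by rewrite -addn1 PoszD addrA addrK.
have lq : len (j + q%:Z) = 2 * len (j + q.+1%:Z) by rewrite -jq lenP.
have [Q1 DQ1 Q1x] := cube_exists (j + q%:Z) (cube_boundary DQ' Q'x).
have [I' [_ [WI' _ _]]] := whitneyQ_exists DQ1 Q1x.
have b1 : `|avd av I' - avd av I0| <= 6 * L1 * \sum_(p < q.+1) cost p.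
  apply: (IH Q1) => //.
    by rewrite lq; move: Yx; have := mulr_gt0 K0_gt0 l0; rewrite -!mulrA; lra.
  by apply: whitney0_star => //; exact: whitneyQ_0.
have b2 : `|avd av I - avd av I'| <= 3 * L1 * cost q.+1.
  apply: (star_link DQ' Q'x _ _ _ (@nb q.+1) WI) => //.
  - exact: (star_sub_tent dx DQ' Q'x).
  - by apply: le_trans Yx _; rewrite ler_pM2r// ler_pM2r// ler_nat.
  - apply: whitney0_star => //; apply: (@whitneyQ_parent0 (j + q.+1%:Z) Q' Q1); rewrite ?jq//.
    by apply: (@cube_parent (j + q.+1%:Z) Q' Q1 x); rewrite ?jq.
have := ler_distD (avd av I') (avd av I) (avd av I0).
move/le_trans; apply; apply: le_trans (lerD b2 b1) _.
rewrite [X in _ <= _ * X]big_ord_recr/=.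
have := mulr_ge0 L1_ge0 (cost_ge0 q.+1).
by move: L1 (\sum_(i < q.+1) _) (cost q.+1) => l u v; lra.
Qed.

End Cost.
(** [6 L1] pays for the climb through the generations, [2 (Np + 1)] for the descent inside a Whitney
    cube, and [1] for the ball in the definition of the trace. *)
Definition LT : R := 6 * L1 + 2 * (Np + 1) + 1.

Lemma LT_gt0 : 0 < LT.
Proof. by rewrite /LT; have := L1_ge0; have := Np_ge0; move: L1 Np => a b; lra. Qed.

Lemma sum_shift_le (cost : nat -> R) q m : (forall p : nat, 0 <= cost p) ->
  \sum_(p < m) cost (q + p)%N <= \sum_(p < (q + m).+1) cost p.
Proof.
move=> c0; rewrite -addnS big_split_ord/= big_ord_recr/=.
apply: le_trans (_ : _ <= \sum_(p < m) cost (q + p)%N + cost (q + m)%N) _.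
  by rewrite lerDl.
by rewrite lerDr sumr_ge0.
Qed.

Lemma sum_le_ord (cost : nat -> R) q m : (forall p : nat, 0 <= cost p) -> (q <= m)%N ->
  \sum_(p < q) cost p <= \sum_(p < m) cost p.
Proof.
by move=> c0 /subnKC <-; rewrite big_split_ord/= lerDl sumr_ge0.
Qed.

Lemma tent_telescope (av : Rn -> R -> R) (cost : nat -> R) (X : Rn) (I0 : dyadic n) :
  whitneyQ Om C1 j Q I0 -> T X -> (forall p : nat, 0 <= cost p) ->
  (forall p : nat, scale_nested T av X (cost p) (j + p%:Z)) ->
  exists (s : R) (K : nat -> dyadic n), forall m, [/\ dcube 1 (K m) X,
    dcube 1 (K m) `<=` Om, side (K m) <= s * len m%:Z &
    exists N, `|avd av (K m) - avd av I0| <= LT * \sum_(p < N) cost p].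
Proof.
move=> WI0 TX c0 nb.
have [x [q [Q' [I [dx DQ' Q'x WI IX]]]]] := tent_star TX.
have [Xx _ _] := whitney_star_near DQ' Q'x WI IX.
have b1 := star_telescope WI0 dx c0 nb Xx DQ' Q'x WI.
exists (side I), (fun m => iter m (subcube X) I) => m; split.
- exact: subcubes_mem.
- have sub := @desc_sub R n m I.1 I.2 _ (subcubes_desc X I m).
  rewrite -(subcubes_gen X I m) -!surjective_pairing in sub.
  by apply: subset_trans sub _; case: WI => wI _; exact: whitney_sub.
- by rewrite -[side (iter _ _ _)]/(len _) subcubes_gen lenD.
have b2 : `|avd av (iter m (subcube X) I) - avd av I| <=
    2 * (Np + 1) * \sum_(p < m) cost (q + p)%N.
  have h := @star_subcubes T av (fun p : nat => cost (q + p)%N) (j + q%:Z) Q' I x X DQ' Q'x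
    (star_sub_tent dx DQ' Q'x) WI IX.
  apply: h => // p.
  by rewrite -addrA -PoszD; exact: nb.
exists (q + m).+1.
have s1' := sum_le_ord c0 (leq_addr m q : (q < (q + m).+1)%N).
have s2' := sum_shift_le q m c0.
have S0 : 0 <= \sum_(p < (q + m).+1) cost p by exact: sumr_ge0.
have := ler_distD (avd av I) (avd av (iter m (subcube X) I)) (avd av I0).
move/le_trans; apply; apply: le_trans (lerD b2 b1) _.
have := ler_wpM2l L1_ge0 s1'.
have : 0 <= Np + 1 by rewrite addr_ge0.
move=> /ler_wpM2l/(_ _ _ s2'); rewrite /LT.
move: L1 (Np + 1) (\sum_(p < m) _) (\sum_(p < q.+1) _) (\sum_(p < _) _) S0 => u v a b e.
lra.
Qed.

(** [X] is the center of a cube [I] of [W_Q'], where [Q'] contains [x]. The ball of the trace at [X]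
    contains the inscribed ball, as [side I <= delta Om X / 4], and lies in [T] because [W^0]
    contains every Whitney cube meeting it: one more nested pair, at scale [q]. *)
Lemma trace_telescope (av : Rn -> R -> R) (cost : nat -> R) x (I0 : dyadic n) :
  whitneyQ Om C1 j Q I0 -> Q x -> (forall p : nat, 0 <= cost p) ->
  (forall p : nat, scale_nested T av x (cost p) (j + p%:Z)) ->
  forall q : nat, exists X, [/\ cone Om C1 D x X, Om X,
    delta Om X <= 5 * len (j + q%:Z) &
    `|av X (delta Om X / 2) - avd av I0| <= LT * \sum_(p < q.+1) cost p].
Proof.
move=> WI0 Qx c0 nb q; have dx := sub_dilate Qx.
have Bx := cube_boundary DQ Qx.
have [Q' DQ' Q'x] := cube_exists (j + q%:Z) Bx.
have [I [_ [WI _ _]]] := whitneyQ_exists DQ' Q'x.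
have WI' : whitney_star Om C1 D M Z (j + q%:Z) Q' I.
  by apply: whitney0_star => //; exact: whitneyQ_0.
have l0 := len_gt0 (R := R) (j + q%:Z).
have b1 : `|avd av I - avd av I0| <= 6 * L1 * \sum_(p < q.+1) cost p.
  apply: (star_telescope WI0 dx c0 nb _ DQ' Q'x) => //.
  by rewrite subrr enorm0 !mulr_ge0// ?(ltW K0_gt0)// ltW.
pose X : Rn := center I; have IX : dcube 1 I X by exact: center_mem.
have [wI _ _] := WI; have OX := whitney_sub wI IX.
have UX : regionU Om C1 (j + q%:Z) Q' X by exists I.
have [Xx _] := whitneyQ_near DQ' Q'x WI IX.
have dX : delta Om X <= 5 * len (j + q%:Z) by apply: le_trans Xx; exact: delta_le_near.
exists X; split => //; first by exists (j + q%:Z), Q'.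
have d4 := whitney_delta_ge b0 wI IX.
have sI := side_gt0 (R := R) I.
have s4 : side I <= sn * side I by rewrite ler_peMl// ltW.
have K5 : 5 * len (j + q%:Z) <= KA * len (j + q%:Z).
  by rewrite ler_pM2r// /KA /K0; have := C0_gt0; lra.
have th : theta * len (j + q%:Z) <= side I / 2.
  apply: le_trans (theta_le _ (leq_trans (leq_addr d1 g0) (leqnSn _))) _.
  have [e -> _] := star_index_le DQ' Q'x WI'.
  have : len (I.1 + e%:Z) <= side I by rewrite -[side I]/(len _) len_le lerDl.
  by have := len_gt0 (R := R) (I.1 + e%:Z); lra.
have b2 : `|avd av I - av X (delta Om X / 2)| <= cost q.
  apply: (@nb q) => //.
  - by apply: eball_sub; rewrite subrr enorm0 add0r; lra.
  - apply: subset_trans (regionU_ball DQ' UX) _.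
    exact: (star_sub_tent dx DQ' Q'x).
  - rewrite (_ : 2 * (delta Om X / 2) = delta Om X); last by lra.
    exact: eball_delta_sub.
  - exact: le_trans K5.
  - by apply: le_trans K5; lra.
  - by rewrite divr_gt0.
have S1 : cost q <= \sum_(p < q.+1) cost p.
  by rewrite big_ord_recr/= lerDr sumr_ge0.
have S0 : 0 <= \sum_(p < q.+1) cost p by exact: sumr_ge0.
have N1 := mulr_ge0 Np_ge0 S0.
move: b1 b2; rewrite /LT !ler_norml.
move: (avd _ _) (avd _ _) (av _ _) L1 Np (cost q) (\sum_(p < _) _) N1 S0 S1 => *; lra.
Qed.

Lemma tent_sub : T `<=` Om.
Proof.
move=> X /tent_star[x [q [Q' [I [_ _ _ [wI _] IX]]]]].
exact: whitney_sub wI _ IX.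
Qed.

Lemma tent_near X y : T X -> Q y -> enorm (X - y) <= KA * len j.
Proof.
move=> TX Qy; have [x [q [Q' [I [dx DQ' Q'x WI IX]]]]] := tent_star TX.
have [Xx _ _] := whitney_star_near DQ' Q'x WI IX.
have l0 := len_gt0 (R := R) j.
have [Bx xQ] := dx; rewrite (_ : 2 - 1 = 1) ?mul1r in xQ; last by lra.
have [z Qz xz] : exists2 z, Q z & enorm (x - z) < 2 * len j.
  by apply: dist_lt; [exact: cube_nonempty DQ|lra].
have := cube_diam DQ Qz Qy; have := enorm_tri X x y; have := enorm_tri x z y.
have : 2 * K0 * len (j + q%:Z) <= 2 * (K0 * len j).
  rewrite -mulrA ler_pM2l// ler_pM2l//; last by rewrite len_le lerDl.
have : 20 * len j <= K0 * len j by rewrite ler_pM2r// /K0; have := C0_gt0; lra.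
rewrite /KA -!mulrA; move: (K0 * len j) (K0 * _) Xx => *; lra.
Qed.

Lemma tent_top : exists I0,
  [/\ whitneyQ Om C1 j Q I0, whitney Om I0 & dcube 1 I0 `<=` T].
Proof.
have [y Qy] := cube_nonempty DQ.
have [I [_ [WI _ _]]] := whitneyQ_exists DQ Qy; exists I.
have WI' : whitney_star Om C1 D M Z j Q I.
  by apply: whitney0_star => //; exact: whitneyQ_0.
split => //; first by case: WI.
move=> p Ip; have := @star_sub_tent y 0 Q (sub_dilate Qy).
by rewrite addr0; apply => //; exists I.
Qed.

End Telescope.

End TentGeometry.

(** * What the analysis uses of the geometry of a tent *)

Section TentSummary.
Context {R : realType} {n : nat}.
Local Notation Rn := 'rV[R]_n.
Local Notation len := (@len R).

(* [av] is a function of balls, and [cost p] bounds its variation between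
   nested balls of radii comparable to [len (j + p)] near the point: the
   variation between a cube close to that point and the cube [I0] is then at
   most the sum of the costs. *)
Definition telescopes (Om T : set Rn) (KA theta L : R) (j : int) (I0 : dyadic n) :=
  forall (av : Rn -> R -> R) (cost : nat -> R) X, T X -> (forall p, 0 <= cost p) ->
    (forall p : nat, let l := len (j + p%:Z) in
       nested_bound Om T av X (KA * l) (KA * l) (theta * l) (cost p)) ->
    exists (s : R) (K : nat -> dyadic n), forall q, [/\ dcube 1 (K q) X,
      dcube 1 (K q) `<=` Om, side (K q) <= s * len q%:Z &
      exists N, `|avd av (K q) - avd av I0| <= L * \sum_(p < N) cost p].

Definition traces (Om : set Rn) (C1 : R) (D : int -> set (set Rn)) (T Q : set Rn)
    (KA theta L : R) (j : int) (I0 : dyadic n) :=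
  forall (av : Rn -> R -> R) (cost : nat -> R) x, Q x -> (forall p, 0 <= cost p) ->
    (forall p : nat, let l := len (j + p%:Z) in
       nested_bound Om T av x (KA * l) (KA * l) (theta * l) (cost p)) ->
    forall q : nat, exists X, [/\ cone Om C1 D x X, Om X,
      delta Om X <= 5 * len (j + q%:Z) &
      `|av X (delta Om X / 2) - avd av I0| <= L * \sum_(p < q.+1) cost p].

Lemma tent_geometry (Om : set Rn) (C1 : R) (D : int -> set (set Rn)) (a0 : R)
    (M : nat) (c C0 : R) (Z : int -> set Rn -> dyadic n -> dyadic n -> nat -> Rn) :
  (0 < n)%N -> open Om -> boundary Om !=set0 -> 0 < C1 -> H1 Om C1 ->
  christ_cubes Om D a0 -> 0 < c -> 0 < C0 -> harnack_chains Om C1 D M c C0 Z ->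
  exists KA theta L : R, [/\ 1 <= KA, 0 < theta, 0 < L &
  forall j Q, D j Q -> exists I0, let T := tent2 Om C1 D M Z j Q in
    [/\ whitney Om I0 /\ dcube 1 I0 `<=` T,
        T `<=` Om, forall X y, T X -> Q y -> enorm (X - y) <= KA * len j,
        telescopes Om T KA theta L j I0 & traces Om C1 D T Q KA theta L j I0]].
Proof.
move=> n0 oOm b0 C1_gt0 h1 hD c_gt0 C0_gt0 hZ.
have [d1 [g0 [d1_gt0 hd1 hg0]]] := scale_exists n0 c_gt0.
exists (5 * (20 + C0)), (Defs.len (g0 + d1).+1%:Z / 4), (@LT R n M C0 d1 g0).
split; [by lra|by rewrite divr_gt0// len_gt0|exact: LT_gt0|].
move=> j Q DQ.
have [I0 [WI0 wI IT]] : exists I0, [/\ whitneyQ Om C1 j Q I0, whitney Om I0 &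
    dcube 1 I0 `<=` tent2 Om C1 D M Z j Q].
  by eapply tent_top; eassumption.
exists I0 => /=; split => //.
- exact: (tent_sub n0 C1_gt0 c_gt0 C0_gt0 d1_gt0 hd1 hg0).
- move=> X y TX Qy.
  exact: (tent_near n0 oOm b0 C1_gt0 hD c_gt0 C0_gt0 hZ d1_gt0 hd1 hg0 DQ TX Qy).
- move=> av cost X TX cge nb.
  exact: (tent_telescope n0 oOm b0 C1_gt0 h1 hD c_gt0 C0_gt0 hZ d1_gt0 hd1 hg0
    DQ WI0 TX cge nb).
- move=> av cost x Qx cge nb.
  exact: (trace_telescope n0 oOm b0 C1_gt0 h1 hD C0_gt0 hZ d1_gt0 hd1 hg0
    DQ WI0 Qx cge nb).
Qed.

End TentSummary.

(** * Real sequences and powers *)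

Section RealBounds.
Context {R : realType}.

Lemma eqW (x y : R) : x = y -> x <= y.
Proof. by move=> ->. Qed.

Lemma sum_geometric_le (x : R) N : 0 <= x < 1 -> \sum_(p < N) x ^+ p <= (1 - x)^-1.
Proof.
move=> /andP[x0 x1]; have x1' : 0 < 1 - x by rewrite subr_gt0.
rewrite -[leRHS]mul1r ler_pdivlMr//.
have -> : (\sum_(p < N) x ^+ p) * (1 - x) = 1 - x ^+ N.
  by rewrite -[1 - x]opprB mulrN mulrC -subrX1 opprB.
by rewrite gerBl exprn_ge0.
Qed.

Lemma sum_sqrt_geometric (U x : R) (a : nat -> R) N : 0 <= x < 1 -> 0 <= U ->
  (forall p, a p <= U * x ^+ p) ->
  \sum_(p < N) Num.sqrt (a p) <= Num.sqrt U / (1 - Num.sqrt x).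
Proof.
move=> /andP[x0 x1] U0 ha.
have s1 : 0 <= Num.sqrt x < 1 by rewrite sqrtr_ge0/= -sqrtr1 ltr_sqrt.
apply: le_trans (_ : \sum_(p < N) Num.sqrt U * Num.sqrt x ^+ p <= _).
  apply: ler_sum => p _; apply: (@le_trans _ _ (Num.sqrt (U * x ^+ p))).
    by rewrite ler_wsqrtr.
  rewrite sqrtrM//; apply: eqW; congr (_ * _).
  elim: (p : nat) => [|q IH]; first by rewrite !expr0 sqrtr1.
  by rewrite !exprS sqrtrM// IH.
rewrite -mulr_sumr; apply: ler_wpM2l; first exact: sqrtr_ge0.
exact: sum_geometric_le.
Qed.

(* [a p ^ k <= (4 / 3) ^ p v (W D ^ p) ^ (k - 1)], and [4 / 3 * (3 / 2) = 2]: the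
   growth is still beaten by the factor [(1 / 4) ^ p] in the squared costs. *)
Lemma powR_interpolation (k D W v : R) (a : nat -> R) : 1 < k -> 0 <= D ->
  D `^ (k - 1) = 3 / 2 -> 0 <= W -> (forall p, 0 <= a p <= W * D ^+ p) ->
  (forall p, (3 / 4) ^+ p * a p <= v) ->
  forall p, a p <= (v * W `^ (k - 1)) `^ k^-1 * 2 ^+ p.
Proof.
move=> k1 D0 Dk W0 ha hv p; have /andP[a0 aW] := ha p.
have k0 : 0 < k by apply: lt_trans k1.
have v0 : 0 <= v by apply: le_trans (hv p); rewrite mulr_ge0// exprn_ge0// divr_ge0.
have Wk0 : 0 <= W `^ (k - 1) by exact: powR_ge0.
have ak : a p `^ k <= v * W `^ (k - 1) * 2 ^+ p.
  rewrite -mulr_powRB1//.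
  have h1 : a p <= (4 / 3) ^+ p * v.
    rewrite -(@ler_pM2l _ ((3 / 4) ^+ p)) ?exprn_gt0// ?divr_gt0//.
    by rewrite mulrA -exprMn (_ : 3 / 4 * (4 / 3) = 1 :> R) ?expr1n ?mul1r//; lra.
  have h2 : a p `^ (k - 1) <= W `^ (k - 1) * (3 / 2) ^+ p.
    have -> : (3 / 2) ^+ p = (D ^+ p) `^ (k - 1).
      rewrite -Dk -(powR_mulrn p (powR_ge0 _ _)) -powRrM [(k - 1) * _]mulrC powRrM.
      by rewrite powR_mulrn.
    rewrite -powRM ?exprn_ge0//.
    apply: ge0_ler_powR; rewrite ?nnegrE//; first by rewrite subr_ge0 ltW.
    by rewrite mulr_ge0// exprn_ge0.
  apply: (@le_trans _ _ (((4 / 3) ^+ p * v) * (W `^ (k - 1) * (3 / 2) ^+ p))).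
    by apply: ler_pM => //; exact: powR_ge0.
  rewrite [X in _ <= _ * X](_ : 2 ^+ p = (4 / 3) ^+ p * (3 / 2) ^+ p); last first.
    by rewrite -exprMn; congr (_ ^+ p); lra.
  by apply: eqW; ring.
have kV : 0 <= k^-1 by rewrite invr_ge0 ltW.
have -> : a p = (a p `^ k) `^ k^-1.
  by rewrite -powRrM divff ?gt_eqF// powRr1.
apply: le_trans (_ : (v * W `^ (k - 1) * 2 ^+ p) `^ k^-1 <= _).
  by apply: ge0_ler_powR; rewrite ?nnegrE ?powR_ge0// ?mulr_ge0// exprn_ge0.
rewrite powRM ?mulr_ge0 ?exprn_ge0//; apply: ler_wpM2l; first exact: powR_ge0.
apply: ler1_powR; first by rewrite exprn_ege1// ler1n.
by rewrite invf_le1// ltW.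
Qed.

Lemma nneseries_le_bound (u : nat -> R) (B : R) : (forall p, 0 <= u p) ->
  (forall N, \sum_(p < N) u p <= B) -> (\sum_(0 <= p <oo) (u p)%:E <= B%:E)%E.
Proof.
move=> u0 uB; apply: lime_le; first by apply: is_cvg_nneseries => p _ _; rewrite lee_fin.
by apply: nearW => N; rewrite big_mkord sumEFin lee_fin.
Qed.

Lemma nneseries_ge_term (u : nat -> \bar R) (p : nat) : (forall p, 0 <= u p)%E ->
  (u p <= \sum_(0 <= q <oo) u q)%E.
Proof.
move=> u0; apply: le_trans (nneseries_lim_ge p.+1 _); last by [].
by rewrite big_nat_recr//= leeDr// sume_ge0.
Qed.

(** [k = 1 + ln (3/2) / ln D], where [D >= 2] makes [ln D] positive. *)
Lemma exponent_exists (B : R) : exists D k : R, [/\ B <= D, 1 <= D, 1 < k & D `^ (k - 1) = 3 / 2].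
Proof.
pose D := Num.max B 2; have D2 : 2 <= D by rewrite le_max lexx orbT.
have D1 : 1 < D by apply: lt_le_trans D2; rewrite ltr1n.
have lD : 0 < ln D by exact: ln_gt0.
have l32 : 0 < ln (3 / 2 : R) by apply: ln_gt0; lra.
exists D, (1 + ln (3 / 2) / ln D); split.
- by rewrite le_max lexx.
- exact: ltW.
- by rewrite ltrDl divr_gt0.
rewrite addrAC subrr add0r /powR gt_eqF ?(lt_trans ltr01)// divfK ?gt_eqF// lnK//.
by rewrite posrE divr_gt0.
Qed.

(** Lets [t] tend to 0: after taking [k]-th roots, [t] is a plain additive error. *)
Lemma powR_absorb (s y K k : R) : 0 < K -> 0 < k -> 0 <= s -> 0 <= y ->
  (forall t, 0 < t -> y <= K * (s + t) `^ k) -> y <= K * s `^ k.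
Proof.
move=> K0 k0 s0 y0 h; have yK0 : 0 <= y / K by rewrite divr_ge0// ltW.
suff : (y / K) `^ k^-1 <= s.
  move=> /(ge0_ler_powR (ltW k0)); rewrite !nnegrE powR_ge0 => /(_ isT s0).
  by rewrite -powRrM mulVf ?gt_eqF// powRr1// ler_pdivrMr// mulrC.
apply/ler_addgt0Pr => t t0; have st0 : 0 <= s + t by rewrite addr_ge0// ltW.
rewrite -(powRr1 st0) -(mulfV (lt0r_neq0 k0)) powRrM.
apply: ge0_ler_powR; rewrite ?nnegrE ?powR_ge0 ?invr_ge0 ?(ltW k0)//.
by rewrite ler_pdivrMr// mulrC; exact: h.
Qed.

Lemma powR_normD_le (a b p : R) : 0 <= p ->
  `|a + b| `^ p <= 2 `^ p * (`|a| `^ p + `|b| `^ p).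
Proof.
move=> p0; pose w := Num.max `|a| `|b|.
have w0 : 0 <= w by rewrite le_max normr_ge0.
have h : `|a + b| <= 2 * w.
  apply: le_trans (ler_normD a b) _; rewrite mulr_natl mulr2n.
  by apply: lerD; rewrite le_max lexx ?orbT.
apply: le_trans (ge0_ler_powR p0 _ _ h) _; rewrite ?nnegrE ?mulr_ge0//.
rewrite powRM//; apply: ler_wpM2l; first exact: powR_ge0.
by rewrite /w /Num.max; case: ifP => _; rewrite ?lerDl ?lerDr powR_ge0.
Qed.

Lemma powR_two_lt1 (e : R) : 0 < e -> 0 < 2 `^ (- e) < (1 : R).
Proof.
move=> e0; rewrite powR_gt0//= powRN invf_lt1 ?powR_gt0//.
have := congr1 (fun f => f e) (@powR1 R) => /= {1}<-.
by apply: gt0_ltr_powR; rewrite ?nnegrE ?ltr1n.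
Qed.

Lemma inve_fin (x : \bar R) : (0 < x < +oo)%E -> (x^-1)%E = ((fine x)^-1)%:E.
Proof.
case: x => [x| |] //=; last by rewrite ltxx andbF.
by move=> /andP[x0 _]; rewrite inver gt_eqF.
Qed.

Lemma limn_einf_ge (f : nat -> \bar R) c : (forall i, c <= f i)%E -> (c <= limn_einf f)%E.
Proof.
move=> cf; rewrite limn_einf_lim; apply: lime_ge; first exact: is_cvg_einfs.
by apply: nearW => i; apply: le_ereal_inf_tmp => _ [j _ <-]; exact: cf.
Qed.

Lemma limn_einf_le (f : nat -> \bar R) c : (forall i, f i <= c)%E -> (limn_einf f <= c)%E.
Proof.
move=> fc; rewrite limn_einf_lim; apply: lime_le; first exact: is_cvg_einfs.
apply: nearW => i; apply: le_trans (fc i); apply: ereal_inf_lbound.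
by exists i => //=.
Qed.

(** If [a = 0] the bound is the positivity of powers; otherwise [t ^ p] is differentiable at [|a|],
    hence continuous there. *)
Lemma powR_limn_einf (p a : R) (f : nat -> R) : 0 < p -> f i @[i --> \oo] --> a ->
  ((`|a| `^ p)%:E <= limn_einf (fun i => (`|f i| `^ p)%:E))%E.
Proof.
move=> p0 fa; have [a0|a0] := eqVneq `|a| 0.
  by rewrite a0 powR0 ?gt_eqF//; apply: limn_einf_ge => i; rewrite lee_fin powR_ge0.
have ap : 0 < `|a| by rewrite lt_def a0 normr_ge0.
suff h : (`|f i| `^ p)%:E @[i --> \oo] --> (`|a| `^ p)%:E.
  by rewrite (cvg_limn_einf_sup h).1.
apply: cvg_EFin; first exact: nearW.
have c : {for `|a|, continuous (fun t : R => t `^ p)}.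
  apply: differentiable_continuous; apply/derivable1_diffP.
  by apply: ex_derive; exact: is_derive1_powR.
by have := continuous_cvg _ c (cvg_norm fa); apply.
Qed.

Lemma summable_cvg0 (f : nat -> R) : (forall i, 0 <= f i) ->
  (\sum_(0 <= i <oo) (f i)%:E \is a fin_num)%E -> f i @[i --> \oo] --> (0 : R).
Proof.
move=> f0 ff; apply: cvg_series_cvg_0; apply: nondecreasing_is_cvgn.
  by apply/nondecreasing_seqP => i; rewrite /series/= big_nat_recr//= lerDl.
exists (fine (\sum_(0 <= i <oo) (f i)%:E)%E) => _ [i _ <-].
rewrite -lee_fin fineK// /series/= -sumEFin.
by apply: nneseries_lim_ge => j _ _; rewrite lee_fin.
Qed.

Lemma cvge0_eventually (u : nat -> \bar R) (e : R) : u i @[i --> \oo] --> 0%E -> 0 < e ->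
  exists N, forall i, (N <= i)%N -> (u i <= e%:E)%E.
Proof.
move=> /fine_cvgP[fu /cvgrPdist_le cu] e0.
have [N _ hN] := filterI fu (cu e e0).
exists N => i Ni; have [fi ui] := hN i Ni.
rewrite -(fineK fi) lee_fin; apply: le_trans ui.
by rewrite sub0r normrN; exact: ler_norm.
Qed.

End RealBounds.

(** * Measurability *)

Section Borel.
Context {R : realType} {n : nat}.
Local Notation Rn := 'rV[R]_n.
Implicit Types (A B U : set Rn).

Lemma borel_open A : open A -> measurable A.
Proof. by move=> oA; apply: sub_sigma_algebra. Qed.

Lemma borel_closed A : closed A -> measurable A.
Proof. by move=> /closed_openC/borel_open/measurableC; rewrite setCK. Qed.

Lemma eball_measurable (x : Rn) (r : R) : measurable (eball x r).
Proof. by apply: borel_open; exact: eball_open. Qed.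

Lemma cball_measurable (x : Rn) (r : R) : measurable (cball x r).
Proof. by apply: borel_closed; exact: cball_closed. Qed.

Lemma dcube_measurable (lam : R) (I : dyadic n) : measurable (dcube lam I : set Rn).
Proof.
apply: borel_closed.
have -> : (dcube lam I : set Rn) = \bigcap_(i : 'I_n)
    [set x : Rn | `|x ord0 i - center I ord0 i| <= lam * side I / 2].
  by apply/seteqP; split => x h i *; exact: h.
apply: closed_bigI => i _; set c := center I ord0 i; set b := lam * _ / 2.
have -> : [set x : Rn | `|x ord0 i - c| <= b] =
    (fun x : Rn => `|x ord0 i - c|) @^-1` [set t | t <= b] by [].
apply: closed_comp; last exact: closed_le.
move=> x _; apply: (@continuous_comp _ _ _ (fun x : Rn => x ord0 i - c) Num.norm).
  by apply: continuousB; [exact: coord_continuousr|exact: cst_continuous].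
exact: norm_continuous.
Qed.

Lemma coord_measurable (i : 'I_n) A : measurable A ->
  measurable_fun A (fun x : Rn => x ord0 i).
Proof.
move=> mA; apply: (@measurable_funS _ _ _ _ setT) => //.
apply: (measurability _ (RGenOpens.measurableE R)).
move=> _ [_ [a [b ->] <-]]; rewrite setTI; apply: borel_open.
apply: open_comp; last exact: interval_open.
by move=> x _; exact: coord_continuousr.
Qed.

Lemma continuous_within_measurable U (V : set Rn) (g f : Rn -> R) : open U -> U `<=` V ->
  {within V, continuous g} -> (forall x, U x -> g x = f x) -> measurable_fun U f.
Proof.
move=> oU UV cg gf; apply: (@eq_measurable_fun _ _ _ _ U g).
  by move=> x /[!inE] /gf.
have /continuousP cg' : {within U, continuous g} by exact: continuous_subspaceW cg.
apply: (measurability _ (RGenOpens.measurableE R)).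
move=> _ [_ [a [b ->] <-]].
have /open_subspaceP[W oW WU] : open (g @^-1` `]a, b[ : set (subspace U)).
  exact/cg'/interval_open.
by rewrite setIC -WU; apply: borel_open; exact: openI.
Qed.

Lemma enorm_measurable : measurable_fun setT (enorm : Rn -> R).
Proof.
apply: (@continuous_within_measurable setT setT enorm) => //; first exact: openT.
by apply: continuous_subspaceT; exact: enorm_continuous.
Qed.

Lemma enorm_sq_measurable U (v : Rn -> Rn) : measurable U -> measurable_fun U v ->
  measurable_fun U (fun x => enorm (v x) ^+ 2).
Proof.
move=> mU mv; apply: (@measurable_funX _ _ _ _ (fun x => enorm (v x))).
by apply: measurableT_comp mv; exact: enorm_measurable.
Qed.

Lemma grad_sq_measurable (Om : set Rn) (f : Rn -> R) : open Om -> smooth_closure Om f ->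
  measurable_fun Om (fun x => enorm (grad f x) ^+ 2).
Proof.
move=> oOm sf.
have -> : (fun x => enorm (grad f x) ^+ 2) =
    (fun x => \sum_(i < n) ('D_(evec i) f x) ^+ 2).
  by apply/funext => x; rewrite enorm_sq; apply: eq_bigr => i _; rewrite mxE.
apply: measurable_sum => i; apply: measurable_funX.
have [_ [g [cg gf]]] := sf [:: i].
by apply: continuous_within_measurable cg gf => //; exact: subset_closure.
Qed.

Lemma countable_union_measurable (T : countType) (P : set T) (F : T -> set Rn) :
  (forall t, measurable (F t)) -> measurable (\bigcup_(t in P) F t).
Proof.
move=> mF; rewrite bigcup_mkcond; apply: countable_bigcupT_measurable.
  exact: countableP.
by move=> t; case: ifP.
Qed.

(** The union over uncountably many [x] only selects a set of dyadic cubes, and there are countably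
    many of these. *)
Lemma tent_measurable (Om : set Rn) (C1 : R) (D : int -> set (set Rn)) (M : nat)
    (Z : int -> set Rn -> dyadic n -> dyadic n -> nat -> Rn) j Q :
  measurable (tent2 Om C1 D M Z j Q).
Proof.
rewrite (_ : tent2 Om C1 D M Z j Q = \bigcup_(I in [set I : dyadic n |
    exists x k' Q', [/\ dilate Om 2 j Q x, D k' Q', Q' x, @len R k' <= len j &
      whitney_star Om C1 D M Z k' Q' I]]) dcube 1 I).
  by apply: countable_union_measurable => I; exact: dcube_measurable.
apply/seteqP; split => X.
  move=> [x dx [k' [Q' [DQ' Q'x kj [I WI IX]]]]].
  by exists I => //; exists x, k', Q'.
move=> [I [x [k' [Q' [dx DQ' Q'x kj WI]]]] IX].
by exists x => //; exists k', Q'; split => //; exists I.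
Qed.

End Borel.

Section LebesgueSetFunction.
Import HBNNSimple.
Context {R : realType} {n : nat}.
Local Notation Rn := 'rV[R]_n.

Lemma leb_set0 (k : nat) : leb (set0 : set 'rV[R]_k) = 0%E.
Proof.
elim: k => [|k IH] /=; first by rewrite indicE in_set0.
by rewrite (eq_integral (fun=> 0%E)) ?integral0.
Qed.

(* [leb] is only a set function here, so the library's monotonicity of the
   integral, which is stated for measures, does not apply. *)
Lemma integral_set_function_le_abs (mu : set Rn -> \bar R) (K : set Rn) (w : Rn -> R) :
  mu set0 = 0%E ->
  (\int[mu]_(x in K) (w x)%:E <= \int[mu]_(x in K) `|w x|%:E)%E.
Proof.
move=> mu0; rewrite /integral.
have s0 (h : {nnsfun Rn >-> R}) : (forall x, h x = 0) -> sintegral mu h = 0%E.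
  move=> h0; rewrite /sintegral fsbig1// => x _.
  have [->|x0] := eqVneq x 0; first by rewrite mul0e.
  rewrite (_ : h @^-1` [set x] = set0) ?mu0 ?mule0//.
  by apply/seteqP; split => // y /= hy; move: x0; rewrite -hy h0 eqxx.
apply: leeB; last first.
  apply: (@le_trans _ _ 0%E).
    apply: ge_ereal_sup => _ [h hle <-]; rewrite s0// => x; apply/eqP.
    rewrite eq_le fun_ge0 andbT -lee_fin; apply: le_trans (hle x) _.
    rewrite funenegE /patch; case: ifP => _; rewrite ?oppe0 ?maxxx//.
    by rewrite -EFinN -EFin_max lee_fin ge_max lexx andbT oppr_le0.
  apply: ereal_sup_ubound; exists nnsfun0; last by rewrite s0.
  by move=> x; exact: funeneg_ge0.
apply: ereal_sup_le => _ [h hle <-]; exists h => // x; apply: le_trans (hle x) _.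
rewrite !funeposE /patch; case: ifP => _ //.
by rewrite -!EFin_max lee_fin ge_max !le_max ler_norm lexx orbT.
Qed.

End LebesgueSetFunction.

(** * Bounded overlap of balls of one scale *)

Section Kernel.
Context {R : realType} {n : nat}.
Local Notation Rn := 'rV[R]_n.
Local Notation len := (@len R).

Lemma cell_measurable i (z : 'rV[int]_n) : measurable [set x : Rn | (dcell i x).2 = z].
Proof.
have -> : [set x : Rn | (dcell i x).2 = z] = \bigcap_(k : 'I_n)
    ((fun x : Rn => x ord0 k) @^-1` `[len i * (z ord0 k)%:~R, len i * ((z ord0 k)%:~R + 1)[).
  apply/seteqP; split => x /=.
    move=> xz k _; have /dcellP/(_ k) : dcell i x = (i, z) by rewrite -xz.
    by rewrite /= in_itv.
  move=> h; apply: (congr1 snd ((dcellP i z x).2 _)) => k.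
  by have := h k I; rewrite /= in_itv.
apply: fin_bigcap_measurable; first exact: finite_finset.
move=> k _; rewrite -[_ @^-1` _]setTI; apply: coord_measurable => //.
Qed.

Lemma centerE (I : dyadic n) k :
  (center I : Rn) ord0 k = side I * ((I.2 ord0 k)%:~R + 2^-1).
Proof. by rewrite mxE. Qed.

(** Centered at the cell of [x] rather than at [x]: whatever is computed from it is constant on the
    cells, hence measurable, and the overlap is counted on integer indices. *)
Definition nball (K : R) (i : int) (x : Rn) : set Rn :=
  eball (center (dcell i x)) (K * len i).

(** On each cell [f] is constant and [w] dominates the measure of the part in [A], so the integral
    of [f] there is at most that of [G] over [T] and the ball of the cell. This ball is covered by
    the cells at a bounded set of index shifts, and for each shift the sum over all cells is the
    integral over [T]; [Nov] is the number of shifts. The cells are numbered by [pickle]. *)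
Lemma kernel_bound (K : R) : exists2 Nov : R, 0 <= Nov &
  forall (m nu : {measure set Rn -> \bar R}) (A T : set Rn) (G : Rn -> R) i (w : Rn -> R),
  measurable A -> measurable T -> measurable_fun T G -> (forall y, T y -> 0 <= G y) ->
  (forall x x', dcell i x = dcell i x' -> w x = w x') ->
  (forall x, A x -> 0 < w x /\
    (nu (A `&` [set x' | (dcell i x').2 = (dcell i x).2]) <= (w x)%:E)%E) ->
  let f x := ((w x)^-1%:E * \int[m]_(y in T `&` nball K i x) (G y)%:E)%E in
  measurable_fun A f /\ (\int[nu]_(x in A) f x <= Nov%:E * \int[m]_(y in T) (G y)%:E)%E.
Proof.
pose L0 := (Num.Def.archi_bound (`|K| + 1)).
have hL0 : `|K| + 1 < L0%:R by apply: archi_boundP; rewrite addr_ge0.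
pose S : finType := {ffun 'I_n -> 'I_(2 * L0).+1}.
pose shift (s : S) : 'rV[int]_n := \row_k ((s k : nat)%:Z - L0%:Z).
exists #|S|%:R => // m nu A T G i w mA mT mG G0 wc hw f.
have f_const x x' : dcell i x = dcell i x' -> f x = f x'.
  by move=> xx'; rewrite /f (wc _ _ xx') /nball xx'.
pose cz (x : Rn) := (dcell i x).2.
pose F (k : nat) := A `&` [set x | pickle (cz x) = k].
have FE k (x0 : Rn) : F k x0 -> F k = A `&` [set x | cz x = cz x0].
  move=> [_ /= <-]; apply/seteqP; split => x [Ax /=].
    by move=> /(pcan_inj pickleK) xx0; split.
  by move=> xx0; split => //=; rewrite xx0.
have mF k : measurable (F k).
  have [->|/set0P[x0 /FE ->]] := eqVneq (F k) set0 => //.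
  by apply: measurableI => //; exact: cell_measurable.
have AF : A = \bigcup_k F k.
  apply/seteqP; split => [x Ax|x [k _ []//]].
  by exists (pickle (cz x)).
have tF : trivIset setT F.
  by apply/trivIsetP => a b _ _ ab; apply/seteqP; split => // x [[_ /= xa] [_ /= xb]];
    move: ab; rewrite -xa -xb eqxx.
have Fcst k x0 : F k x0 -> {in F k, f =1 cst (f x0)}.
  move=> Fx0 x; rewrite inE (FE _ _ Fx0) => -[_ /= e]; apply: f_const.
  by rewrite /dcell -/(cz x) -/(cz x0); congr pair.
have mf : measurable_fun A f.
  rewrite AF; apply/measurable_fun_bigcup => // k.
  have [->|/set0P[x0 Fx0]] := eqVneq (F k) set0; first exact: measurable_fun_set0.
  apply: (eq_measurable_fun (cst (f x0))); last exact: measurable_cst.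
  by move=> x /(Fcst _ _ Fx0) ->.
split => //.
have f0 x : A x -> (0 <= f x)%E.
  move=> Ax; apply: mule_ge0; first by rewrite lee_fin invr_ge0 ltW// (hw x Ax).1.
  by apply: integral_ge0 => y [Ty _]; rewrite lee_fin G0.
rewrite [X in (\int[_]_(x in X) _ <= _)%E]AF ge0_integral_bigcup//; last 2 first.
- by rewrite -AF.
- by move=> x; rewrite -AF; exact: f0.
(* For a fixed shift [s] these sets partition [T]; number [k] is the part of [T] in the cell whose
   index is that of [F k] plus [s]. *)
pose Ek (s : S) (k : nat) := T `&` [set y | pickle (cz y - shift s) = k].
have EkE s k (y0 : Rn) : Ek s k y0 -> Ek s k = T `&` [set y | cz y = cz y0].
  move=> [_ /= <-]; apply/seteqP; split => x [Ax /=].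
    by move=> /(pcan_inj pickleK)/addIr xx0; split.
  by move=> xx0; split => //=; rewrite xx0.
have mE s k : measurable (Ek s k).
  have [->|/set0P[x0 /EkE ->]] := eqVneq (Ek s k) set0 => //.
  by apply: measurableI => //; exact: cell_measurable.
have TE s : T = \bigcup_k Ek s k.
  apply/seteqP; split => [x Ax|x [k _ []//]].
  by exists (pickle (cz x - shift s)).
have tE s : trivIset setT (Ek s).
  by apply/trivIsetP => a b _ _ ab; apply/seteqP; split => // x [[_ /= xa] [_ /= xb]];
    move: ab; rewrite -xa -xb eqxx.
have mGE : measurable_fun T (fun y => (G y)%:E) by exact/measurable_EFinP.
have bound k : (\int[nu]_(x in F k) f x <=
    \sum_(s <- index_enum S) \int[m]_(y in Ek s k) (G y)%:E)%E.
  have [->|/set0P[x0 Fx0]] := eqVneq (F k) set0.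
    rewrite integral_set0; apply: sume_ge0 => s _; apply: integral_ge0 => y [Ty _].
    by rewrite lee_fin G0.
  have -> : (\int[nu]_(x in F k) f x = f x0 * nu (F k))%E.
    by rewrite -(integral_cst nu (mF k)); apply: eq_integral; exact: Fcst.
  have [Ax0 /= kE] := Fx0; have [w0 nuw] := hw x0 Ax0.
  have nF : (nu (F k) <= (w x0)%:E)%E by rewrite (FE _ _ Fx0).
  have I0 : (0 <= \int[m]_(y in T `&` nball K i x0) (G y)%:E)%E.
    by apply: integral_ge0 => y [Ty _]; rewrite lee_fin G0.
  apply: (@le_trans _ _ (\int[m]_(y in T `&` nball K i x0) (G y)%:E)%E).
    rewrite /f muleAC -[leRHS]mul1e; apply: lee_wpmul2r => //.
    apply: le_trans (lee_wpmul2l _ nF) _; first by rewrite lee_fin invr_ge0 ltW.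
    by rewrite -EFinM mulVf// gt_eqF.
  have mB : measurable (nball K i x0) by exact: eball_measurable.
  pose Bs (s : S) := [set y : Rn | pickle (cz y - shift s) = k].
  have mTE s : measurable (Bs s).
    rewrite /Bs; have [->|/set0P[y0 /= Y0]] :=
      eqVneq [set y : Rn | pickle (cz y - shift s) = k] set0 => //.
    rewrite (_ : [set y | _] = [set y : Rn | cz y = cz y0]); first exact: cell_measurable.
    apply/seteqP; split => y /=; rewrite -Y0; last by move=> ->.
    by move=> /(pcan_inj pickleK)/addIr.
  rewrite integral_mkcondr.
  rewrite [leRHS](_ : _ = (\sum_(s <- index_enum S) \int[m]_(y in T)
      ((fun y => (G y)%:E) \_ (Bs s)) y)%E); last first.
    by apply: eq_bigr => s _; rewrite /Ek integral_mkcondr.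
  have pG (P : set Rn) y : T y -> (0 <= ((fun y => (G y)%:E) \_ P) y)%E.
    by move=> Ty; rewrite /patch; case: ifP => _ //; rewrite lee_fin G0.
  have mP (P : set Rn) : measurable P -> measurable_fun T ((fun y => (G y)%:E) \_ P).
    move=> mP; apply/measurable_restrict => //; apply: measurable_funS mGE => //.
  rewrite -ge0_integral_sum//; [|by move=> s; exact: mP|by move=> s y; exact: pG].
  apply: ge0_le_integral => //.
  - by move=> y Ty; exact: pG.
  - exact: mP.
  - by apply: emeasurable_sum => s; exact: mP.
  move=> y Ty; rewrite {1}/patch; case: ifPn => [|_]; last first.
    by apply: sume_ge0 => s _; exact: pG.
  rewrite inE => yB.
  (* [y] is within [K len i] of the center of the cell of [x0], so each coordinate of the two
     indices differs by less than [L0]; adding [L0] makes the difference a natural number. *)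
  pose d l : int := (cz y ord0 l - cz x0 ord0 l + L0%:Z).
  have dl l : 0 <= d l < (2 * L0).+1%:Z.
    have l0 := len_gt0 (R := R) i.
    have /dcellP/(_ l) : dcell i y = (i, cz y) by [].
    have /le_lt_trans/(_ yB) := coord_le_enorm (y - center (dcell i x0)) l.
    rewrite rvsubE centerE -[side _]/(len i) -/(cz x0).
    have KL : K * len i <= (L0%:R - 1) * len i.
      by rewrite ler_pM2r//; have := ler_norm K; lra.
    rewrite ltr_norml => /andP[h1 h2] /andP[h3 h4].
    have g1 : len i * ((cz x0 ord0 l)%:~R - (L0%:R - 1)) < len i * ((cz y ord0 l)%:~R + 1).
      by lra.
    have g2 : len i * (cz y ord0 l)%:~R < len i * ((cz x0 ord0 l)%:~R + L0%:R).
      by lra.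
    rewrite ltr_pM2l// in g1; rewrite ltr_pM2l// in g2.
    have {}g1 : cz x0 ord0 l - L0%:Z < cz y ord0 l.
      by rewrite -(ltr_int R) intrB -pmulrn; lra.
    have {}g2 : cz y ord0 l < cz x0 ord0 l + L0%:Z.
      by rewrite -(ltr_int R) intrD -pmulrn.
    by rewrite /d; clear -g1 g2; move: (cz y ord0 l) (cz x0 ord0 l) g1 g2 => a b; lia.
  pose s0 : S := [ffun l => inord (absz (d l))].
  have s0E : cz y - shift s0 = cz x0.
    apply/rowP => l; rewrite [LHS]mxE [X in _ + X]mxE [X in _ - X]mxE ffunE.
    rewrite inordK; last by have := dl l; clear; move: (d l) => a; lia.
    have /andP[d0 _] := dl l; rewrite gez0_abs// /d.
    by move: (cz y ord0 l) (cz x0 ord0 l) => a b; ring.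
  rewrite (bigD1_seq s0) ?mem_index_enum ?index_enum_uniq//=.
  apply: (@le_trans _ _ (((fun y => (G y)%:E) \_ (Bs s0)) y)).
    by rewrite /patch ifT// inE /Bs /= s0E.
  by rewrite leeDl// sume_ge0// => s _; exact: pG.
apply: le_trans (lee_nneseries _ (fun k _ => bound k)) _.
  move=> k _ _; apply: integral_ge0 => x Fx; apply: f0; rewrite AF.
  by exists k.
rewrite nneseries_sum; last first.
  by move=> s k _; apply: integral_ge0 => y [Ty _]; rewrite lee_fin G0.
rewrite (eq_bigr (fun=> \int[m]_(y in T) (G y)%:E)%E); last first.
  move=> s _; rewrite [in RHS](TE s) ge0_integral_bigcup//.
  - by rewrite -TE.
  - by move=> y; rewrite -TE => Ty; rewrite lee_fin G0.
have cst_sum (x : \bar R) k : (x *+ k)%R = (k%:R%:E * x)%E.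
  elim: k => [|k IH]; first by rewrite mulr0n mul0e.
  by rewrite mulrS IH -natr1 addrC EFinD ge0_muleDl ?lee_fin// mul1e.
by rewrite sumr_const cst_sum.
Qed.

(* The exponential sums of local energies are integrable because balls of
   radius comparable to the cells of one generation have bounded overlap. *)
Lemma kernel_series (K x : R) : 0 <= x < 1 -> exists2 Nov : R, 0 <= Nov &
  forall (m nu : {measure set Rn -> \bar R}) (A T : set Rn) (G : Rn -> R) (j : int)
    (w : nat -> Rn -> R),
  measurable A -> measurable T -> m.-integrable T (EFin \o G) -> (forall y, T y -> 0 <= G y) ->
  (forall p X Y, dcell (j + p%:Z) X = dcell (j + p%:Z) Y -> w p X = w p Y) ->
  (forall p X, A X -> 0 < w p X /\
    (nu (A `&` [set Y | (dcell (j + p%:Z) Y).2 = (dcell (j + p%:Z) X).2]) <= (w p X)%:E)%E) ->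
  let V X := (\sum_(0 <= p <oo)
    (x ^+ p * ((\int[m]_(y in T `&` nball K (j + p%:Z) X) G y) / w p X))%:E)%E in
  [/\ measurable_fun A V, forall X, A X -> (0 <= V X)%E &
      (\int[nu]_(X in A) V X <= (Nov * \int[m]_(y in T) G y)%:E)%E].
Proof.
move=> x01; have /andP[x0 x1] := x01; have [Nov Nov0 hN] := kernel_bound K.
have c0 : 0 <= (1 - x)^-1 by rewrite invr_ge0 subr_ge0 ltW.
exists ((1 - x)^-1 * Nov); first exact: mulr_ge0.
move=> m nu A T G j w mA mT Gi G0 wc hw V.
pose fk p X := ((w p X)^-1%:E * \int[m]_(y in T `&` nball K (j + p%:Z) X) (G y)%:E)%E.
have mG : measurable_fun T G by apply/measurable_EFinP; case/integrableP: Gi.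
have fkP p : measurable_fun A (fk p) /\
    (\int[nu]_(X in A) fk p X <= Nov%:E * \int[m]_(y in T) (G y)%:E)%E.
  by apply: (hN m nu A T G (j + p%:Z) (w p)) => //; [exact: wc|exact: hw].
have termE p X : (x ^+ p * ((\int[m]_(y in T `&` nball K (j + p%:Z) X) G y) / w p X))%:E =
    ((x ^+ p)%:E * fk p X)%E.
  rewrite EFinM; congr (_ * _)%E; rewrite /fk EFinM muleC /Rintegral fineK//.
  have mTN : measurable (T `&` nball K (j + p%:Z) X).
    by apply: measurableI => //; exact: eball_measurable.
  by apply: integrable_fin_num => //; exact: integrableS Gi.
have fk0 p X : A X -> (0 <= fk p X)%E.
  move=> AX; apply: mule_ge0; first by rewrite lee_fin invr_ge0 ltW//; case: (hw p X AX).
  by apply: integral_ge0 => y [Ty _]; rewrite lee_fin G0.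
have q0 p : 0 <= x ^+ p by exact: exprn_ge0.
have VE X : V X = (\sum_(0 <= p <oo) ((x ^+ p)%:E * fk p X))%E.
  by apply: eq_eseriesr => p _; exact: termE.
have mterm p : measurable_fun A (fun X => (x ^+ p)%:E * fk p X)%E.
  by apply: measurable_funeM; case: (fkP p).
have t0 p X : A X -> (0 <= (x ^+ p)%:E * fk p X)%E.
  by move=> AX; apply: mule_ge0; rewrite ?lee_fin// fk0.
have EE : (\int[m]_(y in T) (G y)%:E)%E = (\int[m]_(y in T) G y)%:E.
  by rewrite /Rintegral fineK//; exact: integrable_fin_num.
set E := \int[m]_(y in T) G y in EE *.
have E0 : 0 <= E by apply: Rintegral_ge0.
rewrite (funext VE); split.
- by apply: ge0_emeasurable_sum => // p X AX _; exact: t0.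
- by move=> X AX; apply: nneseries_ge0 => p _ _; exact: t0.
rewrite integral_nneseries//.
apply: (@le_trans _ _ (\sum_(0 <= p <oo) (x ^+ p * (Nov * E))%:E)%E).
  apply: lee_nneseries => [p _ _|p _]; first by apply: integral_ge0 => X; exact: t0.
  have q0e : (0 <= (x ^+ p)%:E)%E by rewrite lee_fin.
  rewrite (ge0_integralZl nu mA (fkP p).1 (fk0 p) q0e).
  rewrite EFinM; apply: lee_wpmul2l; first by rewrite lee_fin.
  by have [_] := fkP p; rewrite EE -EFinM.
apply: nneseries_le_bound => [p|N]; first by rewrite !mulr_ge0.
by rewrite -mulr_suml -mulrA ler_wpM2r ?mulr_ge0// sum_geometric_le.
Qed.

End Kernel.

(** * The Sobolev inequality in a tent *)

Section Analysis.
Context {R : realType} {n : nat}.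
Local Notation Rn := 'rV[R]_n.
Local Notation len := (@len R).
Local Notation sn := (Num.sqrt n%:R : R).
Variables (Om : set Rn) (m : {measure set Rn -> \bar R}) (C4 : R).
Hypotheses (oOm : open Om) (Om0 : Om !=set0) (C4_gt0 : 0 < C4) (h4 : H4 Om m C4).

Let mOm : measurable Om := borel_open oOm.

Lemma ball_inter_measurable (X : Rn) r : measurable (eball X r `&` Om).
Proof. by apply: measurableI => //; exact: eball_measurable. Qed.

Lemma compact_measure_finite (K : set Rn) : measurable K -> compact K -> K `<=` Om ->
  (m K < +oo)%E.
Proof.
move=> mK cK KO; have [[w [[_ wL] _ ->//]] _] := h4.
apply: le_lt_trans (wL K cK KO).
by apply: integral_set_function_le_abs; exact: leb_set0.
Qed.

Lemma ball_doubling (X : Rn) (r : R) (q : nat) : closure Om X -> 0 < r ->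
  (m (eball X (2 ^+ q * r) `&` Om) <= (C4 ^+ q)%:E * m (eball X r `&` Om))%E.
Proof.
move=> cX r0; elim: q => [|q IH]; first by rewrite !expr0 mul1r mul1e.
rewrite exprS -mulrA; have [_ h] := h4.
have r0' : 0 < 2 ^+ q * r by rewrite mulr_gt0// exprn_gt0.
apply: le_trans (h X _ cX r0') _; rewrite exprS EFinM -muleA.
by apply: lee_wpmul2l => //; rewrite lee_fin ltW.
Qed.

(** A small closed ball in [Om] is compact and [w] is integrable on it; every other ball is reached
    from it by doubling. *)
Lemma ball_measure_finite (X : Rn) (r : R) : (m (eball X r `&` Om) < +oo)%E.
Proof.
have [X0 OX0] := Om0.
have [s s0 sO] := nbhs_eball (open_nbhs_nbhs (conj oOm OX0)).
have s2 : 0 < s / 2 by rewrite divr_gt0.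
have c0 : (m (eball X0 (s / 2) `&` Om) < +oo)%E.
  have : (m (cball X0 (s / 2)) < +oo)%E.
    apply: compact_measure_finite; [exact: cball_measurable|exact: cball_compact|].
    by move=> y ys; apply: sO; apply: le_lt_trans ys _; lra.
  apply: le_lt_trans; apply: le_measure; rewrite ?inE.
  - exact: ball_inter_measurable.
  - exact: cball_measurable.
  - by move=> y [/eball_cball].
pose q := Num.Def.archi_bound ((enorm (X - X0) + `|r|) / (s / 2)).
apply: le_lt_trans (_ : m (eball X0 (2 ^+ q * (s / 2)) `&` Om) < +oo)%E.
  apply: le_measure; rewrite ?inE; [exact: ball_inter_measurable..|].
  apply: setSI; apply: eball_sub.
  apply: le_trans (_ : enorm (X - X0) + `|r| <= _); first by rewrite lerD2l ler_norm.
  by rewrite -ler_pdivrMr//; apply: ltW; exact: upper_nthrootP.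
apply: le_lt_trans (ball_doubling q (subset_closure OX0) s2) _.
by apply: lte_mul_pinfty => //; rewrite ?lee_fin ?exprn_ge0 ?ltW.
Qed.

(** The balls centered at [X] exhaust [Om]; if one of them were null, doubling would make all of
    them null, and [Om] too. *)
Lemma ball_measure_gt0 (X : Rn) (r : R) : m Om != 0%E -> closure Om X -> 0 < r ->
  (0 < m (eball X r `&` Om))%E.
Proof.
move=> mO cX r0; rewrite lt0e measure_ge0 andbT; apply: contra_neq mO => m0.
apply/eqP; rewrite -measure_le0.
rewrite (_ : Om = \bigcup_q (eball X (2 ^+ q * r) `&` Om)); last first.
  apply/seteqP; split => [y Oy|y [q _ []//]].
  exists (Num.Def.archi_bound (enorm (y - X) / r)) => //; split => //.
  rewrite /eball/= -ltr_pdivrMr//; exact: upper_nthrootP.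
have : m.-negligible (\bigcup_q (eball X (2 ^+ q * r) `&` Om)).
  apply: negligible_bigcup => q; apply/negligibleP; first exact: ball_inter_measurable.
  apply/eqP; rewrite -measure_le0; apply: le_trans (ball_doubling q cX r0) _.
  by rewrite m0 mule0.
move/negligibleP => -> //; apply: bigcup_measurable => q _.
exact: ball_inter_measurable.
Qed.

Hypothesis mOm0 : m Om != 0%E.

Lemma inner_ball_measure (X : Rn) r : 0 < r -> eball X r `<=` Om ->
  (0 < m (eball X r) < +oo)%E.
Proof.
move=> r0 XO; have -> : eball X r = eball X r `&` Om by apply/esym/setIidl.
rewrite ball_measure_finite andbT.
apply: ball_measure_gt0 => //; apply: subset_closure; apply: XO.
by rewrite /eball/= subrr enorm0.
Qed.

Lemma integrable_const (A : set Rn) (a : R) : measurable A -> (m A < +oo)%E ->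
  m.-integrable A (EFin \o cst a).
Proof.
move=> mA mAoo; apply/integrableP; split; first exact/measurable_EFinP.
rewrite (eq_integral (cst `|a|%:E)) ?integral_cst//.
by apply: lte_mul_pinfty => //; rewrite lee_fin.
Qed.

Lemma avgE (A : set Rn) (f : Rn -> R) : measurable A -> (0 < m A < +oo)%E ->
  m.-integrable A (EFin \o f) -> avg m A f = (\int[m]_(x in A) f x) / fine (m A).
Proof.
move=> mA m0 fi; rewrite /avg /eavg inve_fin// fineM//.
by have := integrable_fin_num mA fi.
Qed.

(** The energy density [G] is a separate function, to cover both a smooth function with its gradient
    and a function of [W] with the limit [v], which is no pointwise derivative. *)
Definition poincare (f G : Rn -> R) (Cp : R) := forall (X : Rn) (r : R), 0 < r ->
  eball X (2 * r) `<=` Om ->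
  m.-integrable (eball X r) (EFin \o f) /\
  \int[m]_(x in eball X r) `|f x - avg m (eball X r) f| <=
    Cp * r * fine (m (eball X r)) *
    Num.sqrt ((\int[m]_(x in eball X r) G x) / fine (m (eball X r))).

Definition ball_avg (f : Rn -> R) (X : Rn) (r : R) : R := avg m (eball X r) f.

Lemma eball_double (X : Rn) r : 0 < r -> eball X r `<=` eball X (2 * r).
Proof. by move=> r0; apply: eball_sub; rewrite subrr enorm0 add0r; lra. Qed.

(** The left-hand side is at most the integral of [|f - f_B1|] over the smaller ball, hence over the
    larger ball [B1], where the inequality of Poincare applies. *)
Lemma nested_avg (f G : Rn -> R) (Cp : R) (z1 z2 : Rn) (r1 r2 : R) : poincare f G Cp ->
  0 < r1 -> 0 < r2 -> eball z2 r2 `<=` eball z1 r1 -> eball z1 (2 * r1) `<=` Om ->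
  `|ball_avg f z2 r2 - ball_avg f z1 r1| * fine (m (eball z2 r2)) <=
    Cp * r1 * fine (m (eball z1 r1)) *
    Num.sqrt ((\int[m]_(x in eball z1 r1) G x) / fine (m (eball z1 r1))).
Proof.
move=> fG r10 r20 B21 BO; have [fi fp] := fG _ _ r10 BO.
have B1O := subset_trans (@eball_double z1 r1 r10) BO.
have m1 := inner_ball_measure r10 B1O.
have m2 := inner_ball_measure r20 (subset_trans B21 B1O).
have mb1 := eball_measurable z1 r1; have mb2 := eball_measurable z2 r2.
have fi2 := integrableS mb1 mb2 B21 fi.
have fm2 := fine_gt0 m2.
apply: le_trans fp; set a := avg m (eball z1 r1) f.
have ai1 : m.-integrable (eball z1 r1) (EFin \o cst a).
  by apply: integrable_const => //; case/andP: m1.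
have ai2 : m.-integrable (eball z2 r2) (EFin \o cst a).
  by apply: integrable_const => //; case/andP: m2.
rewrite -(ger0_norm (ltW fm2)) -normrM.
have -> : (ball_avg f z2 r2 - ball_avg f z1 r1) * fine (m (eball z2 r2)) =
    \int[m]_(x in eball z2 r2) (f x - a).
  rewrite (@RintegralB _ _ _ _ _ f (cst a))// Rintegral_cst// mulrBl.
  by rewrite /ball_avg avgE// divfK// gt_eqF.
have d2 : m.-integrable (eball z2 r2) (EFin \o (fun x => f x - a)).
  exact: (integrableB mb2 fi2 ai2).
have d1 : m.-integrable (eball z1 r1) (EFin \o (fun x => f x - a)).
  exact: (integrableB mb1 fi ai1).
apply: le_trans (le_normr_Rintegral mb2 d2) _.
rewrite /Rintegral fine_le//.
- by apply: integrable_fin_num => //; exact: (integrable_norm d2).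
- by apply: integrable_fin_num => //; exact: (integrable_norm d1).
apply: ge0_subset_integral => //.
by have /integrableP[] := integrable_norm d1.
Qed.

Lemma Rintegral_subset (A B : set Rn) (G : Rn -> R) : measurable A -> measurable B ->
  A `<=` B -> (forall x, B x -> 0 <= G x) -> m.-integrable B (EFin \o G) ->
  \int[m]_(x in A) G x <= \int[m]_(x in B) G x.
Proof.
move=> mA mB AB G0 Gi; rewrite /Rintegral fine_le//.
- by apply: integrable_fin_num => //; exact: integrableS Gi.
- exact: integrable_fin_num.
apply: ge0_subset_integral => //; first by case/integrableP: Gi.
Qed.

(** Integrated over [T] only, so that no energy from outside the tent enters, but normalized by the
    mass of the whole ball in [Om], to which doubling applies. *)
Definition local_energy (T : set Rn) (G : Rn -> R) (K : R) (i : int) (Y : Rn) : R :=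
  (\int[m]_(x in T `&` nball K i Y) G x) / fine (m (nball K i Y `&` Om)).

Lemma nball_mem (K : R) i (x y : Rn) r : enorm (y - x) + r + sn * len i <= K * len i ->
  eball y r `<=` nball K i x.
Proof.
move=> h; apply: eball_sub; apply: le_trans h.
have := dcube_center (dcell_mem i x); have := enorm_tri y x (center (dcell i x)).
have : 0 <= sn * len i by rewrite mulr_ge0 ?sqrtr_ge0// ltW// len_gt0.
by rewrite -[side _]/(len i) mulrA; lra.
Qed.

Lemma inter_ball_gt0 (K : R) i (X z : Rn) r : 0 < r -> eball z r `<=` Om ->
  eball z r `<=` nball K i X -> (0 < m (nball K i X `&` Om) < +oo)%E.
Proof.
move=> r0 zO zN; rewrite ball_measure_finite andbT.
have /andP[p _] := inner_ball_measure r0 zO.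
apply: lt_le_trans p _; apply: le_measure; rewrite ?inE.
- exact: eball_measurable.
- exact: ball_inter_measurable.
- by move=> y zy; split; [exact: zN|exact: zO].
Qed.

(** Both balls are compared with [nball]: the factor [2 KA + sn] makes it contain the larger one,
    and [q] doublings of the smaller one cover its part in [Om]. So [Dq = C4 ^ q] bounds the ratios
    of masses; it enters once through [nested_avg] and once, under the root, through the
    normalization of the energy. *)
Lemma step_cost (KA theta Cp : R) : 0 < KA -> 0 < theta -> 0 < Cp ->
  exists2 Lc : R, 0 < Lc & forall (T : set Rn) (f G : Rn -> R) i (Y : Rn),
  measurable T -> (forall x, T x -> 0 <= G x) ->
  m.-integrable T (EFin \o G) -> poincare f G Cp ->
  nested_bound Om T (ball_avg f) Y (KA * len i) (KA * len i) (theta * len i)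
    (Lc * len i * Num.sqrt (local_energy T G (2 * KA + sn) i Y)).
Proof.
move=> KA0 th0 Cp0; set KB := 2 * KA + sn.
have s0 : 0 <= sn by exact: sqrtr_ge0.
have KB0 : 0 < KB by rewrite /KB ltr_pwDl// mulr_gt0.
pose q := Num.Def.archi_bound (2 * KB / theta).
have hq : 2 * KB <= 2 ^+ q * theta.
  by rewrite -ler_pdivrMr//; apply: ltW; exact: upper_nthrootP.
pose Dq := C4 ^+ q; have Dq0 : 0 < Dq by rewrite exprn_gt0.
exists (Cp * KA * Dq * Num.sqrt Dq); first by rewrite !mulr_gt0// sqrtr_gt0.
move=> T f G i Y mT G0 Gi fG z1 r1 z2 r2 B21 B1T B1O zY r1K r2t r20.
have l0 := len_gt0 (R := R) i.
have z21 : eball z1 r1 z2 by apply: B21; rewrite /eball/= subrr enorm0.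
have r10 : 0 < r1 by apply: le_lt_trans z21; exact: enorm_ge0.
have B1O' := subset_trans (@eball_double z1 r1 r10) B1O.
set nB := nball KB i Y.
have B1N : eball z1 r1 `<=` nB by apply: nball_mem; rewrite /KB !mulrDl; lra.
have mB1 := inner_ball_measure r10 B1O'.
have mB2 := inner_ball_measure r20 (subset_trans B21 B1O').
have mN := inter_ball_gt0 r10 B1O' B1N.
have NA : fine (m (nB `&` Om)) <= Dq * fine (m (eball z2 r2)).
  have -> : eball z2 r2 = eball z2 r2 `&` Om.
    by apply/esym/setIidl; exact: subset_trans B21 B1O'.
  have cz2 : closure Om z2 by apply: subset_closure; apply: B1O'.
  have f2 : m (eball z2 r2 `&` Om) \is a fin_num.
    by rewrite ge0_fin_numE//; exact: ball_measure_finite.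
  rewrite -lee_fin EFinM !fineK//; last first.
    by rewrite ge0_fin_numE//; case/andP: mN.
  apply: le_trans (ball_doubling q cz2 r20).
  apply: le_measure; rewrite ?inE; [exact: ball_inter_measurable..|].
  apply: setSI; apply: eball_sub.
  have z2N : enorm (z2 - center (dcell i Y)) < KB * len i by exact: B1N.
  rewrite enormB; apply: (@le_trans _ _ (2 * KB * len i)); first by lra.
  apply: (@le_trans _ _ (2 ^+ q * theta * len i)); first by rewrite ler_pM2r.
  by rewrite -mulrA ler_pM2l// exprn_gt0.
have f1 := fine_gt0 mB1; have f2 := fine_gt0 mB2.
have fN := fine_gt0 mN.
have le_fine (A B : set Rn) : measurable A -> measurable B -> (m B < +oo)%E -> A `<=` B ->
    fine (m A) <= fine (m B).
  move=> mA mB Boo AB; have AB' : (m A <= m B)%E by apply: le_measure; rewrite ?inE.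
  by rewrite fine_le// ge0_fin_numE//; exact: le_lt_trans Boo.
have h21 : fine (m (eball z2 r2)) <= fine (m (eball z1 r1)).
  by apply: le_fine => //; [exact: eball_measurable..|case/andP: mB1].
have h1N : fine (m (eball z1 r1)) <= fine (m (nB `&` Om)).
  apply: le_fine; [exact: eball_measurable|exact: ball_inter_measurable| |].
    by case/andP: mN.
  by move=> y y1; split; [exact: B1N|exact: B1O'].
have mTN : measurable (T `&` nB) by apply: measurableI => //; exact: eball_measurable.
have hE : \int[m]_(x in eball z1 r1) G x <= \int[m]_(x in T `&` nB) G x.
  apply: Rintegral_subset => //.
  - exact: eball_measurable.
  - by move=> y y1; split; [exact: B1T|exact: B1N].
  - by move=> x [/G0].
  - by apply: integrableS Gi.
have E0 : 0 <= \int[m]_(x in eball z1 r1) G x by apply: Rintegral_ge0 => x /B1T/G0.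
have := nested_avg fG r10 r20 B21 B1O.
rewrite /local_energy -/nB.
set E1 := \int[m]_(x in eball z1 r1) G x in hE E0 *.
set EN := \int[m]_(x in T `&` nB) G x in hE *.
move: (fine (m (eball z1 r1))) (fine (m (eball z2 r2))) (fine (m (nB `&` Om)))
  f1 f2 fN NA h21 h1N => m1 m2 mN' m10 m20 mN0 NA h21 h1N h.
have sq : Num.sqrt (E1 / m1) <= Num.sqrt Dq * Num.sqrt (EN / mN').
  rewrite -sqrtrM ?(ltW Dq0)// ler_wsqrtr//.
  rewrite mulrCA; apply: ler_pM => //; first by rewrite invr_ge0 ltW.
  rewrite -[leLHS]mul1r ler_pdivrMr// mulrAC ler_pdivlMr// mul1r.
  by apply: le_trans NA _; rewrite ler_pM2l.
have m1D : m1 <= Dq * m2 by apply: le_trans NA.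
rewrite -(ler_pM2r m20); apply: le_trans h _.
have sN : 0 <= Num.sqrt (EN / mN') by exact: sqrtr_ge0.
apply: (@le_trans _ _ (Cp * (KA * len i) * (Dq * m2) * (Num.sqrt Dq * Num.sqrt (EN / mN')))).
  apply: ler_pM => //.
  - by rewrite !mulr_ge0// ltW.
  - by apply: ler_pM => //; rewrite ?mulr_ge0 ?(ltW Cp0) ?(ltW r10) ?(ltW m10)// ler_wpM2l// ltW.
by apply: eqW; ring.
Qed.

Lemma ball_avg_near (f G : Rn -> R) (Cp : R) (X z : Rn) (r e : R) :
  poincare f G Cp -> 0 < r -> eball z (2 * r) `<=` Om ->
  (forall y, eball z r y -> `|f y - f X| <= e) -> `|ball_avg f z r - f X| <= e.
Proof.
move=> fG r0 zO he; have [fi _] := fG _ _ r0 zO.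
have zO' := subset_trans (@eball_double z r r0) zO.
have mB := inner_ball_measure r0 zO'.
have mb := eball_measurable z r; have fm := fine_gt0 mB.
have moo : (m (eball z r) < +oo)%E by case/andP: mB.
have ci a := integrable_const a mb moo.
rewrite -(ler_pM2r fm) -[X in `|_| * X](ger0_norm (ltW fm)) -normrM mulrBl.
rewrite /ball_avg avgE// divfK ?gt_eqF//.
rewrite -(Rintegral_cst m mb (f X)) -(@RintegralB _ _ _ _ _ f (cst (f X)))//.
have d : m.-integrable (eball z r) (EFin \o (fun x => f x - f X)).
  exact: (integrableB mb fi (ci _)).
apply: le_trans (le_normr_Rintegral mb d) _.
rewrite -(Rintegral_cst m mb e); apply: le_Rintegral => //; first exact: (integrable_norm d).
exact: ci.
Qed.

Lemma avd_limit (f G : Rn -> R) (Cp : R) (X : Rn) (s : R) (K : nat -> dyadic n) :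
  poincare f G Cp -> Om X ->
  (forall e, 0 < e -> exists2 r, 0 < r & forall y, eball X r y -> `|f y - f X| <= e) ->
  (forall q, dcube 1 (K q) X /\ side (K q) <= s * len q%:Z) ->
  forall e, 0 < e -> exists q, `|avd (ball_avg f) (K q) - f X| <= e.
Proof.
move=> fG OX cf hK e e0; have [r r0 hr] := cf e e0.
have [r' r'0 r'O] := nbhs_eball (open_nbhs_nbhs (conj oOm OX)).
pose t := Num.min r r'; have t0 : 0 < t by rewrite lt_min r0.
have s0 : 0 <= sn by exact: sqrtr_ge0.
have c0 : 0 < (sn + 1) * (`|s| + 1) by rewrite mulr_gt0// ltr_wpDl.
have [q hq] := len_small (divr_gt0 t0 c0); rewrite ler_pdivlMr// in hq.
exists q; have [KX Ks] := hK q.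
have sd := side_gt0 (R := R) (K q).
have Xc : enorm (center (K q) - X) <= sn * (side (K q) / 2).
  by rewrite enormB; exact: dcube_center.
have st : (sn + 1) * side (K q) <= t.
  apply: le_trans hq; rewrite mulrCA ler_wpM2l ?addr_ge0//.
  apply: le_trans Ks _; rewrite mulrC ler_wpM2l ?(ltW (len_gt0 _))//.
  by have := ler_norm s; lra.
have sub : eball (center (K q)) (side (K q)) `<=` eball X t.
  by apply: eball_sub; have := mulr_ge0 s0 (ltW sd); lra.
apply: (ball_avg_near fG); first by rewrite divr_gt0.
  rewrite (_ : 2 * _ = side (K q)); last by lra.
  apply: subset_trans sub _; apply: subset_trans r'O.
  by apply: eball_sub; rewrite subrr enorm0 add0r ge_min lexx orbT.
move=> y yB; apply: hr; apply: lt_le_trans (_ : enorm (y - X) < t) _.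
  by apply: sub; apply: lt_le_trans yB _; lra.
by rewrite ge_min lexx.
Qed.

(** The factor [2^-p] of [len (j + p)] enters the root as [(1/4)^p], and what remains is a geometric
    series of ratio [sqrt x]. *)
Lemma cost_sum_le (U x Lc : R) (j : int) (a : nat -> R) N : 0 <= x < 1 -> 0 <= U -> 0 <= Lc ->
  (forall p, (1 / 4) ^+ p * a p <= U * x ^+ p) ->
  \sum_(p < N) Lc * len (j + p%:Z) * Num.sqrt (a p) <=
    Lc * len j * (Num.sqrt U / (1 - Num.sqrt x)).
Proof.
move=> x01 U0 Lc0 ha.
have -> : \sum_(p < N) Lc * len (j + p%:Z) * Num.sqrt (a p) =
    Lc * len j * \sum_(p < N) Num.sqrt ((1 / 4) ^+ p * a p).
  rewrite mulr_sumr; apply: eq_bigr => p _; rewrite lenD len_nat -!mulrA.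
  have q0 : 0 <= (1 / 4 : R) ^+ p by apply: exprn_ge0; lra.
  congr (_ * (_ * _)); rewrite (sqrtrM _ q0); congr (_ * _).
  rewrite (_ : (1 / 4) ^+ p = (2^-1 ^+ p) ^+ 2).
    by rewrite sqrtr_sqr ger0_norm// exprn_ge0.
  by rewrite exprAC; congr (_ ^+ p); field.
apply: ler_wpM2l; first by rewrite mulr_ge0// ltW// len_gt0.
exact: (@sum_sqrt_geometric _ U x (fun p : nat => (1 / 4) ^+ p * a p) N).
Qed.

(** * The Sobolev estimate relative to the top average *)

Section Pointwise.
Variables (KA theta L Cp : R).
Hypotheses (KA1 : 1 <= KA) (theta0 : 0 < theta) (L0 : 0 < L) (Cp0 : 0 < Cp).
Let KB := 2 * KA + sn.

(** [T] lies in the ball of radius [4 KA len j] about any of its points, and this radius is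
    [2 ^ (p + 2)] times [KA len (j + p)]: hence [p + 2] doublings. *)
Lemma tent_mass_bound (T : set Rn) (j : int) (y0 : Rn) (D : R) : measurable T ->
  T `<=` Om -> (forall X, T X -> enorm (X - y0) <= KA * len j) -> C4 <= D ->
  forall (X : Rn) (p : nat), T X ->
  (0 < m (nball KB (j + p%:Z) X `&` Om) < +oo)%E /\
  (m T <= (D ^+ (p + 2))%:E * m (nball KB (j + p%:Z) X `&` Om))%E.
Proof.
move=> mT TO hy CD X p TX; have KA0 : 0 < KA by apply: lt_le_trans KA1.
have s0 : 0 <= sn by exact: sqrtr_ge0.
have lp := len_gt0 (R := R) (j + p%:Z).
have ballN r : r <= KA * len (j + p%:Z) -> eball X r `<=` nball KB (j + p%:Z) X.
  move=> rK; apply: nball_mem; rewrite subrr enorm0 /KB !mulrDl.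
  by have := mulr_gt0 KA0 lp; lra.
have [r r0 rO] := nbhs_eball (open_nbhs_nbhs (conj oOm (TO X TX))).
pose t := Num.min r (KA * len (j + p%:Z)).
have t0 : 0 < t by rewrite lt_min r0 mulr_gt0.
split.
  apply: (inter_ball_gt0 t0); last first.
    by apply: ballN; rewrite ge_min lexx orbT.
  apply: subset_trans rO; apply: eball_sub.
  by rewrite subrr enorm0 add0r ge_min lexx.
have rp : 0 < KA * len (j + p%:Z) by rewrite mulr_gt0.
have := ball_doubling (p + 2) (subset_closure (TO X TX)) rp.
have -> : 2 ^+ (p + 2) * (KA * len (j + p%:Z)) = 4 * (KA * len j).
  rewrite lenD len_nat exprD exprVn; have : (2 ^+ p : R) != 0 by rewrite expf_neq0.
  by move=> h; field.
move=> h.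
have hT : (m T <= m (eball X (4 * (KA * len j)) `&` Om))%E.
  apply: le_measure; rewrite ?inE//; first exact: ball_inter_measurable.
  move=> Y TY; split; last exact: TO.
  have := enorm_tri Y y0 X; have := hy Y TY; have := hy X TX; rewrite (enormB y0) /eball/=.
  by have := mulr_gt0 KA0 (len_gt0 (R := R) j); lra.
apply: le_trans hT _; apply: le_trans h _; apply: lee_pmul => //.
- by rewrite lee_fin exprn_ge0// ltW.
- by rewrite lee_fin lerXn2r// nnegrE ltW//; exact: lt_le_trans CD.
apply: le_measure; rewrite ?inE; [exact: ball_inter_measurable..|].
by apply: setSI; exact: ballN.
Qed.

Lemma sobolev_pointwise : exists2 Q : R, 0 < Q &
  forall (T : set Rn) (j : int) (I0 : dyadic n) (y0 : Rn) (D k : R),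
  measurable T -> T `<=` Om -> (forall X, T X -> enorm (X - y0) <= KA * len j) ->
  C4 <= D -> 1 <= D -> 1 < k -> D `^ (k - 1) = 3 / 2 ->
  (0 < m T < +oo)%E -> telescopes Om T KA theta L j I0 ->
  forall (f G : Rn -> R),
  (forall X, T X -> forall e, 0 < e ->
     exists2 r, 0 < r & forall y, eball X r y -> `|f y - f X| <= e) ->
  poincare f G Cp -> (forall x, T x -> 0 <= G x) ->
  m.-integrable T (EFin \o G) -> forall X, T X ->
  ((`|f X - avd (ball_avg f) I0| `^ (2 * k))%:E <=
    ((Q * len j) `^ (2 * k) *
      (D ^+ 2 * ((\int[m]_(x in T) G x) / fine (m T))) `^ (k - 1))%:E *
    \sum_(0 <= p <oo) ((3 / 4) ^+ p * local_energy T G KB (j + p%:Z) X)%:E)%E.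
Proof.
have KA0 : 0 < KA by apply: lt_le_trans KA1.
have [Lc Lc0 hLc] := step_cost KA0 theta0 Cp0.
(* The squared costs decay like [4^-p 2^p = 2^-p], so this factor bounds the geometric sum of the
   costs. *)
pose cg : R := (1 - Num.sqrt 2^-1)^-1.
have cg0 : 0 < cg.
  rewrite invr_gt0 subr_gt0 -[ltRHS]sqrtr1 ltr_sqrt//; lra.
exists (L * Lc * cg); first by rewrite !mulr_gt0.
move=> T j I0 y0 D k mT TO hy CD D1 k1 Dk mT0 tel f G cf fG G0 Gi X TX.
set E := \int[m]_(x in T) G x; set mt := fine (m T).
have mt0 : 0 < mt by exact: fine_gt0.
have E0 : 0 <= E by apply: Rintegral_ge0.
have D0 : 0 < D by apply: lt_le_trans D1.
have k0 : 0 < k by apply: lt_trans k1.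
set W := D ^+ 2 * (E / mt); have W0 : 0 <= W by rewrite mulr_ge0 ?exprn_ge0 ?divr_ge0// ltW.
pose a p := local_energy T G KB (j + p%:Z) X; rewrite -/(a _).
have aP p : 0 <= a p <= W * D ^+ p.
  have [mN mTN] := tent_mass_bound mT TO hy CD p TX.
  have fN := fine_gt0 mN.
  have EN0 : 0 <= \int[m]_(x in T `&` nball KB (j + p%:Z) X) G x.
    by apply: Rintegral_ge0 => x [/G0].
  rewrite /a /local_energy divr_ge0 ?(ltW fN)//=.
  rewrite ler_pdivrMr//; apply: (@le_trans _ _ E).
    apply: Rintegral_subset => //.
    by apply: measurableI => //; exact: eball_measurable.
  have : mt <= D ^+ (p + 2) * fine (m (nball KB (j + p%:Z) X `&` Om)).
    rewrite -lee_fin EFinM !fineK//; first by rewrite ge0_fin_numE//; case/andP: mN.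
    by rewrite ge0_fin_numE//; case/andP: mT0.
  rewrite exprD /W; move: (fine _) => u hu.
  rewrite (_ : D ^+ 2 * (E / mt) * D ^+ p * u = E * (D ^+ p * D ^+ 2 * u / mt)); last by ring.
  by rewrite ler_peMr// ler_pdivlMr// mul1r.
have u0 p : (0 <= ((3 / 4) ^+ p * a p)%:E)%E.
  have /andP[a0 _] := aP p.
  by rewrite lee_fin; apply: mulr_ge0 => //; apply: exprn_ge0; lra.
have Qk0 : 0 < (L * Lc * cg * len j) `^ (2 * k) by apply: powR_gt0; rewrite !mulr_gt0 ?len_gt0.
have [[v vE]|vE] : (exists v, \sum_(0 <= p <oo) ((3 / 4) ^+ p * a p)%:E = v%:E)%E \/
    (\sum_(0 <= p <oo) ((3 / 4) ^+ p * a p)%:E = +oo)%E.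
- have : (0 <= \sum_(0 <= p <oo) ((3 / 4) ^+ p * a p)%:E)%E by apply: nneseries_ge0.
  by case: (\sum_(0 <= p <oo) _)%E => [v| |] // _; [left; exists v|right].
- rewrite vE -EFinM lee_fin.
  have va p : (3 / 4) ^+ p * a p <= v by rewrite -lee_fin -vE; apply: (nneseries_ge_term p u0).
  have v0 : 0 <= v.
    by apply: le_trans (va 0%N); rewrite expr0 mul1r; case/andP: (aP 0%N).
  have aU := powR_interpolation k1 (ltW D0) Dk W0 aP va.
  (* [U ^ k = v W^(k-1)] is linear in the value [v] of the series; this is what allows the [2k]-th
     power of the bound, of order [sqrt U], to be integrated over [T]. *)
  set U := (v * W `^ (k - 1)) `^ k^-1 in aU; have U0 : 0 <= U by exact: powR_ge0.
  pose cost p := Lc * len (j + p%:Z) * Num.sqrt (a p).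
  have cost0 p : 0 <= cost p by rewrite /cost !mulr_ge0 ?sqrtr_ge0 ?(ltW Lc0) ?(ltW (len_gt0 _)).
  have costS N : \sum_(p < N) cost p <= Lc * len j * (Num.sqrt U * cg).
    apply: cost_sum_le => //; [by lra|exact: ltW|move=> p].
    have q0 : 0 <= (1 / 4 : R) ^+ p by apply: exprn_ge0; lra.
    apply: (@le_trans _ _ ((1 / 4) ^+ p * (U * 2 ^+ p))); first exact: ler_wpM2l.
    rewrite mulrCA -exprMn (_ : 1 / 4 * 2 = 2^-1 :> R)//; lra.
  have [s [K hK]] := tel (ball_avg f) cost X TX cost0
    (fun p => hLc T f G (j + p%:Z) X mT G0 Gi fG).
  have bnd : `|f X - avd (ball_avg f) I0| <= L * Lc * cg * len j * Num.sqrt U.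
    apply/ler_addgt0Pr => e e0.
    have [q hq] := avd_limit fG (TO X TX) (cf X TX)
      (fun q => let: And4 h1 _ h3 _ := hK q in conj h1 h3) e0.
    have [_ _ _ [N hN]] := hK q.
    have h1 := ler_wpM2l (ltW L0) (costS N).
    have := ler_distD (avd (ball_avg f) (K q)) (f X) (avd (ball_avg f) I0).
    rewrite (distrC (f X) (avd _ (K q))) => h; apply: le_trans h _.
    rewrite addrC; apply: lerD => //.
    apply: le_trans hN _; apply: le_trans h1 _.
    by apply: eqW; ring.
  have LB0 : 0 <= L * Lc * cg * len j * Num.sqrt U by apply: le_trans bnd.
  have k20 : 0 <= 2 * k by rewrite mulr_ge0// ltW.
  apply: le_trans (ge0_ler_powR k20 _ _ bnd) _; rewrite ?nnegrE//.
  rewrite powRM ?sqrtr_ge0//; last first.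
    by rewrite !mulr_ge0 ?(ltW L0) ?(ltW Lc0) ?(ltW cg0) ?(ltW (len_gt0 _)).
  rewrite -[leRHS]mulrA; apply: ler_wpM2l; first exact: ltW.
  rewrite powRrM -[2]/(2%:R) powR_mulrn ?sqrtr_ge0// sqr_sqrtr//.
  by rewrite /U -powRrM mulVf ?gt_eqF// powRr1 ?mulr_ge0 ?powR_ge0// mulrC.
(* With an infinite series the right-hand side is infinite unless its factor vanishes, but [W = 0]
   would annihilate every term of the series. *)
rewrite vE; have Wn0 : W != 0.
  apply/eqP => W00; move: vE; rewrite eseries0// => p _ _ /=.
  have := aP p; rewrite W00 mul0r => /andP[h1 h2].
  by rewrite (_ : a p = 0) ?mulr0//; apply/eqP; rewrite eq_le h1 h2.
by rewrite gt0_muley ?leey// lte_fin mulr_gt0// powR_gt0// lt_def Wn0.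
Qed.

Lemma sobolev_tent : exists k Cs : R, [/\ 1 < k, 0 < Cs &
  forall (T : set Rn) (j : int) (I0 : dyadic n) (y0 : Rn),
  measurable T -> T `<=` Om -> (forall X, T X -> enorm (X - y0) <= KA * len j) ->
  (0 < m T < +oo)%E -> telescopes Om T KA theta L j I0 ->
  forall (f G : Rn -> R), measurable_fun T f ->
  (forall X, T X -> forall e, 0 < e ->
     exists2 r, 0 < r & forall y, eball X r y -> `|f y - f X| <= e) ->
  poincare f G Cp -> (forall x, T x -> 0 <= G x) ->
  m.-integrable T (EFin \o G) ->
  (\int[m]_(X in T) (`|f X - avd (ball_avg f) I0| `^ (2 * k))%:E <=
    (Cs * (len j ^+ 2 * ((\int[m]_(x in T) G x) / fine (m T))) `^ k * fine (m T))%:E)%E].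
Proof.
have [D [k [CD D1 k1 Dk]]] := exponent_exists C4.
have [Q Q0 hQ] := sobolev_pointwise.
have x01 : 0 <= (3 / 4 : R) < 1 by apply/andP; split; lra.
have [Nov Nov0 hN] := @kernel_series R n KB _ x01.
have D0 : 0 < D by apply: lt_le_trans D1.
(* [Nov + 1] instead of [Nov] makes the constant positive. *)
exists k, (Q `^ (2 * k) * (D ^+ 2) `^ (k - 1) * (Nov + 1)); split => //.
  by rewrite !mulr_gt0// ?powR_gt0// ?exprn_gt0// ltr_wpDl.
move=> T j I0 y0 mT TO hy mT0 tel f G mf cf fG G0 Gi.
set E := \int[m]_(x in T) G x; set mt := fine (m T).
have mt0 : 0 < mt by exact: fine_gt0.
have E0 : 0 <= E by apply: Rintegral_ge0.
pose w (p : nat) (X : Rn) := fine (m (nball KB (j + p%:Z) X `&` Om)).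
have [mV V0 VE] : let V X := (\sum_(0 <= p <oo)
    ((3 / 4) ^+ p * local_energy T G KB (j + p%:Z) X)%:E)%E in
  [/\ measurable_fun T V, forall X, T X -> (0 <= V X)%E &
      (\int[m]_(X in T) V X <= (Nov * E)%:E)%E].
  apply: (hN m m T T G j w) => //.
    by move=> p X Y XY; rewrite /w /nball XY.
  move=> p X TX; have [mN _] := tent_mass_bound mT TO hy CD p TX.
  split; first exact: fine_gt0.
  rewrite fineK; last by rewrite ge0_fin_numE//; case/andP: mN.
  apply: le_measure; rewrite ?inE.
  - by apply: measurableI => //; exact: cell_measurable.
  - exact: ball_inter_measurable.
  move=> Y [TY /= YX]; split; last exact: TO.
  have KA0 : 0 < KA by apply: lt_le_trans KA1.
  have -> : nball KB (j + p%:Z) X = nball KB (j + p%:Z) Y.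
    by rewrite /nball /dcell -/(dcell _ X).2 -YX.
  have lp := len_gt0 (R := R) (j + p%:Z).
  apply: (@nball_mem KB (j + p%:Z) Y Y (KA * len (j + p%:Z))).
    rewrite subrr enorm0 /KB !mulrDl; have := mulr_gt0 KA0 lp; lra.
  by rewrite /eball/= subrr enorm0 mulr_gt0.
pose Qw := (Q * len j) `^ (2 * k) * (D ^+ 2 * (E / mt)) `^ (k - 1).
have Qw0 : 0 <= Qw by rewrite mulr_ge0 ?powR_ge0.
have mLHS : measurable_fun T (fun X => (`|f X - avd (ball_avg f) I0| `^ (2 * k))%:E).
  apply/measurable_EFinP; apply: (measurableT_comp (measurable_powR _)).
  apply: measurableT_comp => //.
  by apply: measurable_funB => //; exact: measurable_cst.
apply: (@le_trans _ _ (\int[m]_(X in T) (Qw%:E * (\sum_(0 <= p <oo)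
    ((3 / 4) ^+ p * local_energy T G KB (j + p%:Z) X)%:E)))%E).
  apply: ge0_le_integral => //; first exact: measurable_funeM.
  move=> X TX; exact: (hQ T j I0 y0 D k mT TO hy CD D1 k1 Dk mT0 tel
    f G cf fG G0 Gi X TX).
rewrite ge0_integralZl//.
apply: le_trans (lee_wpmul2l _ VE) _; first by rewrite lee_fin.
rewrite -EFinM lee_fin /Qw.
have emt : E = E / mt * mt by rewrite divfK ?gt_eqF.
have e0 : 0 <= E / mt by rewrite divr_ge0// ltW.
rewrite [X in Nov * X]emt; move: (E / mt) e0 => e e0.
have l0 := len_gt0 (R := R) j.
rewrite powRM ?(ltW Q0) ?(ltW l0)// powRM ?exprn_ge0 ?(ltW D0)//.
rewrite [X in _ <= _ * X * _]powRM ?exprn_ge0 ?(ltW l0)//.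
rewrite (powRrM (len j) 2 k) -[(len j) `^ 2]/(len j `^ 2%:R) powR_mulrn ?(ltW l0)//.
rewrite -[X in _ <= _ * (_ * X) * _](mulr_powRB1 e0); last by apply: lt_trans k1.
move: (Q `^ _) (powR_ge0 Q (2 * k)) => q q_ge0.
move: ((len j ^+ 2) `^ k) (powR_ge0 (len j ^+ 2) k) => l l_ge0.
move: ((D ^+ 2) `^ (k - 1)) (powR_ge0 (D ^+ 2) (k - 1)) => d d_ge0.
move: (e `^ (k - 1)) (powR_ge0 e (k - 1)) => u u_ge0.
rewrite (_ : q * l * (d * u) * (Nov * (e * mt)) =
  (q * d * l * e * u * mt) * Nov); last by ring.
rewrite (_ : q * d * (Nov + 1) * (l * (e * u)) * mt =
  (q * d * l * e * u * mt) * (Nov + 1)); last by ring.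
apply: ler_wpM2l; last by rewrite lerDl.
by rewrite !mulr_ge0// ltW.
Qed.

End Pointwise.

(** * Smooth functions and the energy space *)

Variable C6 : R.
Hypotheses (C6_gt0 : 0 < C6) (h6 : H6b Om m C6).

Lemma eavgE (A : set Rn) (f : Rn -> R) : measurable A -> (0 < m A < +oo)%E ->
  m.-integrable A (EFin \o f) ->
  eavg m A (EFin \o f) = ((\int[m]_(x in A) f x) / fine (m A))%:E.
Proof.
move=> mA m0 fi; rewrite /eavg inve_fin// EFinM /Rintegral fineK//.
exact: integrable_fin_num.
Qed.

Lemma smooth_closure_sub (U V : set Rn) (f : Rn -> R) : U `<=` V ->
  smooth_closure V f -> smooth_closure U f.
Proof.
move=> UV sf s; have [d [g [cg gf]]] := sf s; split; first by move=> i x /UV; exact: d.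
exists g; split; last by move=> x /UV; exact: gf.
by apply: continuous_subspaceW cg; exact: closure_subset.
Qed.

Lemma pderiv_bounded (f : Rn -> R) (s : seq 'I_n) (X : Rn) (r : R) : smooth_closure Om f ->
  0 < r -> eball X (2 * r) `<=` Om ->
  exists M : R, forall x, eball X r x -> `|pderiv s f x| <= M.
Proof.
move=> sf r0 XO; have [_ [g [cg gf]]] := sf s.
have cO : cball X r `<=` Om.
  move=> x xr; apply: XO; rewrite /eball/=; apply: le_lt_trans xr _.
  by rewrite ltr_pMl// ltr1n.
have cg' : {within cball X r, continuous g}.
  by apply: continuous_subspaceW cg; apply: subset_trans cO _; exact: subset_closure.
have [M [_ hM]] := compact_bounded (continuous_compact cg' (@cball_compact _ _ X r)).
exists (M + 1) => x xr; rewrite -gf; last by apply: cO; exact: eball_cball.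
apply: (hM (M + 1)); first by rewrite ltrDl.
by exists x => //; exact: eball_cball.
Qed.

Lemma smooth_measurable (f : Rn -> R) : smooth_closure Om f -> measurable_fun Om f.
Proof.
move=> sf; have [_ [g [cg gf]]] := sf [::].
by apply: continuous_within_measurable cg gf => //; exact: subset_closure.
Qed.

Lemma smooth_continuous (f : Rn -> R) (X : Rn) : smooth_closure Om f -> Om X ->
  forall e, 0 < e -> exists2 r, 0 < r & forall y, eball X r y -> `|f y - f X| <= e.
Proof.
move=> sf OX e e0; have [_ [g [cg gf]]] := sf [::].
have : {within Om, continuous g} by apply: continuous_subspaceW cg; exact: subset_closure.
rewrite (continuous_open_subspace g oOm) => /(_ X).
rewrite inE => /(_ OX) /cvgrPdist_le/(_ e e0) h.
have [r r0 hr] := nbhs_eball (filterI h (open_nbhs_nbhs (conj oOm OX))).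
by exists r => // y /hr[]; rewrite distrC => + Oy; rewrite !gf.
Qed.

Lemma smooth_ball_integrable (f : Rn -> R) (X : Rn) (r : R) : smooth_closure Om f ->
  0 < r -> eball X (2 * r) `<=` Om ->
  m.-integrable (eball X r) (EFin \o f) /\
  m.-integrable (eball X r) (EFin \o (fun x => enorm (grad f x) ^+ 2)).
Proof.
move=> sf r0 XO; have rO := subset_trans (@eball_double X r r0) XO.
have /andP[_ moo] := inner_ball_measure r0 rO.
have mb := eball_measurable X r; have mO := borel_open oOm.
split; apply: measurable_bounded_integrable => //.
- by apply: measurable_funS (smooth_measurable sf).
- have [M hM] := pderiv_bounded [::] sf r0 XO.
  by exists M; split; [exact: num_real|move=> M' /ltW MM' x /hM h; exact: le_trans h MM'].
- by apply: measurable_funS (grad_sq_measurable oOm sf).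
have [M hM] := fin_all_exists (fun i : 'I_n => pderiv_bounded [:: i] sf r0 XO).
exists (\sum_i M i ^+ 2); split; first exact: num_real.
move=> M' /ltW MM' x xr; apply: le_trans MM'.
rewrite /= ger0_norm ?sqr_ge0// enorm_sq; apply: ler_sum => i _; rewrite mxE.
have h := hM i x xr; rewrite -real_normK ?num_real// lerXn2r ?nnegrE//.
exact: le_trans h.
Qed.

Lemma smooth_poincare (f : Rn -> R) : smooth_closure Om f ->
  poincare f (fun x => enorm (grad f x) ^+ 2) C6.
Proof.
move=> sf X r r0 XO; have rO := subset_trans (@eball_double X r r0) XO.
have mb := eball_measurable X r.
have m0 := inner_ball_measure r0 rO.
have [fi gi] := smooth_ball_integrable sf r0 XO; split => //.
have := h6 r0 XO (smooth_closure_sub rO sf) => /=.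
set a := avg m _ f.
have ci : m.-integrable (eball X r) (EFin \o cst a).
  by apply: integrable_const => //; case/andP: m0.
have di : m.-integrable (eball X r) (EFin \o (fun x => f x - a)).
  exact: (integrableB mb fi ci).
have ai : m.-integrable (eball X r) (EFin \o (fun x => `|f x - a|)).
  exact: (integrable_norm di).
rewrite -[eavg m _ (fun x => `|_|%:E)]/(eavg m _ (EFin \o (fun x => `|f x - a|))).
rewrite -[eavg m _ (fun x => (enorm _ ^+ 2)%:E)]/(eavg m _ (EFin \o _)).
rewrite !eavgE// poweR_EFin -EFinM lee_fin powR12_sqrt; last first.
  apply: divr_ge0; last exact: fine_ge0.
  by apply: Rintegral_ge0 => x _; exact: sqr_ge0.
by rewrite ler_pdivrMr ?fine_gt0// mulrAC.
Qed.

Lemma grad_diff_measurable (f : Rn -> R) (v : Rn -> Rn) : smooth_closure Om f ->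
  measurable_fun Om v -> measurable_fun Om (fun x => enorm (grad f x - v x) ^+ 2).
Proof.
move=> sf mv; have mO := borel_open oOm.
have -> : (fun x => enorm (grad f x - v x) ^+ 2) =
    (fun x => \sum_(i < n) ('D_(evec i) f x - v x ord0 i) ^+ 2).
  by apply/funext => x; rewrite enorm_sq; apply: eq_bigr => i _; rewrite !mxE.
apply: measurable_sum => i; apply: measurable_funX; apply: measurable_funB.
  have [_ [g [cg gf]]] := sf [:: i].
  by apply: continuous_within_measurable cg gf => //; exact: subset_closure.
by apply: (measurableT_comp (coord_measurable _ (measurableT : measurable [set: Rn]))) mv.
Qed.

(** From [|grad f|^2 <= 2 |v|^2 + 2 |grad f - v|^2]. It bounds the energy of an approximant on [A]
    by that of [v] on the same set, up to the error of approximation. *)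
Lemma energy_split (f : Rn -> R) (v : Rn -> Rn) (A : set Rn) (e : R) : smooth_closure Om f ->
  L2vec m Om v -> measurable A -> A `<=` Om ->
  (sqint m Om (fun x => (grad f x - v x)%R) <= e%:E)%E ->
  [/\ m.-integrable A (EFin \o (fun x => enorm (v x) ^+ 2)),
      m.-integrable A (EFin \o (fun x => enorm (grad f x) ^+ 2)) &
      \int[m]_(x in A) enorm (grad f x) ^+ 2 <= 2 * \int[m]_(x in A) enorm (v x) ^+ 2 + 2 * e].
Proof.
move=> sf [mv vL] mA AO he; have mO := borel_open oOm.
have mvO := enorm_sq_measurable mO mv; have mgO := grad_sq_measurable oOm sf.
have mdO := grad_diff_measurable sf mv.
have nn (w : Rn -> Rn) x : (0 <= (enorm (w x) ^+ 2)%:E)%E by rewrite lee_fin sqr_ge0.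
have int (w : Rn -> Rn) (B : set Rn) : measurable B -> B `<=` Om ->
    measurable_fun Om (fun x => enorm (w x) ^+ 2) -> (sqint m Om w < +oo)%E ->
    m.-integrable B (EFin \o (fun x => enorm (w x) ^+ 2)).
  move=> mB BO mw wL; apply: integrableS mO mB BO _.
  apply/integrableP; split; first exact/measurable_EFinP.
  rewrite /= (eq_integral (fun x => (enorm (w x) ^+ 2)%:E))// => x _.
  by rewrite /= ger0_norm// sqr_ge0.
have iv := int v A mA AO mvO vL.
pose d x := grad f x - v x.
have id : m.-integrable A (EFin \o (fun x => enorm (d x) ^+ 2)).
  by apply: int => //; apply: le_lt_trans he _; exact: ltry.
have ib : m.-integrable A (EFin \o (fun x => 2 * enorm (v x) ^+ 2 + 2 * enorm (d x) ^+ 2)).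
  have h1 := integrableZl mA 2 iv; have h2 := integrableZl mA 2 id.
  exact: (integrableD mA h1 h2).
have pw x : enorm (grad f x) ^+ 2 <= 2 * enorm (v x) ^+ 2 + 2 * enorm (d x) ^+ 2.
  by have := enormD_sq (v x) (d x); rewrite /d addrC subrK.
have ig : m.-integrable A (EFin \o (fun x => enorm (grad f x) ^+ 2)).
  apply: (le_integrable mA _ _ ib) => [|x _ /=].
    by apply/measurable_EFinP; apply: measurable_funS mgO.
  rewrite lee_fin ger0_norm ?sqr_ge0//; apply: le_trans (pw x) _; exact: ler_norm.
split => //.
have := le_Rintegral mA ig ib (fun x _ => pw x) => /le_trans; apply.
rewrite RintegralD//; [|exact: (integrableZl mA 2 iv)|exact: (integrableZl mA 2 id)].
rewrite !RintegralZl//; apply: lerD => //; apply: ler_wpM2l => //.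
have h : (\int[m]_(x in A) (enorm (d x) ^+ 2)%:E <= e%:E)%E.
  apply: le_trans he; apply: ge0_subset_integral => //; exact/measurable_EFinP.
rewrite -lee_fin /Rintegral fineK//; exact: integrable_fin_num.
Qed.

Lemma L1loc_ball_integrable (u : Rn -> R) (X : Rn) (r : R) : L1loc m Om u -> 0 < r ->
  eball X (2 * r) `<=` Om -> m.-integrable (eball X r) (EFin \o u).
Proof.
move=> [mu uL] r0 XO.
have cO : cball X r `<=` Om.
  move=> x xr; apply: XO; rewrite /eball/=; apply: le_lt_trans xr _.
  by rewrite ltr_pMl// ltr1n.
apply: integrableS (cball_measurable X r) (eball_measurable X r) (@eball_cball _ _ X r) _.
apply/integrableP; split; last exact: uL (@cball_compact _ _ X r) cO.
by apply/measurable_EFinP; apply: measurable_funS mu => //; exact: borel_open.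
Qed.

Lemma avg_diff (f u : Rn -> R) (X : Rn) (r e : R) : 0 < r -> eball X r `<=` Om ->
  m.-integrable (eball X r) (EFin \o f) -> m.-integrable (eball X r) (EFin \o u) ->
  (\int[m]_(x in eball X r) `|f x - u x|%:E <= e%:E)%E ->
  \int[m]_(x in eball X r) `|f x - u x| <= e /\
  `|avg m (eball X r) f - avg m (eball X r) u| * fine (m (eball X r)) <= e.
Proof.
move=> r0 XO fi ui he; have mb := eball_measurable X r.
have m0 := inner_ball_measure r0 XO.
have fm := fine_gt0 m0.
have di : m.-integrable (eball X r) (EFin \o (fun x => f x - u x)).
  exact: (integrableB mb fi ui).
have h : \int[m]_(x in eball X r) `|f x - u x| <= e.
  rewrite -lee_fin /Rintegral fineK//; apply: integrable_fin_num => //.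
  exact: (integrable_norm di).
split => //; apply: le_trans h.
rewrite -[X in _ * X](ger0_norm (ltW fm)) -normrM mulrBl !avgE// !divfK ?gt_eqF//.
rewrite -RintegralB//; exact: le_normr_Rintegral.
Qed.

(** The inequality of the approximants passed to the limit. The energy of an approximant is at most
    twice that of [v] plus an error, and [sqrt 2 <= 2] gives the constant [2 C6]. *)
Lemma energy_poincare (u : Rn -> R) (v : Rn -> Rn) : energy_gradient Om m u v ->
  poincare u (fun x => enorm (v x) ^+ 2) (2 * C6).
Proof.
move=> [uL vL [phi [sphi fphi L1 L2]]] X r r0 XO.
have ui := L1loc_ball_integrable uL r0 XO; split => //.
have rO := subset_trans (@eball_double X r r0) XO.
have mb := eball_measurable X r.
have m0 := inner_ball_measure r0 rO.
have fm := fine_gt0 m0; have moo : (m (eball X r) < +oo)%E by case/andP: m0.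
set B := eball X r in ui mb m0 fm moo *.
set EV := \int[m]_(x in B) enorm (v x) ^+ 2.
have EV0 : 0 <= EV by apply: Rintegral_ge0 => x _; exact: sqr_ge0.
set mB := fine (m B) in fm *.
(* For an L1 error [e] and an energy error [e ^ 2] the total excess is [e K]: [2 e] from the L1
   distance and the difference of the averages, the rest from the energy error under the root. *)
pose K := 2 + C6 * r * mB * (2 * Num.sqrt mB^-1).
have K0 : 0 < K by rewrite ltr_wpDr// !mulr_ge0 ?sqrtr_ge0// ltW.
apply/ler_addgt0Pr => e' e'0; have [e e0 eK] : exists2 e, 0 < e & e * K = e'.
  by exists (e' / K); [rewrite divr_gt0|rewrite divfK ?gt_eqF].
have e20 : 0 < e ^+ 2 by rewrite exprn_gt0.
have [N1 hN1] := cvge0_eventually (L1 X r r0 XO) e0.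
have [N2 hN2] := cvge0_eventually L2 e20.
pose i := maxn N1 N2; pose f := phi i.
have hL1 := hN1 i (leq_maxl _ _); have hL2 := hN2 i (leq_maxr _ _).
have [fi fp] := smooth_poincare (sphi i) r0 XO.
have [_ _ hE] := energy_split (sphi i) vL mb rO hL2.
have [h1 h2] := avg_diff r0 rO fi ui hL1.
set a := avg m B u; set b := avg m B f in fp h2 *.
have ci c : m.-integrable B (EFin \o cst c) by exact: integrable_const.
have nd (g h : Rn -> R) : m.-integrable B (EFin \o g) -> m.-integrable B (EFin \o h) ->
    m.-integrable B (EFin \o (fun x => `|g x - h x|)).
  move=> gi hi; have d : m.-integrable B (EFin \o (fun x => g x - h x)).
    exact: (integrableB mb gi hi).
  exact: (integrable_norm d).
have i1 := nd _ _ ui (ci a); have i2 := nd _ _ fi (ci b); have i3 := nd _ _ fi ui.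
have i4 : m.-integrable B (EFin \o (fun x => `|f x - u x| + `|f x - b|)).
  exact: (integrableD mb i3 i2).
have i5 : m.-integrable B (EFin \o (fun x => `|f x - u x| + `|f x - b| + `|b - a|)).
  exact: (integrableD mb i4 (ci _)).
have step : \int[m]_(x in B) `|u x - a| <=
    \int[m]_(x in B) (`|f x - u x| + `|f x - b| + `|b - a|).
  apply: le_Rintegral => // x _.
  have -> : u x - a = (u x - f x) + (f x - b) + (b - a) by ring.
  apply: le_trans (ler_normD _ _) _; rewrite lerD2r.
  by apply: le_trans (ler_normD _ _) _; rewrite distrC.
apply: le_trans step _.
rewrite (RintegralD mb i4 (ci _)) (RintegralD mb i3 i2) Rintegral_cst//.
have sE : Num.sqrt ((\int[m]_(x in B) enorm (grad f x) ^+ 2) / mB) <=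
    2 * Num.sqrt (EV / mB) + e * (2 * Num.sqrt mB^-1).
  have x0 : 0 <= 2 * Num.sqrt (EV / mB) by rewrite mulr_ge0 ?sqrtr_ge0.
  have y0 : 0 <= e * (2 * Num.sqrt mB^-1) by rewrite mulr_ge0 ?(ltW e0)// mulr_ge0 ?sqrtr_ge0.
  rewrite -[leRHS]ger0_norm ?addr_ge0// -sqrtr_sqr; apply: ler_wsqrtr.
  apply: (@le_trans _ _ ((2 * EV + 2 * e ^+ 2) / mB)).
    by rewrite ler_pM2r ?invr_gt0.
  rewrite sqrrD !exprMn !sqr_sqrtr ?invr_ge0 ?divr_ge0 ?(ltW fm)//.
  rewrite mulrDl -subr_ge0.
  have w1 : 0 <= EV / mB by rewrite divr_ge0// ltW.
  have w2 : 0 <= e ^+ 2 / mB by rewrite divr_ge0// ltW.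
  rewrite [leRHS](_ : _ =
    2 * (EV / mB) + 2 * (e ^+ 2 / mB) +
      2 * (2 * Num.sqrt (EV / mB) * (e * (2 * Num.sqrt mB^-1)))); last first.
    by move: (Num.sqrt _) => s; move: (Num.sqrt _) => t; ring.
  have w3 : 0 <= 2 * Num.sqrt (EV / mB) * (e * (2 * Num.sqrt mB^-1)) by exact: mulr_ge0.
  by lra.
have c0 : 0 <= C6 * r * mB by rewrite !mulr_ge0// ltW.
have fp' := le_trans fp (ler_wpM2l c0 sE).
have -> : 2 * C6 * r * mB * Num.sqrt (EV / mB) + e' =
    e + C6 * r * mB * (2 * Num.sqrt (EV / mB) + e * (2 * Num.sqrt mB^-1)) + e.
  by rewrite -eK /K; ring.
by apply: lerD => //; apply: lerD.
Qed.

(** * Passage to the limit almost everywhere *)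

Lemma countable_ball_cover : exists B : nat -> set Rn,
  [/\ Om `<=` \bigcup_l B l, forall l, measurable (B l), forall l, B l `<=` Om &
      forall l, B l = set0 \/
        exists X r, [/\ 0 < r, eball X (2 * r) `<=` Om & B l = eball X r]].
Proof.
have s1 : 0 < sn + 1 by rewrite ltr_wpDl ?sqrtr_ge0.
pose r (J : dyadic n) : R := (sn + 1) * side J.
have r0 J : 0 < r J by rewrite mulr_gt0// side_gt0.
pose P := [set J : dyadic n | (eball (center J) (2 * r J) : set Rn) `<=` Om].
pose B l : set Rn := \bigcup_(J in [set J | P J /\ pickle J = l]) eball (center J) (r J).
have BP l : B l = set0 \/ exists X r, [/\ 0 < r, eball X (2 * r) `<=` Om & B l = eball X r].
  have [->|/set0P[x0 [J [PJ Jl] _]]] := eqVneq (B l) set0; [by left|right].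
  exists (center J), (r J); split => //.
  apply/seteqP; split => [x [K [_ /= Kl]]|x Jx]; last by exists J.
  by rewrite -(pcan_inj pickleK (etrans Jl (esym Kl))).
exists B; split => //.
- move=> x Ox; have [t t0 tO] := nbhs_eball (open_nbhs_nbhs (conj oOm Ox)).
  have s3 : 0 < 3 * (sn + 1) by rewrite mulr_gt0.
  have [d hd] := len_small (divr_gt0 t0 s3); rewrite ler_pdivlMr// in hd.
  pose I := dcell d%:Z x; have Ix := dcube_center (dcell_mem d%:Z x).
  have l0 : 0 < side I := side_gt0 (R := R) I.
  have sl : 0 <= sn * side I by rewrite mulr_ge0 ?sqrtr_ge0// ltW.
  have PI : P I.
    apply: subset_trans tO; apply: eball_sub; rewrite enormB /r.
    apply: le_trans hd; rewrite -[len d%:Z]/(side I).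
    rewrite mulrA in Ix; rewrite [leLHS](_ : _ =
      enorm (x - center I) + 2 * (sn * side I) + 2 * side I); last by ring.
    rewrite [leRHS](_ : _ = 3 * (sn * side I) + 3 * side I); last by ring.
    by move: (sn * side I) sl Ix => t'; rewrite -/I; lra.
  exists (pickle I) => //; exists I => //; rewrite /eball/=; apply: le_lt_trans Ix _.
  rewrite /r mulrDl mul1r mulrA; lra.
- by move=> l; case: (BP l) => [->//|[X [t [_ _ ->]]]]; exact: eball_measurable.
move=> l; case: (BP l) => [->//|[X [t [t0 tO ->]]]].
exact: subset_trans (@eball_double X t t0) tO.
Qed.

(** Diagonal extraction: [s N] makes the L1 errors on the first [N] balls of the cover at most
    [2^-N]. On each ball the sum of the errors is then integrable, hence finite almost everywhere,
    and the errors tend to 0 there. *)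
Lemma ae_subsequence (u : Rn -> R) (phi : nat -> Rn -> R) (N0 : nat) :
  measurable_fun Om u -> (forall i, measurable_fun Om (phi i)) ->
  (forall X r, 0 < r -> eball X (2 * r) `<=` Om ->
     (\int[m]_(x in eball X r) `|phi i x - u x|%:E)%E @[i --> \oo] --> 0%E) ->
  exists s : nat -> nat, (forall i, (N0 <= s i)%N) /\
    {ae m, forall x, Om x -> phi (s i) x @[i --> \oo] --> u x}.
Proof.
move=> mu mphi L1; have [B [OB mB BO BP]] := countable_ball_cover.
pose d i x := `|phi i x - u x|.
have dB l : (\int[m]_(x in B l) (d i x)%:E)%E @[i --> \oo] --> 0%E.
  case: (BP l) => [->|[X [r [r0 rO ->]]]]; last exact: L1.
  rewrite (_ : (fun i => _) = fun=> 0%E); first exact: cvg_cst.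
  by apply/funext => i; rewrite integral_set0.
have small N : exists i, (N0 <= i)%N /\
    forall l, (l < N)%N -> (\int[m]_(x in B l) (d i x)%:E <= (2^-1 ^+ N)%:E)%E.
  have e0 : 0 < (2^-1 : R) ^+ N by rewrite exprn_gt0.
  have [i hi] : exists M, forall i, (M <= i)%N -> forall l, (l < N)%N ->
      (\int[m]_(x in B l) (d i x)%:E <= (2^-1 ^+ N)%:E)%E.
    elim: {1}N => [|N' [M hM]]; first by exists 0%N.
    have [M' hM'] := cvge0_eventually (dB N') e0.
    exists (maxn M M') => i; rewrite geq_max => /andP[h1 h2] l.
    by rewrite ltnS leq_eqVlt => /orP[/eqP->|]; [exact: hM'|exact: hM].
  by exists (maxn i N0); split; [exact: leq_maxr|apply: hi; exact: leq_maxl].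
have [s hs] := choice small; exists s; split; first by move=> i; case: (hs i).
have md i l : measurable_fun (B l) (d i).
  apply: measurable_funS (_ : measurable_fun Om (d i)) => //.
  by apply: measurableT_comp => //; exact: measurable_funB.
have ball_ae l : {ae m, forall x, B l x -> phi (s i) x @[i --> \oo] --> u x}.
  (* The shift by [l + 1] drops the terms whose choice does not take the ball [B l] into account. *)
  pose g x := (\sum_(0 <= i <oo) (d (s (i + l.+1)%N) x)%:E)%E.
  have mterm i : measurable_fun (B l) (fun x => (d (s (i + l.+1)%N) x)%:E).
    exact/measurable_EFinP.
  have gfin : (\int[m]_(x in B l) g x <= (2 : R)%:E)%E.
    rewrite /g integral_nneseries//; last by move=> i x _; rewrite lee_fin normr_ge0.
    apply: (@le_trans _ _ (\sum_(0 <= i <oo) ((2^-1 : R) ^+ i)%:E)%E).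
      apply: lee_nneseries => [i _ _|i _].
        by apply: integral_ge0 => x _; rewrite lee_fin normr_ge0.
      have [_ h] := hs (i + l.+1)%N.
      apply: le_trans (h l _) _; first by rewrite ltn_addl.
      by rewrite lee_fin ler_wiXn2l ?leq_addr// invf_le1// ler1n.
    apply: nneseries_le_bound => [i|N]; first exact: exprn_ge0.
    have h2 : 0 <= (2^-1 : R) < 1 by apply/andP; split; lra.
    by apply: le_trans (sum_geometric_le N h2) _; apply: eqW; field.
  have g0 x : (0 <= g x)%E by apply: nneseries_ge0 => i _ _; rewrite lee_fin normr_ge0.
  have gi : m.-integrable (B l) g.
    apply/integrableP; split.
      by apply: ge0_emeasurable_sum => // i x _ _; rewrite lee_fin normr_ge0.
    rewrite (eq_integral g) => [|x _]; last by rewrite gee0_abs.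
    by apply: le_lt_trans gfin _; exact: ltry.
  apply: filterS (integrable_ae (mB l) gi) => x gx Bx.
  have := summable_cvg0 (fun i => normr_ge0 _) (gx Bx).
  rewrite (cvg_shiftn l.+1 (fun i => d (s i) x)) => h.
  by apply/subr_cvg0; apply/norm_cvg0P.
have Z : m.-negligible (\bigcup_l (~` [set x | B l x -> phi (s i) x @[i --> \oo] --> u x])).
  by apply: negligible_bigcup => l; exact: ball_ae.
apply: negligibleS Z => x /= /not_implyP[Ox nx].
by have [l _ Bx] := OB x Ox; exists l => //= /(_ Bx).
Qed.

Lemma fatou_limit (u : Rn -> R) (phi : nat -> Rn -> R) (T : set Rn) (p K : R) (N0 : nat) :
  measurable_fun Om u -> (forall i, measurable_fun Om (phi i)) ->
  (forall X r, 0 < r -> eball X (2 * r) `<=` Om ->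
     (\int[m]_(x in eball X r) `|phi i x - u x|%:E)%E @[i --> \oo] --> 0%E) ->
  measurable T -> T `<=` Om -> 0 < p ->
  (forall i, (N0 <= i)%N -> (\int[m]_(x in T) (`|phi i x| `^ p)%:E <= K%:E)%E) ->
  (\int[m]_(x in T) (`|u x| `^ p)%:E <= K%:E)%E.
Proof.
move=> mu mphi L1 mT TO p0 hK.
have [s [sN0 sae]] := ae_subsequence N0 mu mphi L1.
have mpow (f : Rn -> R) : measurable_fun Om f ->
    measurable_fun T (fun x => (`|f x| `^ p)%:E).
  move=> mf; apply/measurable_EFinP; apply: (measurableT_comp (measurable_powR _)).
  by apply: measurableT_comp => //; exact: measurable_funS mf.
have nn (f : Rn -> R) x : (0 <= (`|f x| `^ p)%:E)%E by rewrite lee_fin powR_ge0.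
pose F i x := (`|phi (s i) x| `^ p)%:E.
have mF i : measurable_fun T (F i) by exact: mpow.
apply: (@le_trans _ _ (\int[m]_(x in T) limn_einf (F ^~ x))%E).
  apply: ae_ge0_le_integral => //.
  - exact: mpow.
  - by move=> x _; apply: limn_einf_ge => i; exact: nn.
  - apply: measurableT_comp => //; apply: measurable_fun_limn_esup => i.
    exact: measurableT_comp.
  by apply: filterS sae => x h /TO/h; exact: powR_limn_einf.
apply: le_trans (fatou m mT mF (fun i x _ => nn (phi (s i)) x)) _.
by apply: limn_einf_le => i; exact: hK.
Qed.

(** * The measure on the boundary and its comparison with [m] *)

Variables (mu : {measure set Rn -> \bar R}) (C3 C5 : R).
Hypotheses (mufin : finite_on_boundary_balls Om mu) (C3_gt0 : 0 < C3) (h3 : H3 Om mu C3).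

(** A point outside the support has a null ball, and a fine enough dyadic cube around the point is
    inside it; countably many null cubes thus cover the complement of the support. *)
Lemma off_support_null : mu (~` boundary Om) = 0%E.
Proof.
have [suppE _] := h3.
pose P : set (dyadic n) := [set I | mu (dcube 1 I) = 0%E].
have mU : measurable (\bigcup_(I in P) (dcube 1 I : set Rn)).
  by apply: countable_union_measurable => I; exact: dcube_measurable.
have mb : measurable (boundary Om).
  rewrite /boundary setDE; apply: measurableI.
    by apply: borel_closed; exact: closed_closure.
  by apply: measurableC; apply: borel_open; exact: open_interior.
have U0 : mu (\bigcup_(I in P) (dcube 1 I : set Rn)) = 0%E.
  pose F (k : nat) : set Rn :=
    \bigcup_(J in [set J | P J /\ pickle J = k]) dcube 1 J.
  have F0 k : mu.-negligible (F k).
    have [->|/set0P[x0 [J [PJ Jk] _]]] := eqVneq (F k) set0; first exact: negligible_set0.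
    rewrite (_ : F k = dcube 1 J); last first.
      apply/seteqP; split => [x [K [_ /= Kk]]|x Jx]; last by exists J.
      by rewrite -(pcan_inj pickleK (etrans Jk (esym Kk))).
    by apply/negligibleP => //; exact: dcube_measurable.
  apply/negligibleP => //; apply: negligibleS (negligible_bigcup F0) => x [I PI Ix].
  by exists (pickle I) => //; exists I.
apply/eqP; rewrite -measure_le0 -U0; apply: le_measure; rewrite ?inE.
- exact: measurableC.
- exact: mU.
move=> x; rewrite /= -suppE /supp /= => /existsNP[r /not_implyP[r0 mr]].
have mr0 : mu (eball x r) = 0%E.
  by apply/eqP; rewrite -measure_le0 leNgt; apply/negP.
have s1 : 0 < sn + 1 by rewrite ltr_wpDl ?sqrtr_ge0.
have [d hd] := len_small (divr_gt0 r0 s1); rewrite ler_pdivlMr// in hd.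
exists (dcell d%:Z x); last exact: dcell_mem.
apply/eqP; rewrite -measure_le0 -mr0; apply: le_measure; rewrite ?inE.
- exact: dcube_measurable.
- exact: eball_measurable.
move=> y yx; rewrite /eball/=.
apply: le_lt_trans (dcube_diam yx (dcell_mem _ x)) _; apply: lt_le_trans hd.
by rewrite mulrC -[side _]/(len d%:Z) ltr_pM2l ?len_gt0// ltrDl.
Qed.

Lemma boundary_measurable : measurable (boundary Om).
Proof.
rewrite /boundary setDE; apply: measurableI.
  by apply: borel_closed; exact: closed_closure.
by apply: measurableC; apply: borel_open; exact: open_interior.
Qed.

Lemma mu_inter_boundary (A : set Rn) : measurable A -> mu A = mu (A `&` boundary Om).
Proof.
move=> mA; rewrite (measureDI mu mA boundary_measurable).
rewrite [X in (X + _)%E](_ : _ = 0%E) ?add0e//.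
apply/eqP; rewrite -measure_le0 -off_support_null; apply: le_measure; rewrite ?inE.
- by apply: measurableD => //; exact: boundary_measurable.
- by apply: measurableC; exact: boundary_measurable.
by move=> x [].
Qed.

Lemma mu_ball_doubling (x : Rn) (r : R) (q : nat) : boundary Om x -> 0 < r ->
  (mu (eball x (2 ^+ q * r)) <= (C3 ^+ q)%:E * mu (eball x r))%E.
Proof.
move=> Bx r0; elim: q => [|q IH]; first by rewrite !expr0 mul1r mul1e.
rewrite exprS -mulrA; have [_ h] := h3.
have r0' : 0 < 2 ^+ q * r by rewrite mulr_gt0// exprn_gt0.
apply: le_trans (h x _ Bx r0') _; rewrite exprS EFinM -muleA.
by apply: lee_wpmul2l => //; rewrite lee_fin ltW.
Qed.

Lemma mu_ball_compare (a : R) : exists2 c : R, 0 < c &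
  forall (x : Rn) (r s : R) (A : set Rn), boundary Om x -> 0 < s -> r <= a * s ->
    A `<=` eball x r -> measurable A -> fine (mu A) <= c * fine (mu (eball x s)).
Proof.
pose q := Num.Def.archi_bound `|a|; exists (C3 ^+ q); first by rewrite exprn_gt0.
move=> x r s A Bx s0 ras Ar mA.
have [p1 p2] := andP (mufin Bx s0).
have fs : mu (eball x s) \is a fin_num by rewrite ge0_fin_numE.
have h : (mu A <= (C3 ^+ q)%:E * mu (eball x s))%E.
  apply: le_trans (mu_ball_doubling q Bx s0); apply: le_measure; rewrite ?inE//.
    exact: eball_measurable.
  apply: subset_trans Ar _; apply: eball_sub; rewrite subrr enorm0 add0r.
  apply: le_trans ras _; rewrite ler_pM2r//; apply: le_trans (ler_norm a) _.
  by apply: ltW; exact: upper_nthrootP.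
rewrite -lee_fin EFinM !fineK//; rewrite ge0_fin_numE//; apply: le_lt_trans h _.
by apply: lte_mul_pinfty => //; rewrite lee_fin exprn_ge0// ltW.
Qed.

Hypotheses (C5_gt0 : 0 < C5) (h5 : H5 Om m mu C5).

Let bulk (x : Rn) (r : R) : R := fine (m (eball x r `&` Om)).
Let surf (x : Rn) (r : R) : R := fine (mu (eball x r)).

Lemma boundary_ball_gt0 (x : Rn) (r : R) : boundary Om x -> 0 < r ->
  0 < bulk x r /\ 0 < surf x r.
Proof.
move=> Bx r0; split; apply: fine_gt0; last exact: mufin.
rewrite ball_measure_finite andbT.
by apply: ball_measure_gt0 => //; case: Bx.
Qed.

Lemma rho_fin (x : Rn) (r : R) : boundary Om x -> 0 < r ->
  rho Om m mu x r = (bulk x r / (r * surf x r))%:E.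
Proof.
move=> Bx r0; have [a0 b0] := boundary_ball_gt0 Bx r0.
have ma : m (eball x r `&` Om) = (bulk x r)%:E.
  by rewrite fineK// ge0_fin_numE//; exact: ball_measure_finite.
have mb : mu (eball x r) = (surf x r)%:E.
  by rewrite fineK// ge0_fin_numE//; case/andP: (mufin Bx r0).
by rewrite /rho ma mb -EFinM inver gt_eqF ?mulr_gt0// -EFinM.
Qed.

(** (H5) for the radii [len j] and [len (j + p)]: the power [1 - 1 / C5] of their ratio [2^p] is
    [2^p] times the decaying factor, and another [2^p] comes from the radii in [rho]. [Num.max 1 C5]
    covers [p = 0], where (H5) says nothing. *)
Lemma density_comparison (x : Rn) (j : int) (p : nat) : boundary Om x ->
  (1 / 4) ^+ p * (bulk x (len j) * surf x (len (j + p%:Z))) <=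
  Num.max 1 C5 * (2 `^ (- C5^-1)) ^+ p * (surf x (len j) * bulk x (len (j + p%:Z))).
Proof.
move=> Bx; have r0 := len_gt0 (R := R) j; have s0 := len_gt0 (R := R) (j + p%:Z).
have [a0 b0] := boundary_ball_gt0 Bx r0; have [a'0 b'0] := boundary_ball_gt0 Bx s0.
have [->|p0] := posnP p.
  rewrite addr0 !expr0 mulr1 mul1r (mulrC (surf _ _)) ler_peMl ?le_max ?lexx//.
  by rewrite mulr_ge0// ltW.
have sr : len (j + p%:Z) < len j by rewrite ltNge len_le -ltNge ltrDl ltz_nat.
have p20 : 0 < (2 : R) ^+ p by rewrite exprn_gt0.
have rs : len j = 2 ^+ p * len (j + p%:Z).
  by rewrite lenD len_nat exprVn mulrCA mulfV ?mulr1// gt_eqF.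
have := h5 Bx s0 sr; rewrite !rho_fin// inver gt_eqF ?divr_gt0 ?mulr_gt0//.
rewrite -EFinM lee_fin {4}rs mulfK ?gt_eqF//.
have -> : (2 ^+ p) `^ (1 - C5^-1) = 2 ^+ p * (2 `^ (- C5^-1)) ^+ p.
  rewrite -exprMn -{1}(powR_mulrn p (ler0n R 2)) -powRrM mulrC powRrM.
  by rewrite powR_mulrn ?powR_ge0// powRD ?pnatr_eq0 ?implybT// powRr1.
move: a0 b0 a'0 b'0; rewrite rs.
set s := len (j + p%:Z) in s0 *.
move: (bulk x (2 ^+ p * s)) (surf x (2 ^+ p * s)) (bulk x s) (surf x s).
move: s s0 => s s0 a b a' b' a0 b0 a'0 b'0.
move: (_ `^ _) (powR_ge0 (2 : R) (- C5^-1)) => th th0.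
rewrite [X in X <= _ -> _](_ : _ = a * b' / (2 ^+ p * (b * a'))); last first.
  by field; rewrite !gt_eqF.
rewrite ler_pdivrMr ?mulr_gt0// => h.
apply: (@le_trans _ _ (C5 * th ^+ p * (b * a'))); last first.
  apply: ler_wpM2r; first by rewrite mulr_ge0// ltW.
  by apply: ler_wpM2r; [exact: exprn_ge0|rewrite le_max lexx orbT].
have q0 : 0 <= (1 / 4 : R) ^+ p by apply: exprn_ge0; lra.
apply: le_trans (ler_wpM2l q0 h) _; apply: eqW.
rewrite [LHS](_ : _ = ((1 / 4) ^+ p * 2 ^+ p * 2 ^+ p) * (C5 * th ^+ p * (b * a'))); last first.
  by move: ((1 / 4) ^+ p) (2 ^+ p) (th ^+ p) => u v w; ring.
rewrite -!exprMn (_ : 1 / 4 * 2 * 2 = 1 :> R); first by rewrite expr1n mul1r.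
by field.
Qed.

Lemma trace_small (C1 : R) (D : int -> set (set Rn)) (f : Rn -> R) (x : Rn) (e : R) :
  has_trace Om m C1 D f x 0 -> 0 < e -> exists2 d : R, 0 < d &
    forall X, cone Om C1 D x X -> delta Om X < d ->
      `|avg m (eball X (delta Om X / 2)) f| < e.
Proof.
move=> h e0; have [d /= d0 hd] := h _ (nbhsx_ballx (0 : R) e e0).
exists d => // X cX dX; have := hd X (conj cX dX).
by rewrite /= -ball_normE /ball_/= sub0r normrN.
Qed.

(** * The top average of a function with vanishing trace *)

Section TraceBound.
Variables (KA theta L Cp a0 : R).
Hypotheses (KA1 : 1 <= KA) (theta0 : 0 < theta) (L0 : 0 < L) (Cp0 : 0 < Cp) (a00 : 0 < a0).
Let KB := 2 * KA + sn.
Let th := 2 `^ (- C5^-1) : R.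

Let KA0 : 0 < KA. Proof. exact: lt_le_trans KA1. Qed.
Let s0 : 0 <= sn. Proof. exact: sqrtr_ge0. Qed.

Lemma boundary_nball (i : int) (x : Rn) : boundary Om x ->
  eball x (len i) `<=` nball KB i x /\ 0 < fine (mu (nball KB i x)).
Proof.
move=> Bx; have l0 := len_gt0 (R := R) i.
have sub : eball x (len i) `<=` nball KB i x.
  apply: nball_mem; rewrite subrr enorm0 /KB !mulrDl.
  by have := ler_wpM2r (ltW l0) KA1; rewrite mul1r; lra.
split => //; apply: fine_gt0.
have /andP[p _] := mufin Bx l0; apply/andP; split.
  by apply: lt_le_trans p _; apply: le_measure; rewrite ?inE//; exact: eball_measurable.
have rb : 0 < (KB + sn) * len i by rewrite mulr_gt0// ltr_pwDl// ltr_pwDl// mulr_gt0.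
have /andP[_] := mufin Bx rb; apply: le_lt_trans; apply: le_measure; rewrite ?inE.
- exact: eball_measurable.
- exact: eball_measurable.
apply: eball_sub; have := dcube_center (dcell_mem i x); rewrite enormB.
rewrite -[side _]/(len i) mulrA [(KB + sn) * _]mulrDl => h.
by have := mulr_ge0 s0 (ltW l0); lra.
Qed.

Definition cube_with_tent (j : int) (Q T : set Rn) (z : Rn) :=
  [/\ [/\ measurable Q, Q `<=` boundary Om, boundary Om z,
         eball z (a0 * len j) `&` boundary Om `<=` Q &
         forall x, Q x -> enorm (x - z) <= len j],
      measurable T, T `<=` Om,
      forall X y, T X -> Q y -> enorm (X - y) <= KA * len j & (0 < m T < +oo)%E].

(** Follows from [density_comparison] at [x] once the balls are replaced: those of radius [len j] by
    [Q] and [T], by doubling of each measure ([e2], [e3]), and those of radius [len (j + p)] by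
    [nball], by doubling for [mu] ([e1]) and by inclusion for [m] ([e4]). *)
Lemma trace_energy : exists2 H : R, 0 < H &
  forall (j : int) (Q T : set Rn) (z : Rn), cube_with_tent j Q T z ->
  0 < fine (mu Q) /\
  forall (G : Rn -> R), (forall x, T x -> 0 <= G x) ->
  forall (x : Rn) (p : nat), Q x ->
  (1 / 4) ^+ p * local_energy T G KB (j + p%:Z) x <=
  H * (fine (mu Q) / fine (m T)) * th ^+ p *
    ((\int[m]_(y in T `&` nball KB (j + p%:Z) x) G y) / fine (mu (nball KB (j + p%:Z) x))).
Proof.
have [c1 c10 hc1] := mu_ball_compare (KB + sn).
have [c2 c20 hc2] := mu_ball_compare (2 / a0).
pose q := Num.Def.archi_bound (KA + 1).
have hq : KA + 1 <= 2 ^+ q by apply: ltW; exact: upper_nthrootP.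
have M0 : 0 < Num.max 1 C5 by rewrite lt_max ltr01.
have D0 : 0 < C4 ^+ q by rewrite exprn_gt0.
exists (Num.max 1 C5 * c1 * c2 * C4 ^+ q); first by rewrite !mulr_gt0.
move=> j Q T z [[mQ QB Bz zQ Qd] mT TO hy mT0].
have r0 := len_gt0 (R := R) j; have ar0 : 0 < a0 * len j by rewrite mulr_gt0.
have mz : (0 < mu (eball z (a0 * len j)))%E by case/andP: (mufin Bz ar0).
have zle : (mu (eball z (a0 * len j)) <= mu Q)%E.
  rewrite mu_inter_boundary; last exact: eball_measurable.
  apply: le_measure; rewrite ?inE//; apply: measurableI; first exact: eball_measurable.
  exact: boundary_measurable.
have Qfin : (mu Q < +oo)%E.
  have r20 : 0 < 2 * len j by rewrite mulr_gt0.
  have /andP[_] := mufin Bz r20; apply: le_lt_trans.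
  apply: le_measure; rewrite ?inE//; first exact: eball_measurable.
  by move=> x /Qd h; apply: le_lt_trans h _; rewrite ltr_pMl// ltr1n.
have muQ0 : 0 < fine (mu Q) by apply: fine_gt0; rewrite (lt_le_trans mz zle).
split => // G G0 x p Qx; have Bx := QB _ Qx.
set s := len (j + p%:Z); have s_gt0 : 0 < s := len_gt0 (R := R) (j + p%:Z).
have [sN N0] := boundary_nball (j + p%:Z) Bx.
have [a1 b1] := boundary_ball_gt0 Bx r0; have [a2 b2] := boundary_ball_gt0 Bx s_gt0.
have e1 : fine (mu (nball KB (j + p%:Z) x)) <= c1 * surf x s.
  apply: (hc1 x ((KB + sn) * s)) => //; last exact: eball_measurable.
  apply: eball_sub; have := dcube_center (dcell_mem (j + p%:Z) x); rewrite enormB.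
  rewrite -[side _]/s mulrA [(KB + sn) * _]mulrDl => h.
  by rewrite -/s; have := mulr_ge0 s0 (ltW s_gt0); lra.
have e2 : surf x (len j) <= c2 * fine (mu Q).
  apply: (@le_trans _ _ (c2 * fine (mu (eball z (a0 * len j))))).
    apply: (hc2 z (2 * len j)) => //; last exact: eball_measurable.
      by rewrite mulrA divfK// gt_eqF.
    by apply: eball_sub; rewrite mulr_natl mulr2n lerD2r; exact: Qd.
  apply: ler_wpM2l; first exact: ltW.
  rewrite fine_le// ge0_fin_numE//; exact: le_lt_trans Qfin.
have e3 : fine (m T) <= C4 ^+ q * bulk x (len j).
  have fb : m (eball x (len j) `&` Om) \is a fin_num.
    by rewrite ge0_fin_numE//; exact: ball_measure_finite.
  rewrite -lee_fin EFinM !fineK//; last by rewrite ge0_fin_numE//; case/andP: mT0.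
  apply: le_trans (ball_doubling q (proj1 Bx) r0).
  apply: le_measure; rewrite ?inE//; first exact: ball_inter_measurable.
  move=> X TX; split; last exact: TO.
  rewrite /eball/=; apply: le_lt_trans (hy X x TX Qx) _.
  apply: (@lt_le_trans _ _ ((KA + 1) * len j)); last by rewrite ler_pM2r.
  by rewrite ltr_pM2r// ltrDl.
have e4 : bulk x s <= fine (m (nball KB (j + p%:Z) x `&` Om)).
  have h : (m (eball x s `&` Om) <= m (nball KB (j + p%:Z) x `&` Om))%E.
    apply: le_measure; rewrite ?inE; [exact: ball_inter_measurable..|].
    exact: setSI.
  rewrite fine_le// ge0_fin_numE//; exact: ball_measure_finite.
have mt0 : 0 < fine (m T) by exact: fine_gt0.
have := density_comparison j p Bx; rewrite -/s -/th /local_energy.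
set E := \int[m]_(y in _) G y.
have E0 : 0 <= E by apply: Rintegral_ge0 => y [/G0].
have q0 : 0 <= (1 / 4 : R) ^+ p by apply: exprn_ge0; lra.
have t0 : 0 <= th ^+ p by apply: exprn_ge0; exact: powR_ge0.
move: (fine (mu (nball KB (j + p%:Z) x))) (fine (m (nball KB (j + p%:Z) x `&` Om))) N0 e1 e4.
move: (fine (mu Q)) (fine (m T)) muQ0 mt0 e2 e3.
move: a1 b1 a2 b2; move: (bulk x (len j)) (surf x (len j)) (bulk x s) (surf x s).
move: E E0 ((1 / 4) ^+ p) q0 (th ^+ p) t0 (C4 ^+ q) D0 (Num.max 1 C5) M0.
move=> E E0 u u0 t t0 d d0 M M0 a b a' b' a1 b1 a2 b2 uQ mt uQ0 mt0 e2 e3 nN mN N0 e1 e4 h.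
have h1 : u * (a * b') <= M * t * (c2 * uQ * a').
  apply: le_trans h _; apply: ler_wpM2l; first by rewrite mulr_ge0// ltW.
  by rewrite ler_pM2r.
have h2 : u * (mt * nN) <= M * c1 * c2 * d * uQ * t * a'.
  apply: (@le_trans _ _ (u * ((d * a) * (c1 * b')))).
    by apply: ler_wpM2l => //; apply: ler_pM => //; exact: ltW.
  rewrite (_ : u * (d * a * (c1 * b')) = d * c1 * (u * (a * b'))); last by ring.
  apply: (@le_trans _ _ (d * c1 * (M * t * (c2 * uQ * a')))).
    by apply: ler_wpM2l => //; rewrite mulr_ge0// ltW.
  by apply: eqW; ring.
have mN0 : 0 < mN by apply: lt_le_trans e4.
rewrite mulrA ler_pdivrMr// [u * E]mulrC.
have -> : M * c1 * c2 * d * (uQ / mt) * t * (E / nN) * mN =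
    E * ((M * c1 * c2 * d * uQ * t * mN) / (mt * nN)).
  by field; rewrite !gt_eqF.
apply: ler_wpM2l => //; rewrite ler_pdivlMr ?mulr_gt0//.
apply: le_trans h2 _; apply: ler_wpM2l => //.
by rewrite !mulr_ge0// ltW.
Qed.

(** The decay [th ^ p] is divided in two: one factor [sqrt th ^ p] remains in the series on the
    right, which makes it integrable over [Q], and the other one makes the costs summable. *)
Lemma trace_pointwise : exists2 H : R, 0 < H &
  forall (C1 : R) (D : int -> set (set Rn)) (j : int) (Q T : set Rn) (z : Rn) (I0 : dyadic n),
  cube_with_tent j Q T z ->
  traces Om C1 D T Q KA theta L j I0 ->
  forall (f G : Rn -> R), poincare f G Cp -> (forall x, T x -> 0 <= G x) ->
  m.-integrable T (EFin \o G) ->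
  forall x, Q x -> has_trace Om m C1 D f x 0 ->
  ((avd (ball_avg f) I0 ^+ 2)%:E <=
    (H * len j ^+ 2 * (fine (mu Q) / fine (m T)))%:E *
    \sum_(0 <= p <oo) (Num.sqrt th ^+ p *
      ((\int[m]_(y in T `&` nball KB (j + p%:Z) x) G y) /
         fine (mu (nball KB (j + p%:Z) x))))%:E)%E.
Proof.
have [Lc Lc0 hLc] := step_cost KA0 theta0 Cp0.
have [H H0 hH] := trace_energy.
have /andP[th0 th1] : 0 < th < 1 by apply: powR_two_lt1; rewrite invr_gt0.
have eta1 : 0 <= Num.sqrt th < 1 by rewrite sqrtr_ge0/= -sqrtr1 ltr_sqrt.
pose cg : R := (1 - Num.sqrt (Num.sqrt th))^-1.
have cg0 : 0 < cg.
  by rewrite invr_gt0 subr_gt0 -[ltRHS]sqrtr1 ltr_sqrt//; case/andP: eta1.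
exists ((L * Lc * cg) ^+ 2 * H); first by rewrite mulr_gt0// exprn_gt0// !mulr_gt0.
move=> C1 D j Q T z I0 cT trc f G fG G0 Gi x Qx tr0.
have [[mQ QB Bz zQ Qd] mT TO hy mT0] := cT; have [muQ0 hE] := hH j Q T z cT.
have mt0 : 0 < fine (m T) by exact: fine_gt0.
have r0 := len_gt0 (R := R) j.
set h := fine (mu Q) / fine (m T); have h0 : 0 < h by rewrite divr_gt0.
pose b p := (\int[m]_(y in T `&` nball KB (j + p%:Z) x) G y) / fine (mu (nball KB (j + p%:Z) x)).
have b0 p : 0 <= b p.
  apply: divr_ge0; last exact: fine_ge0.
  by apply: Rintegral_ge0 => y [/G0].
pose a p := local_energy T G KB (j + p%:Z) x.
have aP p : (1 / 4) ^+ p * a p <= H * h * th ^+ p * b p by exact: hE.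
have eta0 : 0 <= Num.sqrt th by case/andP: eta1.
have u0 p : (0 <= (Num.sqrt th ^+ p * b p)%:E)%E.
  by rewrite lee_fin; apply: mulr_ge0 => //; apply: exprn_ge0.
have [[v vE]|vE] : (exists v, \sum_(0 <= p <oo) (Num.sqrt th ^+ p * b p)%:E = v%:E)%E \/
    (\sum_(0 <= p <oo) (Num.sqrt th ^+ p * b p)%:E = +oo)%E.
- have : (0 <= \sum_(0 <= p <oo) (Num.sqrt th ^+ p * b p)%:E)%E by apply: nneseries_ge0.
  by case: (\sum_(0 <= p <oo) _)%E => [v| |] // _; [left; exists v|right].
- rewrite vE -EFinM lee_fin.
  have va p : Num.sqrt th ^+ p * b p <= v.
    by rewrite -lee_fin -vE; apply: (nneseries_ge_term p u0).
  have v0 : 0 <= v by apply: le_trans (va 0%N); rewrite expr0 mul1r.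
  pose U := H * h * v; have U0 : 0 <= U by rewrite mulr_ge0// mulr_ge0// ltW.
  pose cost p := Lc * len (j + p%:Z) * Num.sqrt (a p).
  have cost0 p : 0 <= cost p by rewrite /cost !mulr_ge0 ?sqrtr_ge0 ?(ltW Lc0) ?(ltW (len_gt0 _)).
  have costS N : \sum_(p < N) cost p <= Lc * len j * (Num.sqrt U * cg).
    apply: cost_sum_le => //; first exact: ltW.
    move=> p; apply: le_trans (aP p) _.
    rewrite -{1}(sqr_sqrtr (ltW th0)) exprAC expr2.
    rewrite (_ : _ * b p = H * h * (Num.sqrt th ^+ p * b p) * Num.sqrt th ^+ p); last first.
      by move: (Num.sqrt th ^+ p) => y; ring.
    apply: ler_wpM2r; first exact: exprn_ge0.
    by apply: ler_wpM2l => //; rewrite mulr_ge0// ltW.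
  have tel := trc (ball_avg f) cost x Qx cost0
    (fun p => hLc T f G (j + p%:Z) x mT G0 Gi fG).
  have bnd : `|avd (ball_avg f) I0| <= L * Lc * cg * len j * Num.sqrt U.
    apply/ler_addgt0Pr => e e0; have [d d0 hd] := trace_small tr0 e0.
    have l5 : 0 < 5 * len j by rewrite mulr_gt0.
    have d10 : 0 < d / (5 * len j) / 2 by rewrite !divr_gt0.
    have [q hq] := len_small d10.
    have [X [cX OX dX hX]] := tel q.
    have dXd : delta Om X < d.
      apply: le_lt_trans dX _; rewrite lenD mulrA.
      apply: (@le_lt_trans _ _ (5 * len j * (d / (5 * len j) / 2))).
        by apply: ler_wpM2l => //; exact: ltW.
      rewrite mulrA mulrCA mulfV ?mulr1 ?gt_eqF//.
      by rewrite ltr_pdivrMr// mulr_natr mulr2n ltrDl.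
    have h1 := ler_wpM2l (ltW L0) (costS q.+1).
    have := hd X cX dXd; have := le_trans hX h1; rewrite -/(ball_avg f X (delta Om X / 2)).
    have := ler_distD (ball_avg f X (delta Om X / 2)) (avd (ball_avg f) I0) 0.
    rewrite !subr0 (distrC (avd _ _)) => g1 g2 g3; apply: le_trans g1 _.
    apply: lerD (ltW g3); apply: le_trans g2 _.
    by apply: eqW; ring.
  have := lerXn2r 2 _ _ bnd; rewrite !nnegrE normr_ge0 (le_trans _ bnd)// => /(_ isT isT).
  rewrite real_normK ?num_real// => g; apply: le_trans g _.
  rewrite exprMn sqr_sqrtr// /U; apply: eqW; ring.
have cg20 : 0 < (L * Lc * cg) ^+ 2 by rewrite exprn_gt0// !mulr_gt0.
by rewrite vE gt0_muley ?leey// lte_fin !mulr_gt0// invr_gt0.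
Qed.

(** The left-hand side of [trace_pointwise] does not depend on [x]: integrating it over [Q]
    multiplies it by [mu Q], which cancels the factor [mu Q] on the right. *)
Lemma trace_bound : exists2 Ct : R, 0 < Ct &
  forall (C1 : R) (D : int -> set (set Rn)) (j : int) (Q T : set Rn) (z : Rn) (I0 : dyadic n),
  cube_with_tent j Q T z ->
  traces Om C1 D T Q KA theta L j I0 ->
  forall (f G : Rn -> R), poincare f G Cp -> (forall x, T x -> 0 <= G x) ->
  m.-integrable T (EFin \o G) ->
  {ae mu, forall x, Q x -> has_trace Om m C1 D f x 0} ->
  avd (ball_avg f) I0 ^+ 2 <= Ct * (len j ^+ 2 * ((\int[m]_(x in T) G x) / fine (m T))).
Proof.
have [H H0 hH] := trace_pointwise; have [H' H'0 hH'] := trace_energy.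
have /andP[th0 th1] : 0 < th < 1 by apply: powR_two_lt1; rewrite invr_gt0.
have eta1 : 0 <= Num.sqrt th < 1 by rewrite sqrtr_ge0/= -sqrtr1 ltr_sqrt.
have [Nov Nov0 hN] := @kernel_series R n KB _ eta1.
exists (H * (Nov + 1)); first by rewrite mulr_gt0// ltr_wpDl.
move=> C1 D j Q T z I0 cT trc f G fG G0 Gi tr0.
have [[mQ QB Bz zQ Qd] mT TO hy mT0] := cT; have [muQ0 _] := hH' j Q T z cT.
have mt0 : 0 < fine (m T) by exact: fine_gt0.
have r0 := len_gt0 (R := R) j.
set E := \int[m]_(x in T) G x; have E0 : 0 <= E by apply: Rintegral_ge0.
pose w (p : nat) (x : Rn) := fine (mu (nball KB (j + p%:Z) x)).
have [mV V0 VE] : let V x := (\sum_(0 <= p <oo) (Num.sqrt th ^+ p *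
    ((\int[m]_(y in T `&` nball KB (j + p%:Z) x) G y) / w p x))%:E)%E in
  [/\ measurable_fun Q V, forall x, Q x -> (0 <= V x)%E &
      (\int[mu]_(x in Q) V x <= (Nov * E)%:E)%E].
  apply: (hN m mu Q T G j w) => //.
    by move=> p x y xy; rewrite /w /nball xy.
  move=> p x Qx; have [_ w0] := boundary_nball (j + p%:Z) (QB _ Qx).
  split => //; rewrite fineK; last first.
    rewrite ge0_fin_numE// ltNge leye_eq; apply/negP => /eqP we.
    by move: w0; rewrite we ltxx.
  apply: le_measure; rewrite ?inE.
  - by apply: measurableI => //; exact: cell_measurable.
  - exact: eball_measurable.
  move=> y [Qy /= yx].
  have -> : nball KB (j + p%:Z) x = nball KB (j + p%:Z) y.
    by rewrite /nball /dcell -/(dcell _ x).2 -yx.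
  apply: (boundary_nball _ (QB _ Qy)).1.
  by rewrite /eball/= subrr enorm0 len_gt0.
set h := fine (mu Q) / fine (m T); have h0 : 0 < h by rewrite divr_gt0.
pose Qw := H * len j ^+ 2 * h.
have Qw0 : 0 <= Qw by rewrite !mulr_ge0 ?exprn_ge0// ltW.
set A := avd (ball_avg f) I0 ^+ 2; have A0 : 0 <= A by exact: sqr_ge0.
have key : (A%:E * mu Q <= (Qw * (Nov * E))%:E)%E.
  rewrite -integral_cst//.
  apply: (@le_trans _ _ (\int[mu]_(x in Q) (Qw%:E * (\sum_(0 <= p <oo) (Num.sqrt th ^+ p *
    ((\int[m]_(y in T `&` nball KB (j + p%:Z) x) G y) / w p x))%:E)))%E); last first.
    by rewrite ge0_integralZl// (EFinM Qw); apply: lee_wpmul2l => //; rewrite lee_fin.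
  apply: ae_ge0_le_integral => //.
  - by move=> x Qx; apply: mule_ge0; rewrite ?lee_fin// V0.
  - exact: measurable_funeM.
  apply: filterS tr0 => x trx Qx.
  exact: (hH C1 D j Q T z I0 cT trc f G fG G0 Gi x Qx (trx Qx)).
have muQf : mu Q = (fine (mu Q))%:E.
  rewrite fineK// ge0_fin_numE// ltNge leye_eq; apply/negP => /eqP we.
  by move: muQ0; rewrite we ltxx.
move: key; rewrite muQf -EFinM lee_fin => key.
rewrite -(ler_pM2r muQ0); apply: le_trans key _; rewrite /Qw /h.
have -> : H * len j ^+ 2 * (fine (mu Q) / fine (m T)) * (Nov * E) =
  H * (len j ^+ 2 * (E / fine (m T))) * fine (mu Q) * Nov by ring.
have -> : H * (Nov + 1) * (len j ^+ 2 * (E / fine (m T))) * fine (mu Q) =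
  H * (len j ^+ 2 * (E / fine (m T))) * fine (mu Q) * (Nov + 1) by ring.
apply: ler_wpM2l; last by rewrite lerDl.
have e0 : 0 <= E / fine (m T) by rewrite divr_ge0// ltW.
by rewrite !mulr_ge0// ltW.
Qed.

End TraceBound.

(** * The inequality for functions of the energy space *)

Variables (C1 : R) (D : int -> set (set Rn)) (a0 : R) (M : nat) (c C0 : R)
  (Z : int -> set Rn -> dyadic n -> dyadic n -> nat -> Rn).
Hypotheses (n0 : (0 < n)%N) (b0 : boundary Om !=set0) (C1_gt0 : 0 < C1) (h1 : H1 Om C1)
  (a0_gt0 : 0 < a0) (hD : christ_cubes Om D a0) (c_gt0 : 0 < c) (C0_gt0 : 0 < C0)
  (hZ : harnack_chains Om C1 D M c C0 Z).

Lemma energy_tent : exists k C : R, [/\ 1 < k, 0 < C &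
  forall j Q, D j Q -> forall (u : Rn -> R) (v : Rn -> Rn), energy_gradient Om m u v ->
  {ae mu, forall x, dilate Om 2 j Q x -> has_trace Om m C1 D u x 0} ->
  let T := tent2 Om C1 D M Z j Q in
  [/\ (0 < m T < +oo)%E, m.-integrable T (EFin \o (fun x => enorm (v x) ^+ 2)) &
    (\int[m]_(x in T) (`|u x| `^ (2 * k))%:E <=
     (C * (len j ^+ 2 * ((\int[m]_(x in T) (enorm (v x) ^+ 2)) / fine (m T))) `^ k *
       fine (m T))%:E)%E]].
Proof.
have [KA [theta [L [KA1 th0 L0 geo]]]] :=
  tent_geometry n0 oOm b0 C1_gt0 h1 hD c_gt0 C0_gt0 hZ.
have [k [Cs [k1 Cs0 sob]]] := sobolev_tent KA1 th0 L0 C6_gt0.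
have C6' : 0 < 2 * C6 by rewrite mulr_gt0.
have [Ct Ct0 trb] := trace_bound KA1 th0 L0 C6' a0_gt0.
have k0 : 0 < k by apply: lt_trans k1.
(* [2 ^ (2k)] comes from splitting [phi i] into [phi i - d] and [d], [2 ^ k] from the energy of
   [phi i], which is about twice that of [v], and [2 Ct + 2] from [d^2 <= 2 b^2 + 2 (d - b)^2]. *)
pose C := 2 `^ (2 * k) * (Cs * 2 `^ k + (2 * Ct + 2) `^ k).
have C_gt0 : 0 < C.
  by rewrite mulr_gt0 ?powR_gt0// addr_gt0// ?mulr_gt0 ?powR_gt0// addr_gt0// mulr_gt0.
exists k, C; split => // j Q DQ u v euv tr0 T.
have mT : measurable T by exact: tent_measurable.
have [I0 /= [[WI IT] TO TQ tel trc]] := geo j Q DQ.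
have [z Bz zQ] : exists2 z, boundary Om z & eball z (a0 * len j) `&` boundary Om `<=` Q.
  by have [_ _ _ _ /(_ j Q DQ)[_ h]] := hD.
have l0 := len_gt0 (R := R) j.
have Qz : Q z by apply: zQ; split => //; rewrite /eball/= subrr enorm0 mulr_gt0.
have QB := cube_boundary hD DQ.
have mQ : measurable Q by have [_ h _ _ _] := hD; exact: (h _ _ DQ).
have Qd x : Q x -> enorm (x - z) <= len j by move=> Qx; exact: (cube_diam hD DQ Qx Qz).
have Tz X : T X -> enorm (X - z) <= KA * len j by move=> TX; exact: TQ.
have s0 : 0 < side I0 / 2 := divr_gt0 (side_gt0 I0) (ltr0n R 2).
have IO : eball (center I0) (2 * (side I0 / 2)) `<=` Om.
  have Oc : Om (center I0) by apply: TO; apply: IT; exact: center_mem.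
  apply: subset_trans (eball_delta_sub oOm Oc); apply: eball_sub.
  rewrite subrr enorm0 add0r mulrC divfK//.
  have := whitney_delta_ge b0 WI (center_mem I0 ler01).
  by have := sn_ge1 (R := R) n0; have := side_gt0 (R := R) I0; nra.
pose B0 : set Rn := eball (center I0) (side I0 / 2).
have B0O : B0 `<=` Om := subset_trans (@eball_double _ _ s0) IO.
have mB0 := inner_ball_measure s0 B0O.
have mT0 : (0 < m T < +oo)%E.
  apply/andP; split.
    case/andP: mB0 => p _; apply: lt_le_trans p _; apply: le_measure; rewrite ?inE//.
      exact: eball_measurable.
    by apply: subset_trans IT; exact: eball_sub_dcube.
  apply: le_lt_trans (ball_measure_finite z ((KA + 1) * len j)).
  apply: le_measure; rewrite ?inE//; first exact: ball_inter_measurable.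
  move=> X TX; split; last exact: TO.
  by apply: le_lt_trans (Tz X TX) _; rewrite ltr_pM2r// ltrDl.
have mt0 : 0 < fine (m T) by exact: fine_gt0.
have [uL vL [phi [sphi fphi L1 L2]]] := euv; have [mv vLoo] := vL.
have nn (w : Rn -> Rn) x : T x -> 0 <= enorm (w x) ^+ 2 by move=> _; exact: sqr_ge0.
have [N0' hN0'] := cvge0_eventually L2 ltr01.
have [vi _ _] := energy_split (sphi N0') vL mT TO (hN0' _ (leqnn _)).
split => //.
have pu := energy_poincare euv.
have trQ : {ae mu, forall x, Q x -> has_trace Om m C1 D u x 0}.
  apply: filterS tr0 => x h Qx; apply: h; split; first exact: QB.
  rewrite (_ : 2 - 1 = 1 :> R) ?mul1r; last by lra.
  by apply: le_trans (dist_le x Qx) _; rewrite subrr enorm0 ltW.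
have := trb C1 D j Q T z I0 (And5 (And5 mQ QB Bz zQ Qd) mT TO TQ mT0) trc u _ pu (nn v) vi trQ.
rewrite /avd /ball_avg -/B0.
set EV := \int[m]_(x in T) enorm (v x) ^+ 2; set S := len j ^+ 2 * (EV / fine (m T)).
have EV0 : 0 <= EV by apply: Rintegral_ge0 => x _; exact: sqr_ge0.
have S0 : 0 <= S by rewrite mulr_ge0 ?exprn_ge0 ?divr_ge0// ltW.
set b := avg m B0 u => hb.
(* The errors of approximation are gathered in [t], additive since [S] may vanish, and removed by
   [powR_absorb]. *)
suff key t : 0 < t -> (\int[m]_(x in T) (`|u x| `^ (2 * k))%:E <=
    (C * (S + t) `^ k * fine (m T))%:E)%E.
  have I0' : (0 <= \int[m]_(x in T) (`|u x| `^ (2 * k))%:E)%E.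
    by apply: integral_ge0 => x _; rewrite lee_fin powR_ge0.
  move: key I0'; case: (\int[m]_(x in T) (`|u x| `^ (2 * k))%:E)%E => [y| |] key.
  - rewrite lee_fin => y0.
    rewrite lee_fin mulrAC; apply: powR_absorb => //; first by rewrite mulr_gt0.
    by move=> t /key; rewrite lee_fin mulrAC.
  - by have := key 1 ltr01.
  - by [].
move=> t0.
(* An energy error [e] adds exactly [t] to [S], and the L1 error below moves the average over [B0]
   by at most [sqrt t]. *)
pose e := t * fine (m T) / len j ^+ 2.
have e0 : 0 < e by rewrite divr_gt0 ?mulr_gt0// exprn_gt0.
have st0 : 0 < Num.sqrt t * fine (m B0) by rewrite mulr_gt0 ?sqrtr_gt0// fine_gt0.
have [N1 hN1] := cvge0_eventually L2 e0.
have [N2 hN2] := cvge0_eventually (L1 _ _ s0 IO) st0.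
apply: (@fatou_limit u phi T (2 * k) _ (maxn N1 N2)) => //.
- by case: uL.
- by move=> i; exact: smooth_measurable.
- by rewrite mulr_gt0.
move=> i; rewrite geq_max => /andP[iN1 iN2].
have [_ gi hE] := energy_split (sphi i) vL mT TO (hN1 i iN1).
set E := \int[m]_(x in T) enorm (grad (phi i) x) ^+ 2 in hE.
have E0 : 0 <= E by apply: Rintegral_ge0 => x _; exact: sqr_ge0.
have [fi _] := smooth_ball_integrable (sphi i) s0 IO.
have ui := L1loc_ball_integrable uL s0 IO.
have [_ hd] := avg_diff s0 B0O fi ui (hN2 i iN2).
rewrite -/B0 -/b ler_pM2r ?fine_gt0// in hd.
set d := avg m B0 (phi i) in hd.
have d2 : d ^+ 2 <= (2 * Ct + 2) * (S + t).
  have h : (d - b) ^+ 2 <= t.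
    rewrite -real_normK ?num_real// -[leRHS]sqr_sqrtr ?(ltW t0)//.
    by rewrite lerXn2r ?nnegrE ?sqrtr_ge0.
  apply: (@le_trans _ _ (2 * b ^+ 2 + 2 * (d - b) ^+ 2)).
    by rewrite -subr_ge0 (_ : _ - _ = (2 * b - d) ^+ 2) ?sqr_ge0//; ring.
  have := mulr_gt0 Ct0 t0; move: hb h S0; move: (b ^+ 2) ((d - b) ^+ 2) => x y; lra.
have mphi := smooth_measurable (sphi i).
have sb := sob T j I0 z mT TO Tz mT0 tel (phi i) _ (measurable_funS mOm TO mphi)
  (fun X TX => smooth_continuous (sphi i) (TO X TX))
  (smooth_poincare (sphi i)) (nn (grad (phi i))) gi.
rewrite -[avd _ I0]/d -/E in sb.
have ES : len j ^+ 2 * (E / fine (m T)) <= 2 * (S + t).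
  have -> : 2 * (S + t) = len j ^+ 2 * ((2 * EV + 2 * e) / fine (m T)).
    by rewrite /S /e; field; rewrite !gt_eqF.
  by rewrite ler_pM2l ?exprn_gt0// ler_pM2r ?invr_gt0.
have k20 : 0 <= 2 * k by rewrite mulr_ge0// ltW.
have St0 : 0 <= S + t by rewrite addr_ge0// ltW.
have mp (f : Rn -> R) : measurable_fun T f ->
    measurable_fun T (fun x => (`|f x| `^ (2 * k))%:E).
  move=> mf; apply/measurable_EFinP; apply: (measurableT_comp (measurable_powR _)).
  exact: measurableT_comp.
have mphiT : measurable_fun T (phi i) by exact: measurable_funS mphi.
have md : measurable_fun T (fun x => phi i x - d).
  by apply: measurable_funB => //; exact: measurable_cst.
have nnp (f : Rn -> R) x : T x -> (0 <= (`|f x| `^ (2 * k))%:E)%E.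
  by move=> _; rewrite lee_fin powR_ge0.
have msum : measurable_fun T
    (fun x => (`|phi i x - d| `^ (2 * k))%:E + (`|d| `^ (2 * k))%:E)%E.
  by apply: emeasurable_funD; [exact: (mp _ md)|exact: measurable_cst].
apply: (@le_trans _ _ (\int[m]_(x in T) ((2 `^ (2 * k))%:E *
    ((`|phi i x - d| `^ (2 * k))%:E + (`|d| `^ (2 * k))%:E)))%E).
  apply: ge0_le_integral => //.
  - exact: mp.
  - exact: measurable_funeM.
  move=> x Tx; rewrite -EFinD -EFinM lee_fin -{1}(subrK d (phi i x)).
  exact: powR_normD_le.
have p0 x : T x -> (0 <= (`|phi i x - d| `^ (2 * k))%:E + (`|d| `^ (2 * k))%:E)%E.
  by move=> Tx; rewrite adde_ge0// lee_fin powR_ge0.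
have p1 : (0 <= (2 `^ (2 * k) : R)%:E)%E by rewrite lee_fin powR_ge0.
have p2 x : T x -> (0 <= (`|d| `^ (2 * k))%:E)%E by rewrite lee_fin powR_ge0.
rewrite (ge0_integralZl m mT msum p0 p1).
rewrite (ge0_integralD m mT (nnp _) (mp _ md) p2 (measurable_cst _)).
have mTE : m T = (fine (m T))%:E by rewrite fineK// ge0_fin_numE//; case/andP: mT0.
rewrite (integral_cst m mT) [in X in (_ * (_ + X))%E]mTE.
apply: (@le_trans _ _ ((2 `^ (2 * k))%:E * ((Cs * (2 * (S + t)) `^ k * fine (m T))%:E +
    (((2 * Ct + 2) * (S + t)) `^ k * fine (m T))%:E))%E).
  apply: lee_wpmul2l; first by rewrite lee_fin powR_ge0.
  apply: leeD.
    apply: le_trans sb _; rewrite lee_fin; apply: ler_wpM2r; first exact: ltW.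
    apply: ler_wpM2l; first exact: ltW.
    apply: ge0_ler_powR; rewrite ?nnegrE ?(ltW k0)//.
      by rewrite mulr_ge0 ?exprn_ge0 ?divr_ge0// ltW.
    by rewrite mulr_ge0.
  rewrite -EFinM lee_fin; apply: ler_wpM2r; first exact: ltW.
  rewrite powRrM -[_ `^ 2]/(_ `^ 2%:R) powR_mulrn// real_normK ?num_real//.
  apply: ge0_ler_powR; rewrite ?nnegrE ?(ltW k0) ?sqr_ge0//.
  by apply: le_trans d2; exact: sqr_ge0.
have Ct2 : 0 <= 2 * Ct + 2 by rewrite addr_ge0// mulr_ge0// ltW.
rewrite -EFinD -EFinM lee_fin !powRM// /C; apply: eqW.
by move: (2 `^ _) (2 `^ k) (_ `^ k) (_ `^ k) => x1 x2 x3 x4; ring.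
Qed.

End Analysis.

Theorem theorem1p4 (R : realType) (n : nat) (Om : set 'rV[R]_n)
    (m mu : {measure set 'rV[R]_n -> \bar R})
    (C1 C3 C4 C5 C6 : R) (N : nat)
    (D : int -> set (set 'rV[R]_n)) (a0 : R)
    (M : nat) (c C0 : R)
    (Z : int -> set 'rV[R]_n -> dyadic n -> dyadic n -> nat -> 'rV[R]_n) :
  domain Om -> ~ bounded_set (boundary Om) ->
  finite_on_boundary_balls Om mu ->
  0 < C1 -> 0 < C3 -> 0 < C4 -> 0 < C5 -> 0 < C6 ->
  H1 Om C1 -> H2 Om C1 N -> H3 Om mu C3 -> H4 Om m C4 -> H5 Om m mu C5 ->
  H6a Om m -> H6b Om m C6 ->
  0 < a0 -> christ_cubes Om D a0 ->
  0 < c -> 0 < C0 -> harnack_chains Om C1 D M c C0 Z ->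
  exists k C : R, 1 < k /\ 0 < C /\
    forall (j : int) (Q : set 'rV[R]_n), D j Q ->
    forall (u : 'rV[R]_n -> R) (v : 'rV[R]_n -> 'rV[R]_n),
      energy_gradient Om m u v ->
      {ae mu, forall x, dilate Om 2 j Q x -> has_trace Om m C1 D u x 0} ->
      let T := tent2 Om C1 D M Z j Q in
      (poweR (eavg m T (fun x => (`|u x| `^ (2 * k))%:E)) (2 * k)^-1 <=
         (C * len j)%:E *
         poweR (eavg m T (fun x => (enorm (v x) ^+ 2)%:E)) 2^-1)%E.
Proof.
move=> [oOm _ Om0] ub mufin C1_gt0 C3_gt0 C4_gt0 C5_gt0 C6_gt0 h1 _ h3 h4 h5 _ h6.
move=> a0_gt0 hD c_gt0 C0_gt0 hZ.
(* In dimension 0 the space is a single point, against the unboundedness of the boundary. *)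
have n0 : (0 < n)%N.
  rewrite lt0n; apply/eqP => n0; apply: ub; exists 0; split; first exact: num_real.
  move=> B B0 x _ /=; apply: le_trans (norm_le_enorm x) _.
  rewrite /enorm big1 ?sqrtr0 ?ltW// => i _.
  by exfalso; have := ltn_ord i; rewrite {2}n0.
have b0 : boundary Om !=set0.
  apply/set0P/eqP => b0; apply: ub; rewrite b0.
  by exists 0; split => // B _ x [].
have mO : measurable Om := borel_open oOm.
have [mOm0|mOm0] := eqVneq (m Om) 0%E; last first.
  have [k [C [k1 C_gt0 h]]] := energy_tent oOm Om0 C4_gt0 h4 mOm0 C6_gt0 h6
    mufin C3_gt0 h3 C5_gt0 h5 n0 b0 C1_gt0 h1 a0_gt0 hD c_gt0 C0_gt0 hZ.
  have k20 : 0 < 2 * k by rewrite mulr_gt0// (lt_trans ltr01).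
  exists k, (C `^ (2 * k)^-1); split=> //; split; first exact: powR_gt0.
  move=> j Q DQ u v euv tr0; cbv zeta; set T := tent2 Om C1 D M Z j Q.
  have [mT0 vi uk] := h j Q DQ u v euv tr0.
  have mT : measurable T by exact: tent_measurable.
  have mt0 : 0 < fine (m T) by exact: fine_gt0.
  rewrite -[eavg m T (fun x => (enorm _ ^+ 2)%:E)]/(eavg m T (EFin \o _)) eavgE//.
  set EV := \int[m]_(x in T) _ in uk *.
  have EV0 : 0 <= EV by apply: Rintegral_ge0 => x _; exact: sqr_ge0.
  have e0 : 0 <= EV / fine (m T) by rewrite divr_ge0// ltW.
  have l0 := len_gt0 (R := R) j.
  rewrite poweR_EFin powR12_sqrt// -EFinM.
  set S := len j ^+ 2 * (EV / fine (m T)) in uk.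
  have S0 : 0 <= S by rewrite mulr_ge0// exprn_ge0// ltW.
  have uavg : (eavg m T (fun x => (`|u x| `^ (2 * k))%:E) <= (C * S `^ k)%:E)%E.
    rewrite /eavg inve_fin//.
    apply: le_trans (lee_wpmul2r _ uk) _; first by rewrite lee_fin invr_ge0 ltW.
    by rewrite -EFinM mulfK ?gt_eqF.
  have uavg0 : (0 <= eavg m T (fun x => (`|u x| `^ (2 * k))%:E))%E.
    rewrite /eavg inve_fin//; apply: mule_ge0; last by rewrite lee_fin invr_ge0 ltW.
    by apply: integral_ge0 => x _; rewrite lee_fin powR_ge0.
  have CS0 : 0 <= C * S `^ k by rewrite mulr_ge0 ?powR_ge0// ltW.
  apply: le_trans (gt0_ler_poweR _ _ _ uavg) _.
  - by rewrite invr_ge0 ltW.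
  - by rewrite in_itv/= uavg0 leey.
  - by rewrite in_itv/= lee_fin CS0 leey.
  rewrite poweR_EFin lee_fin powRM ?powR_ge0 ?(ltW C_gt0)// -mulrA.
  apply: ler_wpM2l; first exact: powR_ge0.
  rewrite -powRrM (_ : k * (2 * k)^-1 = 2^-1); last first.
    by field; rewrite gt_eqF// (lt_trans ltr01).
  by rewrite powR12_sqrt// sqrtrM ?exprn_ge0 ?(ltW l0)// sqrtr_sqr ger0_norm// ltW.
(* Here [m T = 0]. The integral on the left vanishes, and its product with the inverse of [m T] is 0
   whatever value that inverse has in the extended reals. *)
exists 2, 1; split; first by rewrite ltr1n.
split => // j Q DQ u v [[mu' _] _ _] _; cbv zeta; set T := tent2 Om C1 D M Z j Q.
have mT : measurable T by exact: tent_measurable.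
have TO : T `<=` Om.
  have [KA [theta [L [_ _ _ geo]]]] := tent_geometry n0 oOm b0 C1_gt0 h1 hD c_gt0 C0_gt0 hZ.
  by have [I0 [_ TO _ _ _]] := geo j Q DQ.
have mT0 : m T = 0%E.
  by apply/eqP; rewrite -measure_le0 -mOm0; apply: le_measure; rewrite ?inE.
have -> : eavg m T (fun x => (`|u x| `^ (2 * 2))%:E) = 0%E.
  rewrite /eavg null_set_integral ?mul0e//.
  apply/measurable_EFinP; apply: (measurableT_comp (measurable_powR _)).
  by apply: measurableT_comp => //; exact: measurable_funS mu'.
rewrite poweR_EFin powR0 ?invr_neq0 ?mulf_neq0//.
by rewrite mule_ge0 ?poweR_ge0// lee_fin mul1r ltW// len_gt0.
Qed.
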